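(* Let $\sigma\in C([0,\infty);\mathbb{R}^{d\times r})$. Suppose that there exist $h>0$ and $L_h\in[0,\infty]$ such that \[ \lim_{n\to\infty}\int_{nh}^{(n+1)h}\|\sigma(s)\|_F^2\,ds\cdot\log n=L_h. \] Let $A$ be a $d\times d$ real matrix whose eigenvalues all have negative real parts, and for $\xi\in\mathbb{R}^d$ let $X(\cdot,\xi)$ be the unique continuous adapted process obeying \[ dX(t)=AX(t)\,dt+\sigma(t)\,dB(t),\quad t\ge 0;\quad X(0)=\xi. \] (i) If $L_h=0$, then $\lim_{t\to\infty}X(t,\xi)=0$ a.s. for each $\xi\in\mathbb{R}^d$. (ii) If $L_h\in(0,\infty)$, then there exist deterministic $0<c_1\le c_2<\infty$, independent of $\xi$, such that for each $\xi\in\mathbb{R}^d$ \[ c_1\le\limsup_{t\to\infty}\|X(t,\xi)\|\le c_2,\quad \liminf_{t\to\infty}\|X(t,\xi)\|=0,\quad\text{a.s.} \] and \[ \lim_{t\to\infty}\frac1t\int_0^t\|X(s,\xi)\|^2\,ds=0,\quad\text{a.s.} \] (iii) If $L_h=+\infty$, then $\limsup_{t\to\infty}\|X(t,\xi)\|=+\infty$ a.s. for each $\xi\in\mathbb{R}^d$.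
   Context: $d,r$ are positive integers, $B$ is an $r$-dimensional standard Brownian motion, $\sigma$ is deterministic, $\|\cdot\|$ is the Euclidean norm on $\mathbb{R}^d$, and $\|\cdot\|_F$ is the Frobenius norm on $\mathbb{R}^{d\times r}$. *)

(* Defs.v *)
From HB Require Import structures.
From mathcomp Require Import all_boot all_order all_algebra.
From mathcomp Require Import all_classical all_reals all_analysis.
From mathcomp Require Export complex.

Set Implicit Arguments.
Unset Strict Implicit.
Unset Printing Implicit Defensive.

Import Order.TTheory GRing.Theory Num.Theory.
Import numFieldNormedType.Exports.

Local Open Scope classical_set_scope.
Local Open Scope ring_scope.

Section norms.
Context {R : realType}.

(* The library's norm on matrices is the max norm, hence these two. *)
Definition enorm (n : nat) (x : 'cV[R]_n) : R :=
  Num.sqrt (\sum_(i < n) x i 0 ^+ 2).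

Definition fnorm (m n : nat) (M : 'M[R]_(m, n)) : R :=
  Num.sqrt (\sum_(i < m) \sum_(j < n) M i j ^+ 2).

End norms.

(* The library's eigenvalue only sees eigenvalues in the ground field, so a
   real matrix is first embedded in the complex matrices. *)
Definition stable_mx (R : realType) (n : nat) (A : 'M[R]_n) : Prop :=
  forall z : R[i], eigenvalue (map_mx (real_complex R) A) z -> complex.Re z < 0.

(* Processes are functions R -> T -> 'cV[R]_n of which only the values at times
   t >= 0 matter. *)
Section processes.
Context {R : realType} {disp : measure_display} {T : measurableType disp}.
Variable P : probability T R.

Definition sigma_gen (n : nat) (Y : T -> 'cV[R]_n) : set (set T) :=
  <<s [set E | exists i : 'I_n, exists2 U : set R, measurable U &
                 E = (fun w => Y w i 0) @^-1` U] >>.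

(* No completeness or right-continuity is required. *)
Definition filtration (F : R -> set (set T)) : Prop :=
  (forall t, 0 <= t -> sigma_algebra setT (F t) /\ F t `<=` measurable) /\
  (forall s t, 0 <= s -> s <= t -> F s `<=` F t).

Definition adapted (F : R -> set (set T)) (n : nat)
    (X : R -> T -> 'cV[R]_n) : Prop :=
  forall t, 0 <= t -> sigma_gen (X t) `<=` F t.

Definition continuous_process (n : nat) (X : R -> T -> 'cV[R]_n) : Prop :=
  {ae P, forall w, {within `[0, +oo[, continuous (fun t => X t w)}}.

Definition independent_classes (G H : set (set T)) : Prop :=
  forall E E', G E -> H E' -> P (E `&` E') = (P E * P E')%E.

(* Y has law N(0, v I_n), the n-fold product of the law N(0, v) on R; the second
   argument of normal_prob is the standard deviation. *)
Definition isotropic_normal (n : nat) (v : R) (Y : T -> 'cV[R]_n) : Prop :=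
  forall U : 'I_n -> set R, (forall i, measurable (U i)) ->
    P [set w | forall i, U i (Y w i 0)] =
    (\prod_(i < n) normal_prob 0 (Num.sqrt v) (U i))%E.

(* The strict inequality s < t in the law of the increments matters, as
   normal_prob is not a Dirac mass for standard deviation 0. *)
Definition brownian_motion (F : R -> set (set T)) (r : nat)
    (B : R -> T -> 'cV[R]_r) : Prop :=
  [/\ {ae P, forall w, B 0 w = 0},
      continuous_process B,
      adapted F B,
      (forall s t, 0 <= s -> s < t ->
         independent_classes (F s) (sigma_gen (fun w => B t w - B s w))) &
      (forall s t, 0 <= s -> s < t ->
         isotropic_normal (t - s) (fun w => B t w - B s w))].

Section wiener_integral.
Context {m r : nat}.
Implicit Types (p : seq R) (c : nat -> 'M[R]_(m, r)).

(* For p = [:: t_1; ..; t_N] with 0 = t_0 < t_1 < .. < t_N, the step function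
   equal to c k on ]t_k, t_{k+1}], and its integral against B. *)
Definition step_fun p c (s : R) : 'M[R]_(m, r) :=
  \sum_(k < size p) \1_(`]nth 0 (0 :: p) k, nth 0 p k]%classic) s *: c k.

Definition step_integral p c (B : R -> T -> 'cV[R]_r) (w : T) : 'cV[R]_m :=
  \sum_(k < size p) c k *m (B (nth 0 p k) w - B (nth 0 (0 :: p) k) w).

(* I is (a version of) int_0^t sigma(s) dB(s) for deterministic sigma: the
   L^2(P)-limit of the integrals of step functions along any sequence of step
   functions which converges to sigma in L^2([0, t]). *)
Definition is_wiener_integral (sigma : R -> 'M[R]_(m, r))
    (B : R -> T -> 'cV[R]_r) (t : R) (I : T -> 'cV[R]_m) : Prop :=
  sigma_gen I `<=` measurable /\
  forall (p : nat -> seq R) (c : nat -> nat -> 'M[R]_(m, r)),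
    (forall n, itv_partition 0 t (p n)) ->
    (\int[lebesgue_measure]_(s in `[0%R, t])
       (fnorm (step_fun (p n) (c n) s - sigma s) ^+ 2)%:E)%E
      @[n --> \oo] --> 0%E ->
    (\int[P]_w (enorm (I w - step_integral (p n) (c n) B w) ^+ 2)%:E)%E
      @[n --> \oo] --> 0%E.

End wiener_integral.

Definition vint (n : nat) (f : R -> 'cV[R]_n) (t : R) : 'cV[R]_n :=
  \col_i (\int[lebesgue_measure]_(s in `[0, t]) f s i 0).

(* X is a continuous adapted process with
     dX(t) = A X(t) dt + sigma(t) dB(t), t >= 0;  X(0) = xi.
   M is the continuous version of the process of stochastic integrals. *)
Definition sde_solution (F : R -> set (set T)) (n r : nat) (A : 'M[R]_n)
    (sigma : R -> 'M[R]_(n, r)) (B : R -> T -> 'cV[R]_r)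
    (xi : 'cV[R]_n) (X : R -> T -> 'cV[R]_n) : Prop :=
  [/\ continuous_process X,
      adapted F X &
      exists M : R -> T -> 'cV[R]_n,
        [/\ continuous_process M,
            (forall t, 0 <= t -> is_wiener_integral sigma B t (M t)) &
            {ae P, forall w, forall t, 0 <= t ->
               X t w = xi + vint (fun s => A *m X s w) t + M t w}]].

End processes.

(* Main.v *)
Require Import Defs.
From HB Require Import structures.
From mathcomp Require Import all_boot all_order all_algebra.
From mathcomp Require Import all_classical all_reals all_analysis.
From mathcomp Require Import measurable_realfun.
From mathcomp Require Import spectral.
From mathcomp Require Import ring lra zify.

Set Implicit Arguments.
Unset Strict Implicit.
Unset Printing Implicit Defensive.

Import Order.TTheory GRing.Theory Num.Theory.
Import numFieldNormedType.Exports.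
Import HBNNSimple.

Local Open Scope classical_set_scope.
Local Open Scope ring_scope.

(** Write M(t) for the stochastic integral of sigma up to time t, and v_n for the
integral of the squared Frobenius norm of sigma over I_n = [nh, (n+1)h]. The
theorem compares v_n with 1 / log n, because the increments of M over I_n are
Gaussian with total variance v_n, independent for different n: up to constants in
the exponent they exceed a level e with probability exp(- e^2 / v_n), a power of n.

Upper bounds. Exponential Chebyshev bounds applied to dyadic sums of Brownian
increments ([walk_max]), then to their limit M ([wiener_max]) and to all times of
I_n by continuity ([maximal_event]), give a probability at most
C exp(- e^2 / (8 v_n)) that M oscillates by more than e over I_n. If v_n log n < c
eventually, the bound is C n^(- e^2 / (8 c)). It is summable for e^2 >= 16 c, so
the oscillations are eventually at most e ([small_increments]). For every e > 0
it is summable against the weights 1/n, which says that the n with an oscillation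
larger than e have a finite sum of 1/n ([rare_increments]), hence density zero by
Kronecker's lemma.

Lower bounds. Given the past, some coordinate of the increment over I_n carries a
share v_n / d of the variance, and a second moment argument ([walk_lower]) bounds
the conditional probability that it exceeds y below by a constant times
exp(- 16 d y^2 / v_n). If v_n log n is eventually at least 16 d y^2, this is at
least a multiple of 1/n, and the conditional Borel-Cantelli lemma makes increments
larger than y/2 occur infinitely often ([wiener_io]).

Transfer to the solution, path by path. A stable matrix has a quadratic Lyapunov
function q ([lyapunov]). Since X - M solves a linear equation forced by M, an
increment of M of size at most e over I_n yields
q(X((n+1)h)) <= rho q(X(nh)) + C e^2 with rho < 1 ([recursion]). Hence X is
eventually at most D e when the increments of M are eventually at most e
([path_bound]), and the time average of the squared norm of X tends to zero when
the squared increments average to zero ([path_average]); the latter also forces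
the limit inferior to vanish. Conversely X cannot stay below K on I_n unless the
increment of M over I_n is at most D K ([path_lower]). The constants D depend on
A and h only, so that no bound depends on the initial value.

When L = 0 every threshold c may be chosen, so e may be taken arbitrarily small;
when 0 < L < +oo the thresholds L + 1 and L / 2 give the two bounds on the limit
superior; when L = +oo the level y is arbitrary. *)

(** * Euclidean geometry and a Lyapunov norm *)

Section euclidean_norm.
Context {R : realType}.
Implicit Types m n : nat.

Definition dot n (x y : 'cV[R]_n) : R := \sum_(i < n) x i 0 * y i 0.

Lemma enorm_ge0 n (x : 'cV[R]_n) : 0 <= enorm x.
Proof. exact: sqrtr_ge0. Qed.

Lemma enorm_sqr n (x : 'cV[R]_n) : enorm x ^+ 2 = dot x x.
Proof.
rewrite sqr_sqrtr; last by apply: sumr_ge0 => i _; exact: sqr_ge0.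
by apply: eq_bigr => i _; rewrite expr2.
Qed.

Lemma fnorm_sqr m n (M : 'M[R]_(m, n)) :
  fnorm M ^+ 2 = \sum_(i < m) \sum_(j < n) M i j ^+ 2.
Proof.
rewrite sqr_sqrtr//; apply: sumr_ge0 => i _.
by apply: sumr_ge0 => j _; exact: sqr_ge0.
Qed.

Lemma dotDr n (x y z : 'cV[R]_n) : dot x (y + z) = dot x y + dot x z.
Proof. by rewrite -big_split; apply: eq_bigr => i _; rewrite mxE mulrDr. Qed.

Lemma dotC n (x y : 'cV[R]_n) : dot x y = dot y x.
Proof. by apply: eq_bigr => i _; rewrite mulrC. Qed.

(** By Lagrange's identity the difference of the two sides is half the sum of the
squares (f i * g j - f j * g i) ^+ 2. *)
Lemma cauchy_schwarz_sum (I : finType) (f g : I -> R) :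
  (\sum_i f i * g i) ^+ 2 <= (\sum_i f i ^+ 2) * (\sum_i g i ^+ 2).
Proof.
rewrite expr2 !big_distrlr /= -subr_ge0.
have -> : \sum_i \sum_j f i ^+ 2 * g j ^+ 2 =
    \sum_i \sum_j (f i ^+ 2 * g j ^+ 2 + f j ^+ 2 * g i ^+ 2) / 2.
  under [RHS]eq_bigr do under eq_bigr do rewrite mulrDl.
  under [RHS]eq_bigr do rewrite big_split.
  rewrite big_split /= [X in _ = _ + X]exchange_big /= -big_split.
  apply: eq_bigr => i _; rewrite -big_split; apply: eq_bigr => j _ /=; lra.
rewrite -sumrB; apply: sumr_ge0 => i _; rewrite -sumrB; apply: sumr_ge0 => j _.
have -> : (f i ^+ 2 * g j ^+ 2 + f j ^+ 2 * g i ^+ 2) / 2 - f i * g i * (f j * g j)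
  = (f i * g j - f j * g i) ^+ 2 / 2 by lra.
by rewrite divr_ge0 ?sqr_ge0.
Qed.

Lemma dot_le n (x y : 'cV[R]_n) : dot x y <= enorm x * enorm y.
Proof.
rewrite -sqrtrM; last by apply: sumr_ge0 => i _; exact: sqr_ge0.
by apply: le_trans (ler_norm _) _; rewrite -sqrtr_sqr ler_wsqrtr// cauchy_schwarz_sum.
Qed.

Lemma enormD n (x y : 'cV[R]_n) : enorm (x + y) <= enorm x + enorm y.
Proof.
have h0 := addr_ge0 (enorm_ge0 x) (enorm_ge0 y).
rewrite -(ler_pXn2r (n := 2))// ?nnegrE ?enorm_ge0//.
rewrite sqrrD !enorm_sqr dotDr dotC dotDr [dot (x + y) y]dotC dotDr [dot y x]dotC.
have := dot_le x y; lra.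
Qed.

Lemma enormN n (x : 'cV[R]_n) : enorm (- x) = enorm x.
Proof. by congr Num.sqrt; apply: eq_bigr => i _; rewrite mxE sqrrN. Qed.

Lemma enormB n (x y : 'cV[R]_n) : enorm (x - y) <= enorm x + enorm y.
Proof. by rewrite -(enormN y) enormD. Qed.

Lemma enorm_mulmx m n (K : 'M[R]_(m, n)) (x : 'cV[R]_n) :
  enorm (K *m x) <= fnorm K * enorm x.
Proof.
rewrite -sqrtrM; last by apply: sumr_ge0 => i _; apply: sumr_ge0 => j _; exact: sqr_ge0.
apply: ler_wsqrtr; rewrite mulr_suml; apply: ler_sum => i _.
by rewrite mxE; exact: cauchy_schwarz_sum.
Qed.

Lemma coord_le_enorm n (x : 'cV[R]_n) i : `|x i 0| <= enorm x.
Proof.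
rewrite -sqrtr_sqr ler_wsqrtr// (bigD1 i)//= lerDl.
by apply: sumr_ge0 => j _; exact: sqr_ge0.
Qed.

Lemma enorm_le_coord n (x : 'cV[R]_n) c :
  (forall i, `|x i 0| <= c) -> enorm x ^+ 2 <= n%:R * c ^+ 2.
Proof.
move=> xc; rewrite enorm_sqr mulr_natl -[n in leRHS]card_ord -sumr_const.
apply: ler_sum => i _; rewrite -expr2 -real_normK ?num_real//.
by rewrite ler_pXn2r ?nnegrE ?(le_trans _ (xc i)).
Qed.

End euclidean_norm.

Section lyapunov.
Context {R : realType}.

Let cross (u t v : R[i]) : R := complex.Re u * complex.Re (t * v) + complex.Im u * complex.Im (t * v).
Let nsq (u : R[i]) : R := complex.Re u ^+ 2 + complex.Im u ^+ 2.

Let cross_le (u t v : R[i]) :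
  cross u t v <= (`|complex.Re t| + `|complex.Im t|) * (nsq u + nsq v).
Proof.
case: u t v => [a b] [s t] [p q]; rewrite /cross /nsq /=.
have H (x y z : R) : x * y * z <= `|y| * ((x ^+ 2 + z ^+ 2) / 2).
  rewrite mulrAC mulrC; apply: le_trans (ler_norm _) _.
  rewrite normrM ler_wpM2l//.
  by have := sqr_ge0 (`|x| - `|z|); rewrite normrM sqrrB !real_normK ?num_real//; lra.
have := H a s p; have := H a (- t) q; have := H b s q; have := H b t p.
have : 0 <= (`|s| + `|t|) * (a ^+ 2 + b ^+ 2 + (p ^+ 2 + q ^+ 2)).
  by rewrite mulr_ge0 ?addr_ge0 ?sqr_ge0.
rewrite normrN; lra.
Qed.

Let sum_pairs n (c : R) (s : 'I_n -> R) :
  \sum_i \sum_j c * (s i + s j) = c * (2 * n%:R) * \sum_i s i.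
Proof.
under eq_bigr => i _.
  rewrite -mulr_sumr big_split /= sumr_const card_ord -[s i *+ n]mulr_natl.
  over.
rewrite -mulr_sumr big_split /= sumr_const card_ord -mulr_sumr.
by rewrite -[_ *+ n]mulr_natl; ring.
Qed.

(** Over the complex numbers A is unitarily similar to a triangular matrix whose
diagonal entries, the eigenvalues, have real parts at most - al for some al > 0.
Conjugating with the diagonal matrix of the powers of a small kap leaves the
diagonal unchanged and multiplies the entries off the diagonal by positive powers
of kap, so that their contribution is at most al / 2. The real matrix N stacks the
real and imaginary parts of this complex change of coordinates; its left inverse
N' makes the seminorm x |-> enorm (N *m x) a norm. *)
Lemma lyapunov n (A : 'M[R]_n) : (0 < n)%N -> stable_mx A ->
  exists m (N : 'M[R]_(m, n)) (N' : 'M[R]_(n, m)) (al : R),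
    [/\ 0 < al, N' *m N = 1%:M &
        forall x, dot (N *m x) (N *m (A *m x)) <= - al * dot (N *m x) (N *m x)].
Proof.
move=> n0 stA; set AC := map_mx (real_complex R) A.
have [P Pu /=] := Schur AC n0; rewrite /similar_to /= => Ttrig.
have Punit := unitarymx_unit Pu.
set T := conjmx P AC in Ttrig.
have PA : P *m AC = T *m P by rewrite /T conjumx// mulmxKV.
have Tdiag i : complex.Re (T i i) < 0.
  apply: stA; apply: (@eigenvalue_conjmx _ _ _ P).
  - by apply: submx_full; rewrite row_full_unit.
  - by rewrite row_free_unit.
  rewrite -[_ \in _]/(eigenvalue T (T i i)) eigenvalue_root_char (char_poly_trig Ttrig).
  by rewrite (bigD1 i)//= rootM root_XsubC eqxx.
pose al : R := \big[Order.min/1]_(i < n) (- complex.Re (T i i)).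
have al0 : 0 < al by apply: lt_bigmin => // i _; rewrite oppr_gt0.
have Tal i : complex.Re (T i i) <= - al by rewrite lerNr; exact: bigmin_le.
pose tij i j : R := `|complex.Re (T i j)| + `|complex.Im (T i j)|.
have tij0 i j : 0 <= tij i j by rewrite addr_ge0.
pose tau : R := 1 + \sum_i \sum_j tij i j.
have taub i j : tij i j <= tau.
  rewrite /tau (bigD1 i)//= (bigD1 j)//=.
  have : 0 <= \sum_(i0 < n | i0 != j) tij i i0 by apply: sumr_ge0.
  have : 0 <= \sum_(i0 < n | i0 != i) \sum_(j0 < n) tij i0 j0.
    by apply: sumr_ge0 => k _; apply: sumr_ge0.
  lra.
have tau0 : 0 < tau.
  rewrite /tau; have : 0 <= \sum_(i0 < n) \sum_(j0 < n) tij i0 j0.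
    by apply: sumr_ge0 => k _; apply: sumr_ge0.
  lra.
have n0' : 0 < n%:R :> R by rewrite ltr0n.
pose kap : R := Num.min 1 (al / (4 * n%:R * tau)).
have kap0 : 0 < kap by rewrite lt_min ltr01 divr_gt0// !mulr_gt0.
have kap1 : kap <= 1 by rewrite ge_min lexx.
(* The sum over all pairs (i, j) below contains each index 2 n times. *)
have kaptau : kap * tau * (2 * n%:R) <= al / 2.
  have : kap <= al / (4 * n%:R * tau) by rewrite ge_min lexx orbT.
  rewrite ler_pdivlMr ?mulr_gt0//; lra.
pose uc (x : 'cV[R]_n) i := (P *m map_mx (real_complex R) x) i 0.
have ReS (F : 'I_n -> R[i]) : complex.Re (\sum_i F i) = \sum_i complex.Re (F i).
  by apply: (big_morph (@complex.Re R)) => // -[a b] [c d].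
have ImS (F : 'I_n -> R[i]) : complex.Im (\sum_i F i) = \sum_i complex.Im (F i).
  by apply: (big_morph (@complex.Im R)) => // -[a b] [c d].
have ucA x i : uc (A *m x) i = \sum_j T i j * uc x j.
  by rewrite /uc map_mxM mulmxA PA -mulmxA mxE.
pose N1 : 'M[R]_n := \matrix_(i, j) (kap ^+ i * complex.Re (P i j)).
pose N2 : 'M[R]_n := \matrix_(i, j) (kap ^+ i * complex.Im (P i j)).
have ReN x i : (N1 *m x) i 0 = kap ^+ i * complex.Re (uc x i).
  rewrite mxE /uc mxE ReS mulr_sumr; apply: eq_bigr => j _; rewrite !mxE.
  by case: (P i j) => a b /=; ring.
have ImN x i : (N2 *m x) i 0 = kap ^+ i * complex.Im (uc x i).
  rewrite mxE /uc mxE ImS mulr_sumr; apply: eq_bigr => j _; rewrite !mxE.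
  by case: (P i j) => a b /=; ring.
have dotN x y : dot (col_mx N1 N2 *m x) (col_mx N1 N2 *m y) =
    \sum_(i < n) kap ^+ i * kap ^+ i * (complex.Re (uc x i) * complex.Re (uc y i) +
                    complex.Im (uc x i) * complex.Im (uc y i)).
  rewrite /dot big_split_ord/= -big_split; apply: eq_bigr => i _ /=.
  rewrite !mul_col_mx !col_mxEu !col_mxEd !ReN !ImN; ring.
pose Q1 : 'M[R]_n := \matrix_(i, j) (complex.Re (invmx P i j) / kap ^+ j).
pose Q2 : 'M[R]_n := \matrix_(i, j) (- complex.Im (invmx P i j) / kap ^+ j).
exists (n + n)%N, (col_mx N1 N2), (row_mx Q1 Q2), (al / 2); split.
- by rewrite divr_gt0.
- rewrite mul_row_col; apply/matrixP => i j; rewrite !mxE -big_split/=.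
  have := congr1 (fun Mx : 'M[R[i]]_n => complex.Re (Mx i j)) (mulVmx Punit).
  rewrite !mxE ReS => e; transitivity (complex.Re ((i == j)%:R : R[i])).
    rewrite -e; apply: eq_bigr => k _; rewrite !mxE.
    have kk : kap ^+ k != 0 by rewrite expf_neq0// gt_eqF.
    case: (invmx P i k) (P k j) => a b [a' b'] /=.
    by field.
  by case: (i == j).
- move=> x; rewrite !dotN.
  pose p (i : 'I_n) := kap ^+ i * complex.Re (uc x i); pose q (i : 'I_n) := kap ^+ i * complex.Im (uc x i).
  pose s i := p i ^+ 2 + q i ^+ 2.
  have s0 i : 0 <= s i by rewrite addr_ge0 ?sqr_ge0.
  have -> : \sum_(i < n) kap ^+ i * kap ^+ i * (complex.Re (uc x i) * complex.Re (uc x i) +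
     complex.Im (uc x i) * complex.Im (uc x i)) = \sum_i s i.
    by apply: eq_bigr => i _; rewrite /s /p /q; ring.
  have row_le (i : 'I_n) : kap ^+ i * kap ^+ i * (complex.Re (uc x i) * complex.Re (uc (A *m x) i) +
      complex.Im (uc x i) * complex.Im (uc (A *m x) i)) <=
      - al * s i + \sum_j kap * tau * (s i + s j).
    rewrite ucA ReS ImS !mulr_sumr -big_split /= mulr_sumr.
    have -> : - al * s i = \sum_j (if j == i then - al * s i else 0).
      by rewrite -big_mkcond big_pred1_eq.
    rewrite -big_split; apply: ler_sum => j _ /=.
    rewrite -[leLHS]/(kap ^+ i * kap ^+ i * cross (uc x i) (T i j) (uc x j)).
    have c0 k : 0 <= kap ^+ k by rewrite exprn_ge0// ltW.
    have kt0 : 0 <= kap * tau * (s i + s j).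
      by apply: mulr_ge0; [apply: mulr_ge0; exact: ltW|exact: addr_ge0].
    case: (ltngtP i j) => [ij|ji|/val_inj ij].
    - rewrite (is_trig_mxP Ttrig)// -val_eqE gtn_eqF//.
      by rewrite /cross mul0r /= !mulr0 addr0 mulr0 add0r.
    - rewrite -val_eqE ltn_eqF// add0r.
      have -> : kap ^+ i = kap ^+ (i - j) * kap ^+ j by rewrite -exprD subnK// ltnW.
      have le_c := cross_le ((kap ^+ i)%:C%C * uc x i) (T i j) ((kap ^+ j)%:C%C * uc x j).
      have nsqE (k : 'I_n) : nsq ((kap ^+ k)%:C%C * uc x k) = s k.
        by rewrite /nsq /s /p /q; case: (uc x k) => a b /=; ring.
      have E : kap ^+ (i - j) * kap ^+ j * (kap ^+ (i - j) * kap ^+ j) *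
           cross (uc x i) (T i j) (uc x j) = kap ^+ (i - j) *
           cross ((kap ^+ i)%:C%C * uc x i) (T i j) ((kap ^+ j)%:C%C * uc x j).
        have -> : kap ^+ i = kap ^+ (i - j) * kap ^+ j by rewrite -exprD subnK// ltnW.
        by rewrite /cross; case: (uc x i) (T i j) (uc x j) => a b [t1 t2] [a' b'] /=; ring.
      rewrite E; apply: le_trans (ler_wpM2l (c0 _) le_c) _.
      rewrite !nsqE mulrA ler_wpM2r ?(addr_ge0 (s0 _) (s0 _))//.
      apply: ler_pM => //; last exact: taub.
      by rewrite -(subnSK ji) exprS ger_pMr// exprn_ile1// ltW.
    - move: kt0; rewrite -ij eqxx => kt0; apply: le_trans (_ : - al * s i <= _); last by rewrite lerDl.
      have := ler_wpM2r (s0 i) (Tal i); apply: le_trans.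
      by rewrite /cross /s /p /q; case: (uc x i) (T i i) => a b [t1 t2] /=; rewrite le_eqVlt; apply/orP; left; apply/eqP; ring.
  apply: le_trans (ler_sum _ (fun i _ => row_le i)) _.
  rewrite big_split /= -mulr_sumr.
  rewrite sum_pairs.
  have : 0 <= \sum_i s i by apply: sumr_ge0.
  move: (\sum_i s i) kaptau => S kt /(ler_wpM2r); move=> /(_ _ _ kt).
  lra.
Qed.
End lyapunov.

(** * Exponential moments and independence *)

Section product_integrals.
Context {R : realType} {disp : measure_display} {T : measurableType disp}.
Variable mu : {measure set T -> \bar R}.

(** The hypothesis is the claim for indicators f; it extends to simple functions by
linearity and to all nonnegative measurable f by monotone convergence. With W a
density, a weight or an indicator, this single extension argument yields the
integrals against a normal law, against a product law, and the product formula
for independent variables. *)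
Lemma integral_mul_comp d' (S : measurableType d') (Q : {measure set S -> \bar R})
    (W : T -> R) (Y : T -> S) (c : \bar R) :
  measurable_fun setT W -> (forall w, 0 <= W w) -> measurable_fun setT Y ->
  c \is a fin_num ->
  (forall U, measurable U ->
     (\int[mu]_w (W w * \1_U (Y w))%:E = c * Q U)%E) ->
  forall f : S -> R, measurable_fun setT f -> (forall x, 0 <= f x) ->
  (\int[mu]_w (W w * f (Y w))%:E = c * \int[Q]_x (f x)%:E)%E.
Proof.
move=> mW W0 mY cfin WY f mf f0.
have mfE : measurable_fun setT (EFin \o f) by exact/measurable_EFinP.
have simple (g : {nnsfun S >-> R}) :
    (\int[mu]_w (W w * g (Y w))%:E = c * \int[Q]_x (g x)%:E)%E.
  rewrite integralT_nnsfun sintegralE.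
  transitivity (\int[mu]_w (\sum_(x \in range g) x%:E *
      (W w * \1_(g @^-1` [set x]) (Y w))%:E))%E.
    apply: eq_integral => w _; rewrite {1}(fimfunE g) mulrC fsbig_finite//=.
    rewrite mulr_suml -sumEFin fsbig_finite//=; apply: eq_bigr => x _.
    by rewrite -EFinM -mulrA [X in x * X]mulrC.
  have g0 x w : (0 <= x%:E * (W w * \1_(g @^-1` [set x]) (Y w))%:E)%E.
    have [/eqP <-|gx] := boolP (g (Y w) == x).
      by rewrite mule_ge0// lee_fin ?mulr_ge0.
    rewrite indicE memNset ?mulr0 ?mule0//=; exact/eqP.
  rewrite ge0_integral_fsum//; last first.
    move=> x; apply: emeasurable_funM => //; apply/measurable_EFinP.
    apply: measurable_funM => //; apply: measurableT_comp => //.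
  rewrite [in RHS]ge0_mule_fsumr; last first.
    move=> x; have [x0|x0] := leP 0 x; first by rewrite mule_ge0.
    rewrite (_ : g @^-1` [set x] = set0) ?measure0 ?mule0// -subset0 => y /= gy.
    by move: x0; rewrite -gy ltNge fun_ge0.
  apply: eq_fsbigr => x; rewrite inE => -[y _ <-].
  rewrite ge0_integralZl//=.
  - by rewrite WY// muleCA.
  - apply/measurable_EFinP; apply: measurable_funM => //.
    exact: measurableT_comp.
  - by move=> w _; rewrite lee_fin mulr_ge0.
  - by rewrite lee_fin.
pose gn := nnsfun_approx measurableT mfE.
have gf x : (gn n x)%:E @[n --> \oo] --> (f x)%:E.
  by apply: (cvg_nnsfun_approx measurableT mfE) => // y _ /=; rewrite lee_fin.
have ndg x : nondecreasing_seq (fun n => (gn n x)%:E).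
  by move=> m n mn; rewrite lee_fin; exact/lefP/nd_nnsfun_approx.
transitivity (limn (fun n => \int[mu]_w (W w * gn n (Y w))%:E))%E.
  rewrite -monotone_convergence//.
  - apply: eq_integral => w _; apply/esym/cvg_lim => //.
    rewrite EFinM; under eq_fun do rewrite EFinM.
    by apply: cvgeZl => //; exact: gf.
  - move=> n; apply/measurable_EFinP; apply: measurable_funM => //.
    exact: measurableT_comp.
  - by move=> n w _; rewrite lee_fin mulr_ge0.
  - by move=> w _ m n mn; rewrite lee_fin ler_wpM2l//; exact: (ndg (Y w)).
under eq_fun do rewrite simple.
apply/cvg_lim => //; apply: cvgeZl => //.
rewrite [X in _ --> X](_ : _ = \int[Q]_x (limn (fun n => (gn n x)%:E)))%E; last first.
  by apply: eq_integral => x _; apply/esym/cvg_lim => //; exact: gf.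
apply: cvg_monotone_convergence => //.
- by move=> n; exact/measurable_EFinP.
- by move=> n x _; rewrite lee_fin.
Qed.

End product_integrals.

Section gaussian_mgf.
Context {R : realType}.

(** Completing the square turns the integrand into the density of the normal law
centred at a * s ^+ 2, which has total mass 1. *)
Lemma integral_expR_normal (a s : R) : s != 0 ->
  (\int[normal_prob 0 s]_x (expR (a * x))%:E = (expR (a ^+ 2 * s ^+ 2 / 2))%:E)%E.
Proof.
move=> s0.
rewrite -[LHS]mul1e -(@integral_mul_comp R _ _ (@lebesgue_measure R) _ _ (normal_prob 0 s)
  (normal_pdf 0 s) id 1%E); last 7 first.
- exact: measurable_normal_pdf.
- by move=> w; exact: normal_pdf_ge0.
- exact: measurable_id.
- by [].
- move=> U mU; rewrite mul1e /normal_prob [RHS]integral_mkcond.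
  by apply: eq_integral => x _; rewrite epatch_indic EFinM.
- by apply: measurableT_comp => //; exact: measurable_funM.
- by move=> x; exact: expR_ge0.
transitivity (\int[lebesgue_measure]_x ((expR (a ^+ 2 * s ^+ 2 / 2))%:E *
   (normal_pdf (a * s ^+ 2) s x)%:E))%E.
  apply: eq_integral => x _; rewrite -EFinM; congr EFin.
  rewrite !normal_pdfE// /normal_fun [RHS]mulrCA -[LHS]mulrA -!expRD.
  by congr (_ * expR _); rewrite !mulr2n; field; rewrite -mulr2n mulrn_eq0/= expf_eq0.
rewrite ge0_integralZl//.
- by rewrite integral_normal_pdf mule1.
- by apply/measurable_EFinP; exact: measurable_normal_pdf.
- by move=> x _; rewrite lee_fin normal_pdf_ge0.
Qed.

End gaussian_mgf.

Section independence.
Context {R : realType} {disp : measure_display} {T : measurableType disp}.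
Variable P : probability T R.

(** The product rule for events is first integrated in Z, with the event on Y fixed,
and then in Y, with the weight Z fixed. *)
Lemma integral_indep (Z Y : T -> R) (f : R -> R) :
  measurable_fun setT Z -> (forall w, 0 <= Z w) -> measurable_fun setT Y ->
  (forall U V, measurable U -> measurable V ->
     P (Z @^-1` U `&` Y @^-1` V) = P (Z @^-1` U) * P (Y @^-1` V))%E ->
  (\int[P]_w (Z w)%:E)%E \is a fin_num ->
  measurable_fun setT f -> (forall x, 0 <= f x) ->
  (\int[P]_w (Z w * f (Y w))%:E =
   (\int[P]_w (Z w)%:E) * (\int[P]_w (f (Y w))%:E))%E.
Proof.
move=> mZ Z0 mY ind Zfin mf f0.
have mk (g : T -> R) (mg : measurable_fun setT g) :
    exists g' : {RV P >-> R}, g = g' :> (T -> R).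
  pose g' : {mfun T >-> R} := HB.pack g (isMeasurableFun.Build _ _ _ _ _ mg).
  by exists g'.
have [Y' YE] := mk _ mY; have [Z' ZE] := mk _ mZ.
have mpre (g : T -> R) U : measurable_fun setT g -> measurable U ->
    measurable (g @^-1` U).
  by move=> mg mU; rewrite -[X in measurable X]setTI; exact: mg.
have ZY U : measurable U ->
    (\int[P]_w (Z w * \1_U (Y w))%:E = (\int[P]_w (Z w)%:E) * distribution P Y' U)%E.
  move=> mU; rewrite /distribution /pushforward -YE.
  transitivity (\int[P]_w (\1_(Y @^-1` U) w * `|Z w|)%:E)%E.
    by apply: eq_integral => w _; rewrite ger0_norm// mulrC.
  rewrite (@integral_mul_comp R _ _ P _ _ (distribution P Z') _ _ (P (Y @^-1` U)) _ _ _ _ _ (fun x => `|x|))//.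
  - rewrite ge0_integral_distribution//; last first.
    + by apply: measurableT_comp => //; exact: normr_measurable.
    rewrite muleC; congr (_ * _)%E; apply: eq_integral => w _.
    by rewrite /= -ZE ger0_norm.
  - by apply: measurable_indic; exact: mpre.
  - by apply: fin_num_measure; exact: mpre.
  - move=> V mV; transitivity (P (Z @^-1` V) * P (Y @^-1` U))%E; last first.
      by rewrite muleC ZE.
    rewrite -ind//.
    rewrite -[_ `&` _]setIT -integral_indic//; last by apply: measurableI; exact: mpre.
    apply: eq_integral => w _; rewrite indicI mulrC; congr EFin.
rewrite (@integral_mul_comp R _ _ P _ _ (distribution P Y') _ _ _ _ _ _ _ ZY)//.
rewrite ge0_integral_distribution//; last by apply: measurableT_comp.
by rewrite YE.
Qed.
End independence.

Section measurable_bigops.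
Context {R : realType} {d : measure_display} {T : measurableType d}.

Lemma measurable_big_prod I (s : seq I) (p : pred I) (f : I -> T -> R) :
  (forall i, p i -> measurable_fun setT (f i)) ->
  measurable_fun setT (fun w => \prod_(i <- s | p i) f i w).
Proof.
move=> mf; elim: s => [|i s IH]; first by (under eq_fun do rewrite big_nil); exact: measurable_cst.
under eq_fun do rewrite big_cons.
by case: (boolP (p i)) => [pi|_]; [apply: measurable_funM => //; exact: mf|exact: IH].
Qed.

Lemma measurable_big_sum I (s : seq I) (p : pred I) (f : I -> T -> R) :
  (forall i, p i -> measurable_fun setT (f i)) ->
  measurable_fun setT (fun w => \sum_(i <- s | p i) f i w).
Proof.
move=> mf; elim: s => [|i s IH]; first by (under eq_fun do rewrite big_nil); exact: measurable_cst.
under eq_fun do rewrite big_cons.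
by case: (boolP (p i)) => [pi|_]; [apply: measurable_funD => //; exact: mf|exact: IH].
Qed.

End measurable_bigops.

Section isotropic.
Context {R : realType} {disp : measure_display} {T : measurableType disp}.
Variable P : probability T R.

(** The hypothesis on Y is this formula for indicators. Functions replace indicators
one coordinate at a time: the induction is on the number of leading coordinates
at which G is arbitrary, the others being indicators. *)
Lemma isotropic_prod r (v : R) (Y : T -> 'cV[R]_r) (G : 'I_r -> R -> R) :
  isotropic_normal P v Y -> (forall i, measurable_fun setT (fun w => Y w i 0)) ->
  (forall i, measurable_fun setT (G i)) -> (forall i x, 0 <= G i x) ->
  (forall i, (\int[normal_prob 0 (Num.sqrt v)]_x (G i x)%:E)%E \is a fin_num) ->
  (\int[P]_w (\prod_(i < r) G i (Y w i 0))%:E =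
   (\prod_(i < r) fine (\int[normal_prob 0 (Num.sqrt v)]_x (G i x)%:E)%E)%:E)%E.
Proof.
move=> iso mY; set Q := normal_prob 0 (Num.sqrt v).
pose ind (g : R -> R) := exists2 U : set R, measurable U & g = \1_U.
suff H k : forall G : 'I_r -> R -> R,
    (forall i, measurable_fun setT (G i)) -> (forall i x, 0 <= G i x) ->
    (forall i, (\int[Q]_x (G i x)%:E)%E \is a fin_num) ->
    (forall i : 'I_r, (k <= i)%N -> ind (G i)) ->
    (\int[P]_w (\prod_(i < r) G i (Y w i 0))%:E =
     (\prod_(i < r) fine (\int[Q]_x (G i x)%:E)%E)%:E)%E.
  move=> mG G0 Gfin; apply: (H r) => // i; by rewrite leqNgt ltn_ord.
have Qind U : measurable U -> (\int[Q]_x (\1_U x)%:E = Q U)%E.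
  by move=> mU; rewrite integral_indic// setIT.
elim: k => [|k IH] {}G mG G0 Gfin Gind.
  have /boolp.choice[U UG] : forall i, exists U, measurable U /\ G i = \1_U.
    by move=> i; have [U mU GU] := Gind i (leq0n i); exists U.
  transitivity (P [set w | forall i, U i (Y w i 0)]).
    rewrite -[X in P X]setIT -integral_indic//; last first.
      rewrite (_ : mkset _ = \bigcap_(i in [set: 'I_r]) ((fun w => Y w i 0) @^-1` U i)).
        apply: fin_bigcap_measurable => // i _; rewrite -[X in measurable X]setTI.
        by apply: mY => //; exact: (UG i).1.
      by apply/seteqP; split => w /= Uw i; [move=> _|]; exact: Uw.
    apply: eq_integral => w _; congr EFin.
    under eq_bigr do rewrite (UG _).2 indicE.
    rewrite indicE; have [Uw|] := boolP (w \in _).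
      move: Uw; rewrite inE /= => Uw.
      by rewrite big1// => i _; rewrite mem_set.
    rewrite notin_setE /= => /existsNP[i Ui].
    by rewrite (bigD1 i)//= memNset ?mul0r.
  rewrite iso; last by move=> i; exact: (UG i).1.
  have -> : (\prod_(i < r) Q (U i) = \prod_(i < r) (fine (Q (U i)))%:E)%E.
    apply: eq_bigr => i _; rewrite fineK// fin_num_measure//; exact: (UG i).1.
  rewrite prodEFin.
  congr EFin; apply: eq_bigr => i _; congr fine.
  by rewrite (UG i).2 Qind//; exact: (UG i).1.
have [rk|kr] := leqP r k.
  by apply: IH => // i ki; have := ltn_ord i; rewrite ltnNge (leq_trans rk).
pose i0 := Ordinal kr.
rewrite [in RHS](bigD1 i0)//= mulrC EFinM fineK//.
under eq_integral do rewrite (bigD1 i0)//= mulrC.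
apply: (integral_mul_comp (Q := normal_prob 0 (Num.sqrt v)) (W := fun w => \prod_(i < r | i != i0) G i (Y w i 0))
  (Y := fun w => Y w i0 0)) => //.
- apply: measurable_big_prod => i _; apply: measurableT_comp => //.
- by move=> w; apply: prodr_ge0.
- exact: mY.
move=> U mU.
pose G' (i : 'I_r) : R -> R := if i == i0 then \1_(U : set R) else G i.
have G'0 : G' i0 = \1_(U : set R) by rewrite /G' eqxx.
have G'1 i : i != i0 -> G' i = G i by rewrite /G' => /negPf ->.
have := IH G'; rewrite (bigD1 i0)//= G'0 Qind// mulrC EFinM fineK; last exact: fin_num_measure.
under eq_bigr => i ii0 do rewrite G'1//.
move=> <-.
- apply: eq_integral => w _; rewrite [in RHS](bigD1 i0)//= G'0 mulrC.
  by congr (_ * _)%:E; apply: eq_bigr => i ii0; rewrite G'1.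
- move=> i; rewrite /G'; case: ifP => // _; exact: measurable_indic.
- by move=> i x; rewrite /G'; case: ifP.
- move=> i; rewrite /G'; case: ifP => // _; rewrite Qind//; exact: fin_num_measure.
- move=> i ki; rewrite /G'; case: ifP => [_|/negbT ii0]; first by exists U.
  apply: Gind; rewrite ltn_neqAle ki andbT; apply: contra ii0 => /eqP ki0.
  exact/eqP/val_inj.
- exact: mG.
Qed.

Lemma isotropic_mgf r (v : R) (Y : T -> 'cV[R]_r) (a : 'cV[R]_r) : 0 < v ->
  isotropic_normal P v Y -> (forall i, measurable_fun setT (fun w => Y w i 0)) ->
  (\int[P]_w (expR (dot a (Y w)))%:E = (expR (dot a a * v / 2))%:E)%E.
Proof.
move=> v0 iso mY.
have sv0 : Num.sqrt v != 0 by rewrite gt_eqF// sqrtr_gt0.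
have H := integral_expR_normal _ sv0.
under eq_integral do rewrite /dot expR_sum.
rewrite (isotropic_prod (v := v) (G := fun i x => expR (a i 0 * x)))//.
- under eq_bigr do rewrite H sqr_sqrtr ?(ltW v0)//=.
  by rewrite -expR_sum /dot; congr (expR _)%:E; rewrite !mulr_suml; apply: eq_bigr => i _; rewrite expr2.
- by move=> i; apply: measurableT_comp => //; exact: measurable_funM.
- by move=> i; rewrite H.
Qed.

End isotropic.

(** * Walks of weighted Brownian increments *)

Section sub_sigma_algebra.
Context {R : realType} {disp : measure_display} {T : measurableType disp}.
Implicit Types (G : set (set T)) (f g : T -> R).

(** Measurability with respect to a class of sets, as the members of a filtration
are; gmeasP relates it to measurability on a type. *)
Definition gmeas G f := forall U : set R, measurable U -> G (f @^-1` U).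

Lemma gmeasP G f : sigma_algebra setT G ->
  gmeas G f <-> measurable_fun (setT : set (g_sigma_algebraType G)) f.
Proof.
move=> sG; have GE : <<s G>> = G by exact: sigma_algebra_id.
split=> [Gf _ U mU|mf U mU].
  by rewrite setTI /measurable /= GE; exact: Gf.
have := mf measurableT U mU; rewrite setTI => h.
by rewrite -GE; exact: h.
Qed.

Lemma gmeas_measurable G f : G `<=` measurable -> gmeas G f -> measurable_fun setT f.
Proof. by move=> Gm Gf _ U mU; rewrite setTI; apply/Gm/Gf. Qed.

Lemma gmeasS G H f : G `<=` H -> gmeas G f -> gmeas H f.
Proof. by move=> GH Gf U mU; apply/GH/Gf. Qed.

Lemma gmeas_indic G (E : set T) : sigma_algebra setT G -> G E -> gmeas G (\1_E).
Proof.
move=> sG GE; apply/gmeasP => //; apply: measurable_indic.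
exact: sub_sigma_algebra.
Qed.

Lemma gmeas_gt G f x : gmeas G f -> G [set w | x < f w].
Proof.
move=> Gf; have := Gf `]x, +oo[%classic (measurable_itv _).
by congr G; apply/seteqP; split => w /=; rewrite in_itv/= andbT.
Qed.

Lemma sigma_gen_coord n (Y : T -> 'cV[R]_n) i : gmeas (sigma_gen Y) (fun w => Y w i 0).
Proof. by move=> U mU; apply: sub_sigma_algebra; exists i, U. Qed.

Lemma sigma_gen_dot n (Y : T -> 'cV[R]_n) (a : 'cV[R]_n) :
  gmeas (sigma_gen Y) (fun w => dot a (Y w)).
Proof.
have sG : sigma_algebra setT (sigma_gen Y) by exact: smallest_sigma_algebra.
apply/gmeasP => //; apply: measurable_big_sum => i _.
apply: measurable_funM => //; apply/gmeasP => //; exact: sigma_gen_coord.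
Qed.

End sub_sigma_algebra.

Section brownian_increments.
Context {R : realType} {disp : measure_display} {T : measurableType disp}.
Variable P : probability T R.
Variables (F : R -> set (set T)) (hF : filtration F).
Variables (r : nat) (B : R -> T -> 'cV[R]_r) (hB : brownian_motion P F B).

Lemma filtration_sigma t : 0 <= t -> sigma_algebra setT (F t).
Proof. by case: hF => H _ /H[]. Qed.

Lemma filtration_measurable t : 0 <= t -> F t `<=` measurable.
Proof. by case: hF => H _ /H[]. Qed.

Lemma filtrationS s t : 0 <= s -> s <= t -> F s `<=` F t.
Proof. by case: hF => _; exact. Qed.

Lemma adapted_coord n (X : R -> T -> 'cV[R]_n) t i : adapted F X -> 0 <= t ->
  gmeas (F t) (fun w => X t w i 0).
Proof. by move=> aX t0; apply: gmeasS (aX _ t0) _; exact: sigma_gen_coord. Qed.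

Lemma brownian_coord_meas t i : 0 <= t -> gmeas (F t) (fun w => B t w i 0).
Proof. by case: hB => _ _ aB _ _ t0; exact: adapted_coord. Qed.

Lemma increment_gmeas s t (a : 'cV[R]_r) : 0 <= s -> s <= t ->
  gmeas (F t) (fun w => dot a (B t w - B s w)).
Proof.
move=> s0 st; have t0 := le_trans s0 st.
apply/gmeasP; first exact: filtration_sigma.
apply: measurable_big_sum => i _; apply: measurable_funM => //.
under eq_fun do rewrite 2!mxE.
apply: measurable_funB; apply/gmeasP; try exact: filtration_sigma.
  exact: brownian_coord_meas.
exact: gmeasS (filtrationS s0 st) (brownian_coord_meas _ s0).
Qed.

(** An increment is independent of the past, so its exponential moment factors out of
the integral against any variable Z known at the earlier time. *)
Lemma increment_mgf s t (a : 'cV[R]_r) (Z : T -> R) : 0 <= s -> s < t ->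
  gmeas (F s) Z -> (forall w, 0 <= Z w) -> (\int[P]_w (Z w)%:E)%E \is a fin_num ->
  (\int[P]_w (Z w * expR (dot a (B t w - B s w)))%:E =
   \int[P]_w (Z w)%:E * (expR (dot a a * (t - s) / 2))%:E)%E.
Proof.
move=> s0 st mZ Z0 Zfin; have t0 := ltW (le_lt_trans s0 st).
case: (hB) => _ _ _ ind iso.
have mY i : measurable_fun setT (fun w => (B t w - B s w) i 0).
  under eq_fun do rewrite 2!mxE.
  apply: measurable_funB; apply: gmeas_measurable (brownian_coord_meas _ _) => //;
    exact: filtration_measurable.
rewrite (integral_indep (P := P) (f := expR) (Y := fun w => dot a (B t w - B s w)))//.
- by rewrite (isotropic_mgf _ _ (iso _ _ s0 st))// subr_gt0.
- exact: gmeas_measurable (filtration_measurable s0) mZ.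
- apply: gmeas_measurable (filtration_measurable t0) _.
  exact: increment_gmeas (ltW st).
- move=> U V mU mV; apply: (ind _ _ s0 st); first exact: mZ.
  exact: sigma_gen_dot.
Qed.

End brownian_increments.

Section walk.
Context {R : realType} {disp : measure_display} {T : measurableType disp}.
Variable P : probability T R.
Variables (F : R -> set (set T)) (hF : filtration F).
Variables (r : nat) (B : R -> T -> 'cV[R]_r) (hB : brownian_motion P F B).
Variables (dlt : R) (dlt0 : 0 < dlt).
Implicit Types (a : nat -> 'cV[R]_r) (i n : nat).

(** The coefficients a are indexed by absolute time on the grid of mesh dlt, so that
pieces of the same walk started at different indices i can be compared. *)
Definition walk a i n w : R := \sum_(k < n)
  dot (a (i + k)%N) (B ((i + k).+1%:R * dlt) w - B ((i + k)%:R * dlt) w).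

Definition walk_var a i n : R := dlt * \sum_(k < n) dot (a (i + k)%N) (a (i + k)%N).

Let time_ge0 i : 0 <= i%:R * dlt.
Proof. by rewrite mulr_ge0// ltW. Qed.

Let time_le i j : (i <= j)%N -> i%:R * dlt <= j%:R * dlt.
Proof. by move=> ij; rewrite ler_wpM2r ?ler_nat// ltW. Qed.

Lemma walkS a i n w : walk a i n.+1 w = walk a i n w +
  dot (a (i + n)%N) (B ((i + n).+1%:R * dlt) w - B ((i + n)%:R * dlt) w).
Proof. by rewrite /walk big_ord_recr. Qed.

Lemma walk_gmeas a i n : gmeas (F ((i + n)%:R * dlt)) (walk a i n).
Proof.
have sF := filtration_sigma hF (time_ge0 (i + n)).
apply/gmeasP => //; apply: measurable_big_sum => k _; apply/gmeasP => //.
apply: gmeasS (filtrationS hF (time_ge0 (i + k).+1) _) _.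
  by apply: time_le; rewrite -addnS leq_add2l.
exact: (increment_gmeas hF hB _ (time_ge0 _) (time_le (leqnSn _))).
Qed.

Let expR_walk_gmeas a i n (th : R) G : F ((i + n)%:R * dlt) G ->
  gmeas (F ((i + n)%:R * dlt)) (fun w => \1_G w * expR (th * walk a i n w)).
Proof.
move=> FG; have sF := filtration_sigma hF (time_ge0 (i + n)).
apply/gmeasP => //; apply: measurable_funM; first by apply/gmeasP => //; exact: gmeas_indic.
apply: measurableT_comp => //; apply: measurable_funM => //.
by apply/gmeasP => //; exact: walk_gmeas.
Qed.

Let indic_expR_ge0 (G : set T) (x : R) w : 0 <= \1_G w * expR x :> R.
Proof. by rewrite mulr_ge0// expR_ge0. Qed.

Lemma walk_step a i n (th : R) G : F ((i + n)%:R * dlt) G ->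
  (\int[P]_w (\1_G w * expR (th * walk a i n w))%:E)%E \is a fin_num ->
  (\int[P]_w (\1_G w * expR (th * walk a i n.+1 w))%:E =
   \int[P]_w (\1_G w * expR (th * walk a i n w))%:E *
   (expR (th ^+ 2 * (dlt * dot (a (i + n)%N) (a (i + n)%N)) / 2))%:E)%E.
Proof.
move=> FG Gfin.
have tt : (i + n)%:R * dlt < (i + n).+1%:R * dlt by rewrite ltr_pM2r// ltr_nat.
have := increment_mgf hF hB (th *: a (i + n)%N) (time_ge0 (i + n)) tt
  (expR_walk_gmeas a th FG) (fun w => indic_expR_ge0 G (th * walk a i n w) w) Gfin.
have dotZ (x y : 'cV[R]_r) : dot (th *: x) y = th * dot x y.
  by rewrite /dot mulr_sumr; apply: eq_bigr => k _; rewrite mxE mulrA.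
rewrite dotZ dotC dotZ -mulrBl -natrB// subSnn mul1r.
have -> : th * (th * dot (a (i + n)%N) (a (i + n)%N)) * dlt =
  th ^+ 2 * (dlt * dot (a (i + n)%N) (a (i + n)%N)) by ring.
move=> <-; apply: eq_integral => w _; congr EFin.
by rewrite walkS mulrDr expRD mulrA dotZ.
Qed.

(** Multiplying exp (th * walk) by the exponential moments of the increments one after
the other; the event G of the initial time plays the part of a conditioning. *)
Lemma walk_mgf a i n (th : R) G : F (i%:R * dlt) G ->
  (\int[P]_w (\1_G w * expR (th * walk a i n w))%:E =
   P G * (expR (th ^+ 2 * walk_var a i n / 2))%:E)%E.
Proof.
move=> FG; have mG : measurable G by exact: (filtration_measurable hF (time_ge0 i)).
elim: n => [|n IH].
  rewrite /walk_var big_ord0 mulr0 mulr0 mul0r expR0 mule1 -[in RHS](setIT G).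
  rewrite -integral_indic//; apply: eq_integral => w _.
  by rewrite /walk big_ord0 mulr0 expR0 mulr1.
have FGn : F ((i + n)%:R * dlt) G.
  by apply: filtrationS FG => //; apply: time_le; exact: leq_addr.
rewrite walk_step//; last by rewrite IH fin_numM// fin_num_measure.
rewrite IH -muleA -EFinM -expRD; congr (_ * (expR _)%:E)%E.
by rewrite /walk_var big_ord_recr/=; field.
Qed.

(** Doob's inequality for the exponential submartingale, proved directly. On the event
D that level x is passed for the first time at step m, exp (th * walk) is at least
exp (th * x) then, and its integral over the events already collected does not
decrease in the later steps. Summing over m bounds exp (th * x) * P (E n) by the
integral of exp (th * walk) over E n. *)
Lemma walk_max a i n (th x : R) : 0 <= th ->
  (P [set w | exists2 l, (l <= n)%N & (x < walk a i l w)%R] <=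
   (expR (th ^+ 2 * walk_var a i n / 2 - th * x))%:E)%E.
Proof.
move=> th0.
pose E n := [set w | exists2 l, (l <= n)%N & (x < walk a i l w)%R].
have ES m : E m.+1 = E m `|` [set w | x < walk a i m.+1 w].
  apply/seteqP; split => w /=.
    case=> l; rewrite leq_eqVlt => /predU1P[->|]; first by right.
    by rewrite ltnS; left; exists l.
  by case=> [[l lm xl]|xm]; [exists l => //; exact: leqW|exists m.+1].
have FE m : F ((i + m)%:R * dlt) (E m).
  elim: m => [|m IH].
    rewrite (_ : E 0%N = [set w | x < walk a i 0 w]).
      by apply: gmeas_gt; exact: walk_gmeas.
    apply/seteqP; split => w /=; last by exists 0%N.
    by case=> l; rewrite leqn0 => /eqP ->.
  rewrite ES; have sF := filtration_sigma hF (time_ge0 (i + m.+1)).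
  rewrite -(sigma_algebra_id sF).
  apply: (@measurableU _ (g_sigma_algebraType (F ((i + m.+1)%:R * dlt)))).
    apply: sub_sigma_algebra; apply: filtrationS IH => //.
    by apply: time_le; rewrite leq_add2l.
  by apply: sub_sigma_algebra; apply: gmeas_gt; exact: walk_gmeas.
have mE m : measurable (E m) by exact: (filtration_measurable hF (time_ge0 (i + m))).
have mw m : measurable_fun setT (walk a i m).
  exact: gmeas_measurable (filtration_measurable hF (time_ge0 (i + m))) (walk_gmeas _ _ _).
have mexp (G : set T) m : measurable G ->
    measurable_fun setT (fun w => (\1_G w * expR (th * walk a i m w))%:E).
  move=> mG; apply/measurable_EFinP; apply: measurable_funM => //.
  by apply: measurableT_comp => //; exact: measurable_funM.
have FT : F (i%:R * dlt) setT.
  rewrite -(sigma_algebra_id (filtration_sigma hF (time_ge0 i))).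
  exact: (@measurableT _ (g_sigma_algebraType (F (i%:R * dlt)))).
have fin (G : set T) m : measurable G ->
   (\int[P]_w (\1_G w * expR (th * walk a i m w))%:E)%E \is a fin_num.
  move=> mG; rewrite ge0_fin_numE; last by apply: integral_ge0 => w _; rewrite lee_fin.
  apply: (@le_lt_trans _ _ (\int[P]_w (\1_setT w * expR (th * walk a i m w))%:E))%E.
    apply: ge0_le_integral => //; try exact: mexp.
    move=> w _; rewrite lee_fin ler_wpM2r ?expR_ge0// indicT.
    by rewrite /indic lern1 leq_b1.
  rewrite walk_mgf// probability_setT mul1e; exact: ltry.
have markov (D : set T) m : measurable D -> (forall w, D w -> x < walk a i m w) ->
    ((expR (th * x))%:E * P D <=
     \int[P]_w (\1_D w * expR (th * walk a i m w))%:E)%E.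
  move=> mD xD; rewrite -[D in P D]setIT -integral_indic// -ge0_integralZl//; last first.
    exact/measurable_EFinP/measurable_indic.
  apply: ge0_le_integral => //; try exact: mexp.
    by apply/measurable_EFinP; apply: measurable_funM => //; exact: measurable_indic.
  move=> w _; rewrite -EFinM lee_fin mulrC indicE.
  have [|] := boolP (w \in D); last by rewrite !mul0r.
  by rewrite inE => /xD /ltW xw; rewrite !mul1r ler_expR ler_wpM2l.
have main m : ((expR (th * x))%:E * P (E m) <=
    \int[P]_w (\1_(E m) w * expR (th * walk a i m w))%:E)%E.
  elim: m => [|m IH].
    by apply: markov => // w [l]; rewrite leqn0 => /eqP ->.
  pose D := [set w | x < walk a i m.+1 w] `\` E m.
  have mD : measurable D.
    apply: measurableD => //; apply: gmeas_gt => U mU.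
    by rewrite -[X in measurable X]setTI; exact: mw.
  have ED : E m.+1 = E m `|` D by rewrite ES /D setDE setUIr setUv setIT.
  have dED : E m `&` D = set0 by rewrite /D setDE setICA setICr setI0.
  rewrite ED measureU//.
  rewrite ge0_muleDr//.
  have -> : (\int[P]_w (\1_(E m `|` D) w * expR (th * walk a i m.+1 w))%:E =
     \int[P]_w (\1_(E m) w * expR (th * walk a i m.+1 w))%:E +
     \int[P]_w (\1_D w * expR (th * walk a i m.+1 w))%:E)%E.
    rewrite -ge0_integralD//; try exact: mexp; try by move=> w _; rewrite lee_fin.
    apply: eq_integral => w _; rewrite -EFinD -mulrDl; congr (_ * _)%:E.
    rewrite !indicE in_setU; case: (boolP (w \in E m)) => [|_]; last by rewrite add0r.
    by rewrite inE => Ew; rewrite [w \in D]memNset ?addr0// => -[].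
  apply: leeD; last by apply: markov => // w [].
  rewrite walk_step// ?fin//; apply: le_trans IH _.
  rewrite lee_pemulr//; first by apply: integral_ge0 => w _; rewrite lee_fin.
  rewrite lee_fin -expR0 ler_expR divr_ge0// mulr_ge0 ?sqr_ge0// mulr_ge0 ?(ltW dlt0)//.
  by rewrite /dot; apply: sumr_ge0 => k _; rewrite -expr2 sqr_ge0.
have up : (\int[P]_w (\1_(E n) w * expR (th * walk a i n w))%:E <=
    (expR (th ^+ 2 * walk_var a i n / 2))%:E)%E.
  rewrite -[leRHS]mul1e -(probability_setT P) -walk_mgf//.
  apply: ge0_le_integral => //; try exact: mexp; try by move=> w _; rewrite lee_fin.
  move=> w _; rewrite lee_fin ler_wpM2r ?expR_ge0// indicT indicE.
  by rewrite lern1 leq_b1.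
rewrite expRD mulrC expRN EFinM lee_pdivlMl ?expR_gt0//.
exact: le_trans (main n) up.
Qed.
End walk.

Section walk_lower.
Context {R : realType} {disp : measure_display} {T : measurableType disp}.
Variable P : probability T R.
Variables (F : R -> set (set T)) (hF : filtration F).
Variables (r : nat) (B : R -> T -> 'cV[R]_r) (hB : brownian_motion P F B).
Variables (dlt : R) (dlt0 : 0 < dlt).

(** A second moment argument for Z = exp (th * walk), whose first two moments over G
are P G * X and P G * X ^+ 4 for X = exp (th ^+ 2 * s ^+ 2 / 2). Where the walk is
below y, Z is at most X / 2, for th chosen large enough; elsewhere Z is at most
Z ^+ 2 / (4 * X ^+ 3) + X ^+ 3 by the inequality of the means. Integrating,
X * P G <= X / 2 * P G + X / 4 * P G + X ^+ 3 * P (G `&` E), that is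
P (G `&` E) >= P G / (4 * X ^+ 2). *)
Lemma walk_lower (a : nat -> 'cV[R]_r) i n (s y : R) G :
  0 < s -> walk_var dlt a i n = s ^+ 2 -> 0 <= y -> F (i%:R * dlt) G ->
  (P G * (expR (- (8 + 8 * (y ^+ 2 / s ^+ 2))) / 4)%:E <=
   P (G `&` [set w | (y < walk B dlt a i n w)%R]))%E.
Proof.
move=> s0 Vs y0 FG.
have i0 : 0 <= i%:R * dlt by rewrite mulr_ge0// ltW.
have in0 : 0 <= (i + n)%:R * dlt by rewrite mulr_ge0// ltW.
have mG : measurable G := filtration_measurable hF i0 FG.
have gw : gmeas measurable (walk B dlt a i n).
  by move=> U mU; apply: (filtration_measurable hF in0); exact: (walk_gmeas hF hB).
have mw : measurable_fun setT (walk B dlt a i n) by exact: gmeas_measurable gw.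
set E := G `&` _.
have mE : measurable E by apply: measurableI => //; exact: gmeas_gt.
pose c := y / s; have c0 : 0 <= c by rewrite divr_ge0// ltW.
have -> : y ^+ 2 / s ^+ 2 = c ^+ 2 by rewrite expr_div_n.
(* This th satisfies th * y + 1 <= q, whence expR (th * y) <= X / 2 below. *)
pose th := (2 + 2 * c) / s; pose q := (2 + 2 * c) ^+ 2 / 2.
have sN0 : s != 0 by rewrite gt_eqF.
have thV : th ^+ 2 * s ^+ 2 / 2 = q by rewrite /th /q; field.
have thV2 : (th *+ 2) ^+ 2 * s ^+ 2 / 2 = q *+ 4.
  by rewrite -thV -[th *+ 2]mulr_natl -[X in _ = X]mulr_natl; field.
have th0 : 0 <= th by rewrite divr_ge0 ?(ltW s0)// addr_ge0// mulr_ge0.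
pose X := expR q; have X0 : 0 < X by exact: expR_gt0.
have XN0 : X != 0 by rewrite gt_eqF.
have thy : expR (th * y) <= X / 2.
  have -> : th * y = (2 + 2 * c) * c by rewrite /th /c; field.
  have e2 : 2 <= expR 1 :> R by have := expR_ge1Dx (1 : R); apply: le_trans; lra.
  rewrite ler_pdivlMr//; apply: le_trans (ler_wpM2l (expR_ge0 _) e2) _.
  by rewrite -expRD ler_expR /q; have := sqr_ge0 c; rewrite expr2; nra.
pose Z w := expR (th * walk B dlt a i n w).
have Z0 w : 0 < Z w by exact: expR_gt0.
have Z2 w : expR (th *+ 2 * walk B dlt a i n w) = Z w ^+ 2.
  by rewrite /Z -expRM_natl mulrnAl mulr_natl.
have mZ : measurable_fun setT Z by apply: measurableT_comp => //; exact: measurable_funM.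
have pw w : \1_G w * Z w <= X / 2 * \1_G w + (\1_G w * Z w ^+ 2 / (4 * X ^+ 3) + X ^+ 3 * \1_E w).
  have X30 : 0 < X ^+ 3 by rewrite exprn_gt0.
  have [Gw|/negPf Gw] := boolP (w \in G); last first.
    by rewrite !indicE in_setI Gw !(mul0r, mulr0, addr0).
  rewrite !indicE in_setI Gw /= !mul1r mulr1.
  have [wy|wy] := leP (walk B dlt a i n w) y.
    have : Z w <= X / 2 by apply: le_trans thy; rewrite ler_expR ler_wpM2l.
    have : 0 <= Z w ^+ 2 / (4 * X ^+ 3) by rewrite divr_ge0 ?sqr_ge0 ?mulr_ge0// ltW.
    have : 0 <= X ^+ 3 * (w \in [set w | y < walk B dlt a i n w])%:R by rewrite mulr_ge0// ltW.
    lra.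
  rewrite mem_set// mulr1.
  have -> : Z w ^+ 2 / (4 * X ^+ 3) = Z w + (Z w / (2 * X ^+ 3) - 1) ^+ 2 * X ^+ 3 - X ^+ 3.
    by field.
  have := mulr_ge0 (sqr_ge0 (Z w / (2 * X ^+ 3) - 1)) (ltW X30); lra.
have int_ind A : measurable A -> (\int[P]_w (\1_A w)%:E = P A)%E.
  by move=> mA; rewrite integral_indic// setIT.
have mind A : measurable A -> measurable_fun setT (\1_A : T -> R).
  by move=> mA; exact: measurable_indic.
have I1 : (\int[P]_w (\1_G w * Z w)%:E = P G * X%:E)%E.
  by rewrite (walk_mgf hF hB dlt0 _ _ _ FG) Vs thV.
have I2 : (\int[P]_w (\1_G w * Z w ^+ 2)%:E = P G * (X ^+ 4)%:E)%E.
  under eq_integral do rewrite -Z2.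
  by rewrite (walk_mgf hF hB dlt0 _ _ _ FG) Vs thV2 -[_ *+ 4]mulr_natl expRM_natl.
have X3 : 0 <= X ^+ 3 by rewrite exprn_ge0// ltW.
have X4 : 0 <= (4 * X ^+ 3)^-1 by rewrite invr_ge0 mulr_ge0.
have X2 : 0 <= X / 2 by rewrite divr_ge0// ltW.
have GZ w : (0 <= (\1_G w * Z w ^+ 2)%:E)%E by rewrite lee_fin mulr_ge0 ?sqr_ge0.
have mGZ' k : measurable_fun setT (fun w => \1_G w * Z w ^+ k).
  by apply: measurable_funM; [exact: mind|exact: measurable_funX].
have mGZ k : measurable_fun setT (fun w => (\1_G w * Z w ^+ k)%:E).
  exact/measurable_EFinP.
have mZl (c' : R) (f : T -> R) : measurable_fun setT f ->
    measurable_fun setT (fun w => c'%:E * (f w)%:E)%E.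
  by move=> mf; apply/measurable_EFinP; exact: measurable_funM.
have mindE (A : set T) : measurable A -> measurable_fun setT (fun w => (\1_A w : R)%:E).
  by move=> mA; apply/measurable_EFinP; exact: mind.
have ind0 (A : set T) w : (0 <= (\1_A w)%:E :> \bar R)%E by rewrite lee_fin.
have : (P G * X%:E <= (X / 2)%:E * P G + ((4 * X ^+ 3)^-1%:E * (P G * (X ^+ 4)%:E) + (X ^+ 3)%:E * P E))%E.
  rewrite -I1 -I2 -(int_ind G)// -(int_ind E)//.
  rewrite -(@ge0_integralZl _ _ _ P _ measurableT _ (mindE _ mG) (X / 2)%:E)//.
  rewrite -(@ge0_integralZl _ _ _ P _ measurableT _ (mindE _ mE) (X ^+ 3)%:E)//.
  rewrite -(@ge0_integralZl _ _ _ P _ measurableT _ (mGZ 2%N) ((4 * X ^+ 3)^-1)%:E)//.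
  rewrite -ge0_integralD//; try exact: mZl (mGZ' _); try (apply: mZl; exact: mind); last 2 first.
  - by move=> w _; rewrite mule_ge0.
  - by move=> w _; rewrite mule_ge0.
  rewrite -ge0_integralD//; try (apply: mZl; exact: mind); last 3 first.
  - by move=> w _; rewrite mule_ge0.
  - by move=> w _; rewrite adde_ge0 ?mule_ge0.
  - apply: emeasurable_funD; [exact: mZl (mGZ' _)|(apply: mZl; exact: mind)].
  apply: ge0_le_integral => //.
  - by move=> w _; rewrite lee_fin mulr_ge0// ltW.
  - exact: (mGZ 1%N).
  - by apply: emeasurable_funD; [(apply: mZl; exact: mind)|apply: emeasurable_funD; [exact: mZl (mGZ' _)|(apply: mZl; exact: mind)]].
  - by move=> w _; rewrite -!EFinM -!EFinD lee_fin [(4 * _)^-1 * _]mulrC.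
have Gfin : P G \is a fin_num by exact: fin_num_measure.
have Efin : P E \is a fin_num by exact: fin_num_measure.
rewrite -(fineK Gfin) -(fineK Efin) -!EFinM -!EFinD !lee_fin.
set g := fine _; set p := fine _ => key.
have g0 : 0 <= g by rewrite fine_ge0.
have -> : expR (- (8 + 8 * c ^+ 2)) = (expR (8 + 8 * c ^+ 2))^-1 by rewrite expRN.
have qX : X ^+ 2 <= expR (8 + 8 * c ^+ 2).
  by rewrite /X -expRM_natl ler_expR /q; have := sqr_ge0 (1 - c); rewrite !expr2; lra.
have {}key : g <= 4 * X ^+ 2 * p.
  have : g * X <= X / 2 * g + (4 * X ^+ 3)^-1 * (g * X ^+ 4) + X ^+ 3 * p by lra.
  have -> : (4 * X ^+ 3)^-1 * (g * X ^+ 4) = X * g / 4 by field.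
  move=> h; rewrite -(ler_pM2l X0).
  have -> : X * (4 * X ^+ 2 * p) = 4 * (X ^+ 3 * p) by ring.
  lra.
have p0 : 0 <= p by rewrite fine_ge0.
rewrite mulrA ler_pdivrMr// ler_pdivrMr ?expR_gt0//.
by apply: le_trans key _; have := ler_wpM2l p0 qX; lra.
Qed.
End walk_lower.

(** * Riemann sums of continuous functions *)

Section continuous_functions.
Context {R : realType}.
Notation mu := (@lebesgue_measure R).

(** Freezing the value at 0 on the negative half-line turns continuity within
[0, +oo[ into continuity on the whole line, where the theorems on derivatives and
integrals apply; no value at a time t >= 0 changes. *)
Lemma continuous_extend (V : topologicalType) (f : R -> V) :
  {within `[0, +oo[, continuous f} -> continuous (fun x : R => f (Num.max 0 x)).
Proof.
move=> /subspace_continuousP cf x.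
have mx : `[0, +oo[%classic (Num.max 0 x) by rewrite /= in_itv/= le_max lexx.
apply: cvg_comp (cf _ mx).
move=> A /= [e /= e0 eA]; rewrite /nbhs/=.
exists e => //= y /= xy; apply: eA; last by rewrite /= in_itv/= le_max lexx.
rewrite /ball_/=; apply: le_lt_trans xy.
rewrite !maxEle; case: (lerP 0 x) => x0; case: (lerP 0 y) => y0 //.
- by rewrite subr0 ger0_norm// ger0_norm; lra.
- by rewrite sub0r normrN ger0_norm// ler0_norm; lra.
- by rewrite subr0 normr0.
Qed.

(** Only one of the two points has to lie in the segment, which spares the case
distinctions at the ends of a subdivision. *)
Lemma heine (V : normedModType R) (f : R -> V) (a b : R) : continuous f ->
  forall e : R, 0 < e -> exists2 eta : R, 0 < eta &
    forall x y, a <= x <= b -> `|x - y| <= eta -> `|f x - f y| <= e.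
Proof.
move=> cf e e0.
have /compact_near_coveringP/near_covering_withinP cov := @segment_compact _ a b.
pose Q (eta x : R) := forall y, `|x - y| <= eta -> `|f x - f y| <= e.
have : \forall eta \near 0^'+, `[a, b] `<=` Q eta.
  apply: (cov _ (0^'+) Q) => x _.
  have /cvgrPdist_le/(_ (e / 2)) : f y @[y --> x] --> f x by exact: cf.
  rewrite divr_gt0// => /(_ isT) [d /= d0 df].
  exists (ball x (d / 2), [set eta | eta < d / 2]) => /=.
    split; first by apply: nbhsx_ballx; rewrite divr_gt0.
    by apply: nbhs_right_lt; rewrite divr_gt0.
  move=> [z eta] /= [xz ed] _ y zy.
  have -> : f z - f y = (f x - f y) - (f x - f z) by rewrite opprB [RHS]addrC addrA subrK.
  apply: le_trans (ler_normB _ _) _.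
  rewrite [e]splitr lerD//; apply: df => /=; last first.
    by apply: lt_trans xz _; lra.
  rewrite /ball_/= (_ : x - y = (x - z) + (z - y)); last by ring.
  apply: le_lt_trans (ler_normD _ _) _.
  by rewrite [d]splitr ltrD//; apply: le_lt_trans ed.
move=> [d /= d0 dQ]; exists (d / 2); first by rewrite divr_gt0.
have h : `[a, b] `<=` Q (d / 2).
  apply: dQ; last by rewrite divr_gt0.
  by rewrite /ball_/= sub0r normrN gtr0_norm ?divr_gt0//; lra.
by move=> x y xab; apply: h; rewrite /= in_itv.
Qed.

Lemma continuous_itv_integrable (f : R -> R) a b : continuous f ->
  mu.-integrable `[a, b] (EFin \o f).
Proof.
move=> cf; apply: continuous_compact_integrable; first exact: segment_compact.
exact: continuous_subspaceT.
Qed.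

Lemma Rintegral_itv_split (f : R -> R) a b c : continuous f -> a <= b -> b <= c ->
  \int[mu]_(x in `[a, c]) f x = \int[mu]_(x in `[a, b]) f x + \int[mu]_(x in `[b, c]) f x.
Proof.
move=> cf ab bc.
have := @Rintegral_itvB _ f (BLeft a) (BRight c) b.
rewrite !bnd_simp => /(_ (continuous_itv_integrable _ _ cf) ab bc).
rewrite Rintegral_itv_obnd_cbnd; first by move=> <-; ring.
apply: integrableS (continuous_itv_integrable a c cf) => //.
by move=> x /=; rewrite !in_itv/= => /andP[bx ->]; rewrite (le_trans ab (ltW bx)).
Qed.

Lemma Rintegral_itv_dist (f : R -> R) a b c e : continuous f -> a <= b ->
  (forall x, a <= x <= b -> `|c - f x| <= e) ->
  `|(b - a) * c - \int[mu]_(x in `[a, b]) f x| <= (b - a) * e.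
Proof.
move=> cf ab fe.
have cst k : \int[mu]_(x in `[a, b]) k = (b - a) * k.
  rewrite Rintegral_cst//= lebesgue_measure_itv/= lte_fin.
  move: ab; rewrite le_eqVlt => /predU1P[->|ab]; first by rewrite ltxx subrr mulr0 mul0r.
  by rewrite ab -EFinB/= mulrC.
have icst k : mu.-integrable `[a, b] (EFin \o (fun=> k)).
  by apply: continuous_itv_integrable => x; exact: cvg_cst.
have lo : (b - a) * (c - e) <= \int[mu]_(x in `[a, b]) f x.
  rewrite -cst; apply: le_Rintegral => //; first exact: continuous_itv_integrable.
  by move=> x; rewrite /= in_itv/= => /fe; rewrite ler_norml => /andP[]; lra.
have up : \int[mu]_(x in `[a, b]) f x <= (b - a) * (c + e).
  rewrite -cst; apply: le_Rintegral => //; first exact: continuous_itv_integrable.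
  by move=> x; rewrite /= in_itv/= => /fe; rewrite ler_norml => /andP[]; lra.
move: (Rintegral _ _ _) lo up => I lo up.
by rewrite ler_norml; apply/andP; split; lra.
Qed.

Lemma riemann_sum_dist (f : R -> R) (al dlt e : R) n : continuous f -> 0 < dlt ->
  (forall x y, al <= x <= al + n%:R * dlt -> `|x - y| <= dlt -> `|f x - f y| <= e) ->
  `|dlt * (\sum_(k < n) f (al + k%:R * dlt)) -
    \int[mu]_(x in `[al, al + n%:R * dlt]) f x| <= n%:R * dlt * e.
Proof.
move=> cf d0; elim: n => [|n IH] unif.
  by rewrite big_ord0 mulr0 mul0r addr0 set_itv1 Rintegral_set1 subrr normr0 mul0r.
have nd : al + n%:R * dlt <= al + n.+1%:R * dlt by rewrite lerD2l ler_pM2r// ler_nat.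
have and0 : al <= al + n%:R * dlt by rewrite lerDl mulr_ge0// ltW.
rewrite big_ord_recr/= (Rintegral_itv_split cf and0 nd) mulrDr opprD addrACA.
apply: le_trans (ler_normD _ _) _.
have E : al + n.+1%:R * dlt - (al + n%:R * dlt) = dlt by rewrite -addn1 natrD; ring.
have -> : n.+1%:R * dlt * e = n%:R * dlt * e + dlt * e by rewrite -addn1 natrD; ring.
rewrite lerD//.
  by apply: IH => x y /andP[x1 x2]; apply: unif; rewrite x1 (le_trans x2).
rewrite -[X in X * f _]E -[X in _ <= X * e]E.
apply: Rintegral_itv_dist => // x /andP[x1 x2]; apply: unif; first by rewrite and0 nd.
rewrite ler0_norm; last by rewrite subr_le0.
by rewrite opprB lerBlDl (le_trans x2)// -addn1 natrD; lra.
Qed.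

End continuous_functions.

(** * The Wiener integral as a limit of dyadic sums *)

Section limits.
Context {R : realType}.

Lemma cvge0P (a : nat -> \bar R) : (forall n, 0 <= a n)%E ->
  (forall e : R, 0 < e -> \forall n \near \oo, (a n <= e%:E)%E) ->
  a n @[n --> \oo] --> 0%E.
Proof.
move=> a0 ae; apply/fine_cvgP; split.
  near=> n; rewrite ge0_fin_numE//; apply: (@le_lt_trans _ _ 1%:E); last exact: ltry.
  by near: n; exact: ae.
apply/cvgrPdist_le => e e0; near=> n.
have an : (a n <= e%:E)%E by near: n; exact: ae.
have afin : a n \is a fin_num.
  by rewrite ge0_fin_numE//; apply: le_lt_trans an _; exact: ltry.
rewrite sub0r normrN ger0_norm ?fine_ge0//.
by rewrite -lee_fin fineK.
Unshelve. all: by end_near. Qed.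

Lemma cvge0_le (a : nat -> \bar R) (e : R) : (forall n, 0 <= a n)%E ->
  a n @[n --> \oo] --> 0%E -> 0 < e -> \forall n \near \oo, (a n <= e%:E)%E.
Proof.
move=> a0 /fine_cvgP[afin /cvgrPdist_le ca] e0; near=> n.
have fin : a n \is a fin_num by near: n.
rewrite -(fineK fin) lee_fin.
have : `|0 - (fine \o a) n| <= e by near: n; exact: ca.
by rewrite sub0r normrN /= ger0_norm// fine_ge0.
Unshelve. all: by end_near. Qed.

Lemma mesh_small (dl eta : R) : 0 < dl -> 0 < eta ->
  \forall n \near \oo, dl / 2 ^+ n <= eta.
Proof.
move=> d0 e0; exists (Num.truncn (dl / eta)) => // n /= nN.
rewrite ler_pdivrMr ?exprn_gt0// -ler_pdivrMl// mulrC.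
apply: le_trans (ltW (truncnS_gt _)) _.
rewrite -natrX ler_nat; apply: leq_trans (_ : n.+1 <= _)%N; first by rewrite ltnS.
exact: ltn_expl.
Qed.

Lemma mesh_cell (dlt s : R) N : 0 < dlt -> 0 < s -> s <= N%:R * dlt ->
  exists2 k, (k < N)%N & k%:R * dlt < s <= k.+1%:R * dlt.
Proof.
move=> d0 s0; elim: N => [|N IH] sN.
  by move: s0; rewrite ltNge; move: sN; rewrite mul0r => ->.
have [/IH[k kN ks]|Ns] := leP s (N%:R * dlt); first by exists k => //; exact: ltnW.
by exists N => //; rewrite Ns sN.
Qed.

End limits.

Section wiener_sums.
Context {R : realType} {disp : measure_display} {T : measurableType disp}.
Variable P : probability T R.
Variables (d r : nat) (B : R -> T -> 'cV[R]_r) (sigma : R -> 'M[R]_(d, r)).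
Hypothesis csigma : {within `[0, +oo[, continuous sigma}.

(** The Riemann-type approximation of the Wiener integral up to time N * dlt. Along the
meshes h / 2 ^+ n the sums at the times i * h, and at their dyadic subdivisions,
all live on a common grid. *)
Definition wsum (dlt : R) N w : 'cV[R]_d := \sum_(k < N)
  sigma (k%:R * dlt) *m (B (k.+1%:R * dlt) w - B (k%:R * dlt) w).

Let sg s := sigma (Num.max 0 s).

Lemma coord_le_mx_norm m n (M : 'M[R]_(m, n)) i j : `|M i j| <= `|M|.
Proof.
rewrite [leRHS]/Num.norm/= mx_normrE.
by apply: (le_trans _ (@le_bigmax _ _ _ _ (fun ij => `|M ij.1 ij.2|) (i, j))).
Qed.

(** Uniform continuity on a segment, in the squared Frobenius norm in which the
Wiener integral measures its approximations. *)
Lemma sigma_unif (a b e : R) : 0 < e -> exists2 eta : R, 0 < eta &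
  forall x y, 0 <= x -> 0 <= y -> a <= x <= b -> `|x - y| <= eta -> fnorm (sigma x - sigma y) ^+ 2 <= e.
Proof.
move=> e0; pose e' := Num.sqrt (e / (1 + d%:R * r%:R)).
have n0 : 0 < 1 + d%:R * r%:R :> R by rewrite ltr_pwDl// mulr_ge0.
have e'0 : 0 < e' by rewrite sqrtr_gt0 divr_gt0.
have [eta eta0 unif] := heine a b (continuous_extend csigma) e'0.
exists eta => // x y x0 y0 xab /(unif _ _ xab).
rewrite !max_r// => xy; rewrite fnorm_sqr.
apply: le_trans (_ : \sum_(i < d) \sum_(j < r) e' ^+ 2 <= _).
  apply: ler_sum => i _; apply: ler_sum => j _.
  rewrite -real_normK ?num_real// ler_pXn2r ?nnegrE ?(ltW e'0)//.
  exact: le_trans (coord_le_mx_norm _ _ _) xy.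
under eq_bigr do rewrite sumr_const card_ord.
rewrite sumr_const card_ord -mulrnA -mulr_natl natrM sqr_sqrtr; last by rewrite divr_ge0// ltW.
rewrite mulrA ler_pdivrMr//; lra.
Qed.

Lemma fnorm_sqr_continuous : continuous (fun s : R => fnorm (sg s) ^+ 2).
Proof.
have csg : continuous sg := continuous_extend csigma.
have -> : (fun s => fnorm (sg s) ^+ 2) =
    (fun s => \sum_(i < d) \sum_(j < r) (sg s) i j ^+ 2).
  by apply/funext => s; rewrite fnorm_sqr.
apply: continuous_big; first exact: add_continuous.
move=> i _; apply: continuous_big; first exact: add_continuous.
move=> j _ s; rewrite /GRing.exp/=.
have cij : {for s, continuous (fun s => sg s i j)}.
  by apply: (cvg_comp sg (fun M : 'M[R]_(d, r) => M i j)); [exact: csg|exact: coord_continuous].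
exact: (cvgM cij cij).
Qed.

(** The left-end step functions on the dyadic grids converge to sigma uniformly on
the time interval, hence in L^2, so the characterisation of the Wiener integral
applies to their integrals. *)
Lemma wiener_L2 (dl : R) N I : 0 < dl -> is_wiener_integral P sigma B (N%:R * dl) I ->
  (\int[P]_w (enorm (I w - wsum (dl / 2 ^+ n) (N * 2 ^ n) w) ^+ 2)%:E)%E
    @[n --> \oo] --> 0%E.
Proof.
move=> dl0 [_ HI].
pose dn n : R := dl / 2 ^+ n.
have dn0 n : 0 < dn n by rewrite divr_gt0// exprn_gt0.
pose p n := mkseq (fun k => k.+1%:R * dn n) (N * 2 ^ n).
pose c n k := sigma (k%:R * dn n).
have NE n : (N * 2 ^ n)%N%:R * dn n = N%:R * dl.
  by rewrite natrM natrX /dn; field; rewrite expf_neq0.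
have nthS n k : (k < N * 2 ^ n)%N -> nth 0 (p n) k = k.+1%:R * dn n.
  by move=> kN; rewrite nth_mkseq.
have nth0 n k : (k <= N * 2 ^ n)%N -> nth 0 (0 :: p n) k = k%:R * dn n.
  by case: k => [|k] kN /=; [rewrite mul0r|rewrite nth_mkseq].
have sumE n w : step_integral (p n) (c n) B w = wsum (dn n) (N * 2 ^ n) w.
  rewrite /step_integral /wsum.
  rewrite -(big_mkord xpredT (fun k => c n k *m (B (nth 0 (p n) k) w - B (nth 0 (0 :: p n) k) w))).
  rewrite -(big_mkord xpredT (fun k => sigma (k%:R * dn n) *m (B (k.+1%:R * dn n) w - B (k%:R * dn n) w))).
  rewrite size_mkseq; apply: eq_big_nat => k /andP[_ kN].
  by rewrite nthS// nth0// ltnW.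
rewrite (_ : (fun n => _) = (fun n =>
    (\int[P]_w (enorm (I w - step_integral (p n) (c n) B w) ^+ 2)%:E)%E)); last first.
  by apply/funext => n; apply: eq_integral => w _; rewrite sumE.
apply: HI.
- move=> n; split.
    apply/(pathP 0) => k; rewrite size_mkseq => kN.
    by rewrite nthS// nth0 ?(ltnW kN)// ltr_pM2r// ltr_nat.
  apply/eqP; rewrite -(NE n) -[RHS](nth0 n _ (leqnn _)).
  by rewrite (last_nth 0) size_mkseq.
have stepE n s k : (k < N * 2 ^ n)%N -> k%:R * dn n < s <= k.+1%:R * dn n ->
    step_fun (p n) (c n) s = c n k.
  move=> kN ks; rewrite /step_fun.
  rewrite -(big_mkord xpredT (fun j => \1_(`]nth 0 (0 :: p n) j, nth 0 (p n) j]%classic) s *: c n j)).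
  rewrite size_mkseq big_mkord (bigD1 (Ordinal kN))//= nthS// nth0 ?(ltnW kN)//.
  rewrite indicE mem_set ?scale1r; last by rewrite /= in_itv.
  rewrite big1 ?addr0// => j; rewrite -val_eqE/= => jk.
  rewrite nthS// nth0 ?(ltnW (ltn_ord j))// indicE memNset ?scale0r//=.
  rewrite in_itv/= => /andP[js sj]; move: ks => /andP[ks sk].
  have kj : (k < j.+1)%N by have := lt_le_trans ks sj; rewrite ltr_pM2r// ltr_nat.
  have jk' : (j < k.+1)%N by have := lt_le_trans js sk; rewrite ltr_pM2r// ltr_nat.
  by move: jk; rewrite eqn_leq -ltnS jk' -ltnS kj.
apply: cvge0P => [n|e e0].
  by apply: integral_ge0 => s _; rewrite lee_fin sqr_ge0.
have T0 : 0 <= N%:R * dl by rewrite mulr_ge0// ltW.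
have e'0 : 0 < e / (1 + N%:R * dl) by rewrite divr_gt0// ltr_pwDl.
have [eta eta0 unif] := sigma_unif 0 (N%:R * dl) e'0.
have := mesh_small dl0 eta0; apply: filterS => n dneta.
rewrite (eq_integral (fun s : measurableTypeR R => (fnorm (step_fun (p n) (c n) s - sg s) ^+ 2)%:E)); last first.
  by move=> s; rewrite inE/= in_itv/= => /andP[s0 _]; rewrite /sg max_r.
have mstep : measurable_fun setT (fun s => (fnorm (step_fun (p n) (c n) s - sg s) ^+ 2)%:E).
  have csg : continuous sg := continuous_extend csigma.
  apply/measurable_EFinP; under eq_fun do rewrite fnorm_sqr.
  apply: measurable_big_sum => i _; apply: measurable_big_sum => j _.
  apply: measurable_funX; under eq_fun do rewrite 2!mxE summxE.
  apply: measurable_funB; last first.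
    apply: continuous_measurable_fun => s.
    by apply: (cvg_comp sg (fun M : 'M[R]_(d, r) => M i j)); [exact: csg|exact: coord_continuous].
  apply: measurable_big_sum => k _; under eq_fun do rewrite mxE.
  by apply: measurable_funM => //; exact: measurable_indic.
rewrite -integral_itv_obnd_cbnd; last exact: measurable_funTS.
apply: (@le_trans _ _ (\int[lebesgue_measure]_(s in `]0%R, (N%:R * dl)%R]) (cst (e / (1 + N%:R * dl))%:E s))%E).
  apply: ge0_le_integral => //; try exact: measurable_funTS.
    by move=> s _; rewrite lee_fin sqr_ge0.
  move=> s /=; rewrite in_itv/= => /andP[s0 sT]; rewrite lee_fin.
  have [|k kN ks] := mesh_cell (dn0 n) s0 (N := N * 2 ^ n); first by rewrite NE.
  rewrite (stepE _ _ _ kN ks) /sg max_r ?(ltW s0)//.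
  move/andP: ks => [ks sk].
  rewrite /c; apply: unif => //; [by rewrite mulr_ge0// ltW|exact: ltW| |].
    by rewrite mulr_ge0 ?(ltW (dn0 n))//= (le_trans (ltW ks) sT).
  apply: le_trans dneta; rewrite ler0_norm ?subr_le0 ?(ltW ks)// opprB lerBlDl.
  by apply: le_trans sk _; rewrite -/(dn n) -[k.+1]addn1 natrD mulrDl mul1r.
rewrite integral_cst//= lebesgue_measure_itv/=.
case: ifP => _; last by rewrite mule0 lee_fin ltW.
rewrite oppr0 addr0 -EFinM lee_fin ltW//.
by rewrite mulrAC ltr_pdivrMr ?ltr_pwDl// ltr_pM2l// ltrDr.
Qed.

End wiener_sums.

Section dyadic_sums.
Context {R : realType} {disp : measure_display} {T : measurableType disp}.
Variable P : probability T R.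

Lemma near_all_le K (Q : nat -> nat -> Prop) :
  (forall l, (l <= K)%N -> \forall n \near \oo, Q l n) ->
  \forall n \near \oo, forall l, (l <= K)%N -> Q l n.
Proof.
elim: K => [|K IH] QK.
  by have := QK 0%N (leqnn _); apply: filterS => n Qn [].
have := IH (fun l lK => QK l (leqW lK)); have := QK K.+1 (leqnn _).
apply: filterS2 => n QS Ql l; rewrite leq_eqVlt => /predU1P[->//|].
by rewrite ltnS; exact: Ql.
Qed.

Lemma measure_exists_le K (A : nat -> set T) (e : R) :
  (forall l, measurable (A l)) -> (forall l, (l <= K)%N -> (P (A l) <= e%:E)%E) ->
  measurable [set w | exists2 l, (l <= K)%N & A l w] /\
  (P [set w | exists2 l, (l <= K)%N & A l w] <= (K.+1%:R * e)%:E)%E.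
Proof.
move=> mA; elim: K => [|K IH] Ae.
  rewrite (_ : mkset _ = A 0%N); first by rewrite mul1r; split => //; exact: Ae.
  apply/seteqP; split => w /=; last by exists 0%N.
  by case=> l; rewrite leqn0 => /eqP ->.
have [mI leI] := IH (fun l lK => Ae l (leqW lK)).
rewrite (_ : mkset _ = [set w | exists2 l, (l <= K)%N & A l w] `|` A K.+1).
  split; first exact: measurableU.
  apply: le_trans (measureU2 _ mI (mA K.+1)) _.
  by rewrite -[K.+2]addn1 natrD mulrDl mul1r EFinD; apply: leeD => //; exact: Ae.
apply/seteqP; split => w /=.
  case=> l; rewrite leq_eqVlt => /predU1P[->|]; first by right.
  by rewrite ltnS; left; exists l.
by case=> [[l lK Al]|AK]; [exists l => //; exact: leqW|exists K.+1].
Qed.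

Lemma markov_sqr (f : T -> R) (c e : R) : measurable_fun setT f -> 0 < c ->
  (\int[P]_w (f w ^+ 2)%:E <= (e * c ^+ 2)%:E)%E ->
  (P [set w | (c < f w)%R] <= e%:E)%E.
Proof.
move=> mf c0 fe.
have mA : measurable [set w | c < f w].
  by apply: gmeas_gt => U mU; rewrite -[X in measurable X]setTI; exact: mf.
have c2 : 0 < c ^+ 2 by rewrite exprn_gt0.
rewrite -(@lee_pmul2r _ (c ^+ 2)%:E)// -EFinM; apply: le_trans fe.
have mI : measurable_fun setT (\1_[set w | c < f w] : T -> R) by exact: measurable_indic.
rewrite muleC -[X in P X]setIT -integral_indic// -ge0_integralZl//; last 2 first.
  exact/measurable_EFinP.
  by rewrite lee_fin ltW.
apply: ge0_le_integral => //.
- by move=> w _; rewrite mule_ge0// lee_fin ?ltW.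
- by apply/measurable_EFinP; apply: measurable_funM.
- by apply/measurable_EFinP; exact: measurable_funX.
move=> w _; rewrite -EFinM lee_fin indicE.
have [|_] := boolP (w \in _); last by rewrite mulr0 sqr_ge0.
by rewrite inE mulr1 => /= cw; rewrite ler_pXn2r ?nnegrE ?(ltW c0)// ltW// (lt_trans c0).
Qed.

Lemma measurable_enorm n (Y : T -> 'cV[R]_n) :
  (forall i, measurable_fun setT (fun w => Y w i 0)) ->
  measurable_fun setT (fun w => enorm (Y w)).
Proof.
move=> mY; apply: measurableT_comp; first by apply: continuous_measurable_fun; exact: sqrt_continuous.
by apply: measurable_big_sum => i _; exact: measurable_funX.
Qed.

Variables (F : R -> set (set T)) (hF : filtration F).
Variables (d r : nat) (B : R -> T -> 'cV[R]_r) (hB : brownian_motion P F B).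
Variables (sigma : R -> 'M[R]_(d, r)).
Hypothesis csigma : {within `[0, +oo[, continuous sigma}.

Lemma dot_mulmx m n (A : 'M[R]_(m, n)) u (v : 'cV[R]_n) :
  dot u (A *m v) = dot (A^T *m u) v.
Proof.
rewrite /dot; under eq_bigr do rewrite mxE mulr_sumr.
rewrite exchange_big; apply: eq_bigr => j _; rewrite mxE mulr_suml.
by apply: eq_bigr => i _ /=; rewrite mxE; ring.
Qed.

(** Projecting the vector sums on u gives a scalar walk with these coefficients. *)
Definition proj_coef (dlt : R) (u : 'cV[R]_d) k := (sigma (k%:R * dlt))^T *m u.

Lemma wsum_walk (dlt : R) u i n w :
  dot u (wsum B sigma dlt (i + n) w - wsum B sigma dlt i w) =
  walk B dlt (proj_coef dlt u) i n w.
Proof.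
rewrite /wsum /walk big_split_ord/= addrAC subrr add0r.
elim/big_ind2 : _ => [|x1 x2 y1 y2 <- <-|k _].
- by rewrite /dot big1// => k _; rewrite mxE mulr0.
- exact: dotDr.
- by rewrite dot_mulmx.
Qed.

Lemma walk_var_le (dlt : R) u i n : 0 < dlt -> enorm u <= 1 ->
  walk_var dlt (proj_coef dlt u) i n <=
  dlt * \sum_(k < n) fnorm (sigma ((i + k)%N%:R * dlt)) ^+ 2.
Proof.
move=> d0 u1; rewrite ler_pM2l//; apply: ler_sum => k _.
rewrite -enorm_sqr ler_pXn2r ?nnegrE ?enorm_ge0 ?sqrtr_ge0//.
apply: le_trans (enorm_mulmx _ _) _.
have -> (M : 'M[R]_(d, r)) : fnorm M^T = fnorm M.
  rewrite /fnorm exchange_big; congr Num.sqrt.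
  by apply: eq_bigr => p _; apply: eq_bigr => q _; rewrite mxE.
by rewrite ler_piMr ?sqrtr_ge0.
Qed.

(** The variances of the coordinates add up to the Riemann sum of the squared
Frobenius norm, so one of the d coordinates has at least the share 1 / d. *)
Lemma walk_var_sum (dlt : R) i n :
  \sum_(p < d) walk_var dlt (proj_coef dlt (delta_mx p 0)) i n =
  dlt * \sum_(k < n) fnorm (sigma ((i + k)%N%:R * dlt)) ^+ 2.
Proof.
rewrite -mulr_sumr exchange_big; congr (_ * _); apply: eq_bigr => k _ /=.
rewrite fnorm_sqr; apply: eq_bigr => p _; apply: eq_bigr => q _ /=.
by rewrite /proj_coef -colE !mxE expr2.
Qed.

Lemma riemann_cvg (f : R -> R) (dl e : R) a K : continuous f -> 0 < dl -> 0 < e ->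
  \forall n \near \oo,
    `|dl / 2 ^+ n * (\sum_(k < K * 2 ^ n) f ((a * 2 ^ n + k)%N%:R * (dl / 2 ^+ n))) -
      \int[lebesgue_measure]_(x in `[a%:R * dl, (a + K)%:R * dl]) f x| <= e.
Proof.
move=> cf d0 e0.
have L0 : 0 < 1 + K%:R * dl by rewrite ltr_pwDl// mulr_ge0// ltW.
have e'0 : 0 < e / (1 + K%:R * dl) by rewrite divr_gt0.
have [eta eta0 unif] := heine (a%:R * dl) ((a + K)%:R * dl) cf e'0.
have := mesh_small d0 eta0; apply: filterS => n dn_eta.
have dn0 : 0 < dl / 2 ^+ n by rewrite divr_gt0// exprn_gt0.
have aE N : (N * 2 ^ n)%N%:R * (dl / 2 ^+ n) = N%:R * dl.
  by rewrite natrM natrX; field; rewrite expf_neq0.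
have := @riemann_sum_dist _ f (a%:R * dl) (dl / 2 ^+ n) (e / (1 + K%:R * dl)) (K * 2 ^ n) cf dn0.
rewrite aE -mulrDl -natrD => H.
under eq_bigr do rewrite natrD mulrDl aE.
apply: le_trans (H _) _.
  by move=> x y xab xy; apply: unif => //; exact: le_trans dn_eta.
by rewrite mulrA ler_pdivrMr// mulrC ler_pM2l// lerDr.
Qed.

End dyadic_sums.

Section wiener_process.
Context {R : realType} {disp : measure_display} {T : measurableType disp}.
Variable P : probability T R.
Variables (F : R -> set (set T)) (hF : filtration F).
Variables (d r : nat) (B : R -> T -> 'cV[R]_r) (hB : brownian_motion P F B).
Variables (sigma : R -> 'M[R]_(d, r)).
Hypothesis csigma : {within `[0, +oo[, continuous sigma}.
Variable M : R -> T -> 'cV[R]_d.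
Hypothesis hM : forall t, 0 <= t -> is_wiener_integral P sigma B t (M t).

(** The argument max 0 s makes the integrand continuous on the whole line. *)
Definition quadvar (a b : R) : R :=
  \int[lebesgue_measure]_(s in `[a, b]) fnorm (sigma (Num.max 0 s)) ^+ 2.

Lemma wiener_meas t i : 0 <= t -> measurable_fun setT (fun w => M t w i 0).
Proof.
move=> t0; have [sM _] := hM t0.
by apply: gmeas_measurable sM _; exact: sigma_gen_coord.
Qed.

Lemma wsum_meas (dlt : R) N i : 0 < dlt ->
  measurable_fun setT (fun w => wsum B sigma dlt N w i 0).
Proof.
move=> d0; have mB j k : measurable_fun setT (fun w => B (k%:R * dlt) w j 0).
  have t0 : 0 <= k%:R * dlt by rewrite mulr_ge0// ltW.
  exact: gmeas_measurable (filtration_measurable hF t0) (brownian_coord_meas hB _ t0).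
under eq_fun do rewrite summxE; apply: measurable_big_sum => k _.
under eq_fun do rewrite mxE; apply: measurable_big_sum => j _.
apply: measurable_funM => //; under eq_fun do rewrite 2!mxE.
by apply: measurable_funB; exact: mB.
Qed.

(** Convergence in L^2 is used only through this consequence: at finitely many given
times M and its dyadic sums are close outside an event of small probability. *)
Lemma wsum_near (dl : R) N (c e : R) : 0 < dl -> 0 < c -> 0 < e ->
  \forall n \near \oo,
    (P [set w | (c < enorm (M (N%:R * dl) w - wsum B sigma (dl / 2 ^+ n) (N * 2 ^ n) w))%R]
      <= e%:E)%E.
Proof.
move=> d0 c0 e0; have t0 : 0 <= N%:R * dl by rewrite mulr_ge0// ltW.
have := wiener_L2 csigma d0 (hM t0).
move=> /(@cvge0_le _ _ (e * c ^+ 2)); rewrite mulr_gt0 ?exprn_gt0//.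
have ge0 n : (0 <= \int[P]_w (enorm (M (N%:R * dl) w -
    wsum B sigma (dl / 2 ^+ n) (N * 2 ^ n) w) ^+ 2)%:E)%E.
  by apply: integral_ge0 => w _; rewrite lee_fin sqr_ge0.
move=> /(_ ge0 isT); apply: filterS => n; apply: markov_sqr => //.
apply: measurable_enorm => i; under eq_fun do rewrite 2!mxE.
by apply: measurable_funB; [exact: wiener_meas|apply: wsum_meas; rewrite divr_gt0// exprn_gt0].
Qed.

Lemma riemann_quadvar (dl e : R) a K : 0 < dl -> 0 < e ->
  \forall n \near \oo, `|dl / 2 ^+ n * (\sum_(k < K * 2 ^ n)
     fnorm (sigma ((a * 2 ^ n + k)%N%:R * (dl / 2 ^+ n))) ^+ 2) -
    quadvar (a%:R * dl) ((a + K)%:R * dl)| <= e.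
Proof.
move=> d0 e0; have := riemann_cvg a K (fnorm_sqr_continuous csigma) d0 e0.
apply: filterS => n; congr (`|_ * _ - _| <= _); apply: eq_bigr => k _.
by rewrite max_r// mulr_ge0// divr_ge0 ?exprn_ge0// ltW.
Qed.

Lemma dot_delta n p (x : 'cV[R]_n) : dot (delta_mx p 0) x = x p 0.
Proof.
rewrite /dot (bigD1 p)//= mxE !eqxx mul1r big1 ?addr0// => i ip.
by rewrite mxE (negPf ip) mul0r.
Qed.

(** The event is, up to an event of probability e, contained in the event that a
dyadic walk of nearly the same variance passes x at some step: each of the two
ends of an increment of M costs x / 2, whence the factor 2. Since the bound for the
walk does not depend on e, which is arbitrary, it passes to the limit. The
strict inequality on V leaves room for the Riemann sums of quadvar. *)
Lemma wiener_max (dl V x th : R) u a K : 0 < dl -> enorm u <= 1 ->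
  quadvar (a%:R * dl) ((a + K)%:R * dl) < V -> 0 < x -> 0 <= th ->
  let E := [set w | exists2 l, (l <= K)%N &
      (2 * x < dot u (M ((a + l)%:R * dl) w - M (a%:R * dl) w))%R] in
  measurable E /\ (P E <= (expR (th ^+ 2 * V / 2 - th * x))%:E)%E.
Proof.
move=> d0 u1 vV x0 th0 E.
have t0 l : 0 <= l%:R * dl by rewrite mulr_ge0// ltW.
have mdot l : measurable_fun setT (fun w => dot u (M ((a + l)%:R * dl) w - M (a%:R * dl) w)).
  apply: measurable_big_sum => i _; apply: measurable_funM => //.
  by under eq_fun do rewrite 2!mxE; apply: measurable_funB; exact: wiener_meas.
have mE : measurable E.
  apply: (bigcup_measurable (P := [set l | (l <= K)%N])
    (F := fun l => [set w | 2 * x < dot u (M ((a + l)%:R * dl) w - M (a%:R * dl) w)])) => l _.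
  by apply: gmeas_gt => U mU; rewrite -[X in measurable X]setTI; exact: mdot.
split => //; apply/lee_addgt0Pr => e e0.
have e'0 : 0 < e / K.+1%:R by rewrite divr_gt0.
have x20 : 0 < x / 2 by rewrite divr_gt0.
have vV0 : 0 < V - quadvar (a%:R * dl) ((a + K)%:R * dl) by rewrite subr_gt0.
have bad_small : \forall n \near \oo, forall l, (l <= K)%N ->
    (P [set w | (x / 2 < enorm (M ((a + l)%:R * dl) w -
        wsum B sigma (dl / 2 ^+ n) ((a + l) * 2 ^ n) w))%R] <= (e / K.+1%:R)%:E)%E.
  by apply: near_all_le => l _; exact: wsum_near.
near \oo => n.
have badP0 : forall l, (l <= K)%N ->
    (P [set w | (x / 2 < enorm (M ((a + l)%:R * dl) w -
        wsum B sigma (dl / 2 ^+ n) ((a + l) * 2 ^ n) w))%R] <= (e / K.+1%:R)%:E)%E.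
  by near: n; exact: bad_small.
have dn0 : 0 < dl / 2 ^+ n by rewrite divr_gt0// exprn_gt0.
pose bad l := [set w | x / 2 < enorm (M ((a + l)%:R * dl) w -
        wsum B sigma (dl / 2 ^+ n) ((a + l) * 2 ^ n) w)].
have badP l : (l <= K)%N -> (P (bad l) <= (e / K.+1%:R)%:E)%E by exact: badP0.
have mbad l : measurable (bad l).
  apply: gmeas_gt => U mU; rewrite -[X in measurable X]setTI.
  apply: measurable_enorm => // i; under eq_fun do rewrite 2!mxE.
  by apply: measurable_funB; [exact: wiener_meas|exact: wsum_meas].
have [mbads Pbads] := measure_exists_le mbad badP.
pose W := [set w | exists2 l, (l <= K * 2 ^ n)%N &
  x < walk B (dl / 2 ^+ n) (proj_coef sigma (dl / 2 ^+ n) u) (a * 2 ^ n) l w].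
have PW : (P W <= (expR (th ^+ 2 * V / 2 - th * x))%:E)%E.
  apply: (le_trans (walk_max hF hB dn0 _ _ _ x th0)).
  rewrite lee_fin ler_expR lerB// ler_pM2r// ler_wpM2l ?sqr_ge0//.
  apply: le_trans (walk_var_le _ _ _ dn0 u1) _.
  have : `|dl / 2 ^+ n * (\sum_(k < K * 2 ^ n)
     fnorm (sigma ((a * 2 ^ n + k)%N%:R * (dl / 2 ^+ n))) ^+ 2) -
    quadvar (a%:R * dl) ((a + K)%:R * dl)| <= V - quadvar (a%:R * dl) ((a + K)%:R * dl).
    by near: n; exact: riemann_quadvar.
  by rewrite ler_norml => /andP[_]; rewrite lerBlDr subrK.
have mW : measurable W.
  apply: (bigcup_measurable (P := [set l | (l <= K * 2 ^ n)%N]) (F := fun l => [set w |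
    x < walk B (dl / 2 ^+ n) (proj_coef sigma (dl / 2 ^+ n) u) (a * 2 ^ n) l w])) => l _.
  apply: gmeas_gt => U mU.
  have t0' : 0 <= (a * 2 ^ n + l)%:R * (dl / 2 ^+ n) by rewrite mulr_ge0// ltW.
  by apply: (filtration_measurable hF t0'); exact: (walk_gmeas hF hB).
have sub : E `<=` W `|` [set w | exists2 l, (l <= K)%N & bad l w].
  move=> w [l lK xM]; have [[j jK bj]|nb] := pselect (exists2 l, (l <= K)%N & bad l w).
    by right; exists j.
  left; exists (l * 2 ^ n)%N; first by rewrite leq_mul2r lK orbT.
  have good j : (j <= K)%N -> enorm (M ((a + j)%:R * dl) w -
        wsum B sigma (dl / 2 ^+ n) ((a + j) * 2 ^ n) w) <= x / 2.
    by move=> jK; rewrite leNgt; apply/negP => bj; apply: nb; exists j.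
  rewrite -wsum_walk -mulnDl.
  have := good _ lK; have := good 0%N isT; rewrite addn0.
  set M0 := M (a%:R * dl) w; set Ml := M ((a + l)%:R * dl) w.
  set Wl := wsum _ _ _ ((a + l) * 2 ^ n) w; set W0 := wsum _ _ _ (a * 2 ^ n) w.
  move=> h0 hl; move: xM; rewrite /= -/Ml -/M0.
  have -> : Ml - M0 = (Wl - W0) + ((Ml - Wl) - (M0 - W0)).
    by apply/matrixP => p q; rewrite !mxE; ring.
  rewrite dotDr; have := dot_le u ((Ml - Wl) - (M0 - W0)).
  have := ler_wpM2r (enorm_ge0 ((Ml - Wl) - (M0 - W0))) u1; rewrite mul1r.
  have := enormB (Ml - Wl) (M0 - W0); lra.
apply: (@le_trans _ _ (P (W `|` [set w | exists2 l, (l <= K)%N & bad l w]))).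
  by apply: le_measure; rewrite ?inE//; exact: measurableU.
apply: le_trans (measureU2 _ mW mbads) _.
apply: leeD => //; apply: le_trans Pbads _.
by rewrite lee_fin mulrC divfK.
Unshelve. all: by end_near.
Qed.

End wiener_process.

(** * Series and Borel-Cantelli lemmas *)

Section series_bounds.
Context {R : realType}.

(** This is (n + 1) ^ - (1 + a), written with expR and ln. *)
Definition pterm (a : R) n : R := expR (- a * ln n.+1%:R) / n.+1%:R.

Lemma pterm_ge0 a n : 0 <= pterm a n.
Proof. by rewrite divr_ge0// expR_ge0. Qed.

(** The term of index n + 1 is at most the decrement of (n + 1) ^ (- a) / a, because
ln (n + 2) - ln (n + 1) >= 1 / (n + 2); the sum telescopes. *)
Lemma pterm_sum_le a N : 0 < a -> \sum_(n < N) pterm a n <= 1 + a^-1.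
Proof.
move=> a0.
have step n : pterm a n.+1 <= (expR (- a * ln n.+1%:R) - expR (- a * ln n.+2%:R)) / a.
  set x : R := n.+1%:R; set y : R := n.+2%:R.
  have x0 : 0 < x by rewrite ltr0n.
  have y0 : 0 < y by rewrite ltr0n.
  have yx : y = x + 1 by rewrite /x /y -[n.+2]addn1 natrD.
  have lnxy : y^-1 <= ln y - ln x.
    have := @le_ln1Dx _ (- y^-1); rewrite ltrN2 invf_lt1// => /(_ _).
    have -> : 1 - y^-1 = x / y by rewrite (_ : x = y - 1) ?yx ?addrK// -yx; field; rewrite gt_eqF.
    rewrite ln_div ?posrE// => H.
    have := H _; rewrite yx ltrDr => /(_ x0); lra.
  rewrite ler_pdivlMr// /pterm -/y.
  have -> : expR (- a * ln x) = expR (- a * ln y) * expR (a * (ln y - ln x)).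
    by rewrite -expRD; congr expR; ring.
  have h2 := expR_ge1Dx (a * (ln y - ln x)).
  have h1 : a * y^-1 <= a * (ln y - ln x) by rewrite ler_pM2l.
  have h3 : a * y^-1 <= expR (a * (ln y - ln x)) - 1 by apply: le_trans h1 _; rewrite lerBrDl.
  rewrite -mulrA [y^-1 * a]mulrC -[X in _ <= _ - X]mulr1 -mulrBr.
  by rewrite ler_wpM2l ?expR_ge0.
case: N => [|N]; first by rewrite big_ord0 addr_ge0// invr_ge0 ltW.
rewrite big_ord_recl {1}/pterm /= ln1 mulr0 expR0 divr1 lerD2l.
apply: le_trans (_ : (1 - expR (- a * ln N.+1%:R)) / a <= _); last first.
  by rewrite ler_pdivrMr// mulVf ?gt_eqF// gerBl expR_ge0.
elim: N => [|N IH]; first by rewrite big_ord0 ln1 mulr0 expR0 subrr mul0r.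
rewrite big_ord_recr /=; apply: le_trans (lerD IH (step N)) _.
by rewrite -mulrDl addrA subrK.
Qed.

Lemma harmonic_sum_unbounded k (K : R) : exists m, K <= \sum_(k <= i < k + m) i.+1%:R^-1.
Proof.
have nd : nondecreasing_seq (series (@harmonic R)).
  by apply: nondecreasing_series => n _ _; exact: harmonic_ge0.
have /cvgryPge/(_ (K + series (@harmonic R) k)) := nondecreasing_dvgn_lt nd (@dvg_harmonic R).
move=> [n _ H]; exists n.
have := H (k + n)%N (leq_addl _ _).
by rewrite -lerBrDr sub_series_geq ?leq_addr.
Qed.

End series_bounds.

Section borel_cantelli_lemmas.
Context {R : realType} {disp : measure_display} {T : measurableType disp}.
Variable P : probability T R.

(** The series of the c n * \1_(A n) has a finite integral, hence is finite almost
everywhere. The weights are what distinguishes this from the usual lemma: it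
says that the A n which occur are sparse, although infinitely many may. *)
Lemma weighted_borel_cantelli (A : nat -> set T) (c : nat -> R) (C : R) :
  (forall n, measurable (A n)) -> (forall n, 0 <= c n) ->
  (forall N, (\sum_(n < N) (c n)%:E * P (A n) <= C%:E)%E) ->
  {ae P, forall w, exists K, forall N, \sum_(n < N) c n * \1_(A n) w <= K}.
Proof.
move=> mA c0 cP.
pose f n w := ((c n) * \1_(A n) w)%:E.
have f0 n w : (0 <= f n w)%E by rewrite lee_fin mulr_ge0.
have mf n : measurable_fun setT (f n).
  by apply/measurable_EFinP; apply: measurable_funM => //; exact: measurable_indic.
have mg : measurable_fun setT (fun w => \sum_(n <oo) f n w)%E.
  exact: ge0_emeasurable_sum.
have g0 w : (0 <= \sum_(n <oo) f n w)%E by exact: nneseries_ge0.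
have intg : P.-integrable setT (fun w => \sum_(n <oo) f n w)%E.
  apply/integrableP; split => //.
  under eq_integral do rewrite gee0_abs//.
  rewrite integral_nneseries//; apply: (@le_lt_trans _ _ C%:E); last exact: ltry.
  apply: lime_le; first by apply: is_cvg_nneseries => n _ _; exact: integral_ge0.
  apply: nearW => N; rewrite big_mkord; apply: le_trans (cP N).
  apply: lee_sum => n _; rewrite /f; under eq_integral do rewrite EFinM.
  rewrite ge0_integralZl//; first by rewrite integral_indic// setIT.
    by apply/measurable_EFinP; exact: measurable_indic.
  by rewrite lee_fin.
have := integrable_ae measurableT intg; apply: filterS => w /(_ I) gfin.
exists (fine (\sum_(n <oo) f n w)%E) => N; rewrite -lee_fin fineK// -sumEFin.
have := @nneseries_lim_ge R (fun n => f n w) xpredT 0 N (fun n _ _ => f0 n w).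
by rewrite big_mkord.
Qed.

Lemma borel_cantelli1 (A : nat -> set T) (c : nat -> R) (C : R) :
  (forall n, measurable (A n)) -> (forall N, \sum_(n < N) c n <= C) ->
  (\forall n \near \oo, (P (A n) <= (c n)%:E)%E) ->
  {ae P, forall w, \forall n \near \oo, ~ A n w}.
Proof.
move=> mA cC [n0 _ Pc].
pose A' n := A (n0 + n)%N.
have mA' n : measurable (A' n) by exact: mA.
have fin : (\sum_(n <oo) P (A' n) < +oo)%E.
  apply: (@le_lt_trans _ _ (C - \sum_(n < n0) c n)%:E); last exact: ltry.
  apply: lime_le; first by apply: is_cvg_nneseries => n _ _.
  apply: nearW => N; rewrite big_mkord.
  apply: (@le_trans _ _ (\sum_(n < N) (c (n0 + n)%N)%:E)%E).
    by apply: lee_sum => n _; apply: Pc; exact: leq_addr.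
  by rewrite sumEFin lee_fin lerBrDl; have := cC (n0 + N)%N; rewrite big_split_ord.
have N0 := lim_sup_set_cvg0 mA' fin.
exists (lim_sup_set A'); split => //.
  by apply: bigcap_measurable => // k _; apply: bigcup_measurable.
move=> w /= H k _ /=; apply: contrapT => nk; apply: H.
exists (n0 + k)%N => // n /= nn An; apply: nk; exists (n - n0)%N => /=.
  by rewrite leq_subRL// (leq_trans _ nn)// leq_addr.
by rewrite /A' subnKC// (leq_trans _ nn)// leq_addr.
Qed.

(** Given any past without an occurrence, the event E n has conditional probability at
least p n, so that no occurrence from k up to k + m has probability at most
the product of the 1 - p i <= expR (- p i), which tends to 0 as the series of the p i
diverges. No independence of the E n is required, only a bound given the past. *)
Lemma borel_cantelli2 (F : nat -> set (set T)) (E : nat -> set T) (p : nat -> R) k0 :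
  (forall n, sigma_algebra setT (F n)) -> (forall n, F n `<=` measurable) ->
  (forall n, F n `<=` F n.+1) -> (forall n, F n.+1 (E n)) -> (forall n, 0 <= p n) ->
  (forall n G, (k0 <= n)%N -> F n G -> (P G * (p n)%:E <= P (G `&` E n))%E) ->
  (forall k K, exists m, K <= \sum_(k <= i < k + m) p i) ->
  {ae P, forall w, forall k, exists2 n, (k <= n)%N & E n w}.
Proof.
move=> sF Fm Fmono FE p0 PE psum.
pose H k m := \bigcap_(i in [set i | (k <= i < k + m)%N]) ~` E i.
have HS k m : H k m.+1 = H k m `\` E (k + m)%N.
  apply/seteqP; split => w /=.
    move=> Hw; split; last by apply: Hw => /=; rewrite leq_addr addnS leqnn.
    by move=> i /= /andP[ki ikm]; apply: Hw => /=; rewrite ki addnS leqW.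
  move=> [Hw nE] i /= /andP[ki]; rewrite addnS ltnS leq_eqVlt => /predU1P[->//|ikm].
  by apply: Hw; rewrite /= ki.
have FH k m : F (k + m)%N (H k m).
  elim: m => [|m IH].
    rewrite addn0 (_ : H k 0%N = setT).
      rewrite -(sigma_algebra_id (sF k)); exact: (@measurableT _ (g_sigma_algebraType (F k))).
    apply/seteqP; split => w //= _ i /=; rewrite addn0 => /andP[ki].
    by rewrite ltnNge ki.
  rewrite HS addnS -(sigma_algebra_id (sF (k + m).+1)).
  apply: (@measurableD _ (g_sigma_algebraType (F (k + m).+1))); apply: sub_sigma_algebra.
    exact: Fmono.
  exact: FE.
have mH k m : measurable (H k m) by exact: (Fm (k + m)%N).
have mE n : measurable (E n) by exact: (Fm n.+1).
have PH k m : (k0 <= k)%N -> (P (H k m) <= (expR (- \sum_(k <= i < k + m) p i))%:E)%E.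
  move=> kk; elim: m => [|m IH].
    by rewrite addn0 big_geq// oppr0 expR0; exact: probability_le1.
  have km : (k <= k + m)%N by exact: leq_addr.
  rewrite addnS big_nat_recr//= HS opprD expRD.
  have Pfin A : measurable A -> P A \is a fin_num by move=> mA; exact: fin_num_measure.
  have mHE : measurable (H k m `&` E (k + m)%N) by exact: measurableI.
  have -> : P (H k m `\` E (k + m)%N) =
      (fine (P (H k m)) - fine (P (H k m `&` E (k + m)%N)))%:E.
    rewrite EFinB !fineK; try exact: Pfin.
    by apply: measureD => //; rewrite ltey_eq Pfin.
  have := PE _ _ (leq_trans kk km) (FH k m).
  rewrite -[X in (X * _ <= _)%E -> _](fineK (Pfin _ (mH k m))) -[X in (_ <= X)%E -> _](fineK (Pfin _ mHE)).
  rewrite -EFinM lee_fin => h.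
  rewrite lee_fin.
  move: IH; rewrite -(fineK (Pfin _ (mH k m))) lee_fin => IH.
  have g0 : 0 <= fine (P (H k m)) by rewrite fine_ge0.
  have e1 := expR_ge1Dx (- p (k + m)%N).
  have := ler_wpM2l g0 e1; have := ler_wpM2r (expR_ge0 (- p (k + m)%N)) IH; lra.
have neg k : P.-negligible (\bigcap_m H (k0 + k)%N m).
  have mI : measurable (\bigcap_m H (k0 + k)%N m) by apply: bigcap_measurable => // m _.
  apply/negligibleP => //; apply/eqP; rewrite eq_le measure_ge0 andbT.
  apply/lee_addgt0Pr => e e0; rewrite add0e.
  have [m mK] := psum (k0 + k)%N (- ln e).
  apply: (@le_trans _ _ (P (H (k0 + k)%N m))).
    by apply: le_measure; rewrite ?inE//; exact: bigcap_inf.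
  apply: le_trans (PH _ _ (leq_addr _ _)) _.
  by rewrite lee_fin -[leRHS]lnK ?posrE// ler_expR lerNl.
have := negligible_bigcup neg; apply: negligibleS => w /= nE.
apply: contrapT => nH; apply: nE => k; apply: contrapT => nk; apply: nH.
exists k => // m _ i /= /andP[ki _] Ei; apply: nk; exists i => //.
exact: leq_trans (leq_addl _ _) ki.
Qed.

End borel_cantelli_lemmas.

(** * Large increments of the Wiener integral *)

Section oscillation.
Context {R : realType} {disp : measure_display} {T : measurableType disp}.
Variable P : probability T R.
Variables (F : R -> set (set T)) (hF : filtration F).
Variables (d r : nat) (d_gt0 : (0 < d)%N).
Variables (B : R -> T -> 'cV[R]_r) (hB : brownian_motion P F B).
Variables (sigma : R -> 'M[R]_(d, r)).
Hypothesis csigma : {within `[0, +oo[, continuous sigma}.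
Variable M : R -> T -> 'cV[R]_d.
Hypothesis hM : forall t, 0 <= t -> is_wiener_integral P sigma B t (M t).
Variables (h : R) (h0 : 0 < h).

Let v i := quadvar sigma (i%:R * h) (i.+1%:R * h).

(** The event E is that the coordinate p of a fine dyadic sum increases by more than y
over the interval, where p is a coordinate which carries at least the share
1 / (2 * d) of the variance v i. It is known at time (i + 1) h, as a conditional
argument demands, while the increment of M itself is only approximated by that
of the dyadic sum: the event Bd is that one of the two ends differs by more than
y / 4, and e is left free in order to make these events summable. *)
Lemma large_increment (y e : R) i : 0 < y -> 0 < e -> exists E Bd : set T,
  [/\ F (i.+1%:R * h) E, measurable Bd, (P Bd <= e%:E)%E,
      forall w, E w -> ~ Bd w ->
        y / 2 < enorm (M (i.+1%:R * h) w - M (i%:R * h) w) &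
      0 < v i -> forall G, F (i%:R * h) G ->
        (P G * (expR (- (8 + 16 * d%:R * y ^+ 2 / v i)) / 4)%:E <= P (G `&` E))%E].
Proof.
move=> y0 e0; have t0 j : 0 <= j%:R * h by rewrite mulr_ge0// ltW.
have [vi0|vi0] := leP (v i) 0.
  exists set0, set0; split => //.
  - rewrite -(sigma_algebra_id (filtration_sigma hF (t0 i.+1))).
    exact: (@measurable0 _ (g_sigma_algebraType (F (i.+1%:R * h)))).
  - by rewrite measure0 lee_fin ltW.
have y40 : 0 < y / 4 by rewrite divr_gt0.
have e20 : 0 < e / 2 by rewrite divr_gt0.
have vi20 : 0 < v i / 2 by rewrite divr_gt0.
near \oo => n.
have b1 : (P [set w | (y / 4 < enorm (M (i.+1%:R * h) w - wsum B sigma (h / 2 ^+ n) (i.+1 * 2 ^ n) w))%R]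
      <= (e / 2)%:E)%E by near: n; exact: (wsum_near hF hB csigma hM).
have b0 : (P [set w | (y / 4 < enorm (M (i%:R * h) w - wsum B sigma (h / 2 ^+ n) (i * 2 ^ n) w))%R]
      <= (e / 2)%:E)%E by near: n; exact: (wsum_near hF hB csigma hM).
have rv : `|h / 2 ^+ n * (\sum_(k < 1 * 2 ^ n)
     fnorm (sigma ((i * 2 ^ n + k)%N%:R * (h / 2 ^+ n))) ^+ 2) -
    quadvar sigma (i%:R * h) ((i + 1)%:R * h)| <= v i / 2.
  by near: n; exact: riemann_quadvar.
set dn := h / 2 ^+ n; have dn0 : 0 < dn by rewrite divr_gt0// exprn_gt0.
have tE N : (N * 2 ^ n)%N%:R * dn = N%:R * h.
  by rewrite natrM natrX /dn; field; rewrite expf_neq0.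
rewrite -/dn mul1n addn1 -/(v i) in rv.
set V := dn * _ in rv.
have Vv : v i / 2 <= V by move: rv; rewrite ler_norml => /andP[+ _]; lra.
have dR : 0 < d%:R :> R by rewrite ltr0n.
have [p Vp] : exists p : 'I_d, v i / (2 * d%:R) <=
    walk_var dn (proj_coef sigma dn (delta_mx p 0)) (i * 2 ^ n) (2 ^ n).
  apply/not_existsP => np.
  have : V < \sum_(p < d) v i / (2 * d%:R).
    rewrite /V -walk_var_sum; apply: ltr_sum => [|p _].
      by apply/hasP; exists (Ordinal d_gt0) => //; rewrite mem_index_enum.
    by rewrite ltNge; apply/negP; exact: np.
  rewrite sumr_const card_ord -[_ *+ d]mulr_natl.
  have -> : d%:R * (v i / (2 * d%:R)) = v i / 2 by field; rewrite gt_eqF.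
  by rewrite ltNge Vv.
set D := walk B dn (proj_coef sigma dn (delta_mx p 0)) (i * 2 ^ n) (2 ^ n).
pose bad j := [set w | y / 4 < enorm (M (j%:R * h) w - wsum B sigma dn (j * 2 ^ n) w)].
have mbad j : measurable (bad j).
  apply: gmeas_gt => U mU; rewrite -[X in measurable X]setTI.
  apply: measurable_enorm => // q; under eq_fun do rewrite 2!mxE.
  by apply: measurable_funB; [exact: (wiener_meas hM)|exact: (wsum_meas hF hB)].
exists [set w | y < D w], (bad i `|` bad i.+1); split.
- apply: gmeas_gt; rewrite /D.
  have := walk_gmeas hF hB dn0 (proj_coef sigma dn (delta_mx p 0)) (i * 2 ^ n) (2 ^ n).
  by rewrite -mulSnr tE.
- exact: measurableU.
- apply: le_trans (measureU2 _ (mbad i) (mbad i.+1)) _.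
  by rewrite [e]splitr EFinD; exact: leeD.
- move=> w /= yD /not_orP[/negP]; rewrite -leNgt => g0 /negP; rewrite -leNgt => g1.
  move: yD; rewrite /D -wsum_walk -mulSnr.
  set M1 := M (i.+1%:R * h) w in g1 *; set M0 := M (i%:R * h) w in g0 *.
  set W1 := wsum _ _ _ (i.+1 * 2 ^ n) w in g1 *; set W0 := wsum _ _ _ (i * 2 ^ n) w in g0 *.
  rewrite dot_delta => yD.
  have := coord_le_enorm (W1 - W0) p; have := ler_norm ((W1 - W0) p 0).
  have -> : W1 - W0 = (M1 - M0) - ((M1 - W1) - (M0 - W0)) by apply/matrixP => p' q; rewrite !mxE; ring.
  have : y < ((M1 - M0) - ((M1 - W1) - (M0 - W0))) p 0.
    by apply: lt_le_trans yD _; rewrite !mxE; lra.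
  have := enormB (M1 - M0) ((M1 - W1) - (M0 - W0)); have := enormB (M1 - W1) (M0 - W0); lra.
- move=> _ G FG; set s2 := walk_var _ _ _ _ in Vp.
  have s20 : 0 < s2 by apply: lt_le_trans Vp; rewrite divr_gt0// mulr_gt0.
  have := @walk_lower _ _ _ P F hF r B hB dn dn0 (proj_coef sigma dn (delta_mx p 0))
    (i * 2 ^ n) (2 ^ n) (Num.sqrt s2) y G.
  rewrite sqrtr_gt0 s20 sqr_sqrtr ?(ltW s20)// tE => /(_ isT erefl (ltW y0) FG).
  apply: le_trans; apply: lee_wpmul2l => //; rewrite lee_fin ler_pM2r// ler_expR lerN2 lerD2l.
  apply: (@le_trans _ _ (8 * (y ^+ 2 / (v i / (2 * d%:R))))).
    apply: ler_wpM2l => //; apply: ler_wpM2l; first exact: sqr_ge0.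
    rewrite lef_pV2 ?posrE//.
    by rewrite divr_gt0// mulr_gt0.
  by rewrite le_eqVlt; apply/orP; left; apply/eqP; field; rewrite !gt_eqF.
Unshelve. all: by end_near. Qed.

(** The conditional probabilities of the events of large_increment are at least
expR (- 8 - ln i) / 4, a multiple of 1 / i, hence have a divergent sum, while the
exceptional events, given probability at most (i + 1) ^ - 2, occur finitely often. *)
Lemma wiener_io (y : R) i0 : 0 < y ->
  (forall i, (i0 <= i)%N -> 0 < v i /\ 16 * d%:R * y ^+ 2 <= v i * ln i%:R) ->
  {ae P, forall w, forall k, exists2 i, (k <= i)%N &
     y / 2 < enorm (M (i.+1%:R * h) w - M (i%:R * h) w)}.
Proof.
move=> y0 vy; have t0 j : 0 <= j%:R * h by rewrite mulr_ge0// ltW.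
have tle j k : (j <= k)%N -> j%:R * h <= k%:R * h by move=> jk; rewrite ler_pM2r// ler_nat.
have pt0 i : 0 < pterm 1 i :> R by rewrite divr_gt0// expR_gt0.
have /boolp.choice[E HE] := fun i => large_increment i y0 (pt0 i).
have /boolp.choice[Bd {}HE] := HE.
have bc1 : {ae P, forall w, \forall i \near \oo, ~ Bd i w}.
  apply: (borel_cantelli1 (c := pterm 1) (C := 1 + 1^-1)).
  - by move=> i; have [] := HE i.
  - by move=> N; exact: pterm_sum_le.
  - by exists 0%N => // i _ /=; have [] := HE i.
have bc2 : {ae P, forall w, forall k, exists2 i, (k <= i)%N & E i w}.
  apply: (borel_cantelli2 (F := fun i => F (i%:R * h)) (k0 := maxn i0 1)
    (p := fun i => expR (- 8) / 4 * i.+1%:R^-1)).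
  - by move=> i; exact: filtration_sigma.
  - by move=> i; exact: filtration_measurable.
  - by move=> i; apply: filtrationS => //; exact: tle.
  - by move=> i; have [] := HE i.
  - by move=> i; rewrite mulr_ge0 ?invr_ge0// divr_ge0 ?expR_ge0.
  - move=> i G; rewrite geq_max => /andP[/vy[vi0 yv] i1] FG.
    have [_ _ _ _ /(_ vi0 _ FG)] := HE i; apply: le_trans; apply: lee_wpmul2l => //.
    rewrite lee_fin mulrAC ler_pM2r//.
    have iR : 0 < i%:R :> R by rewrite ltr0n.
    apply: (@le_trans _ _ (expR (- 8 - ln i%:R))).
      rewrite expRD [expR (- ln _)]expRN lnK ?posrE// ler_wpM2l ?expR_ge0//.
      by rewrite lef_pV2 ?posrE ?ltr0n// ler_nat.
    by rewrite ler_expR -opprD lerN2 lerD2l ler_pdivrMr// [leRHS]mulrC.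
  - move=> k K; have e0 : 0 < expR (- 8) / 4 :> R by rewrite divr_gt0// expR_gt0.
    have [m mK] := harmonic_sum_unbounded k (K / (expR (- 8) / 4)).
    by exists m; rewrite -mulr_sumr mulrC -ler_pdivrMr.
move: bc1 bc2; apply: filterS2 => w [k1 _ nBd] Eio k.
have [i ki Ei] := Eio (maxn k k1).
exists i; first by apply: leq_trans ki; exact: leq_maxl.
have [_ _ _ big _] := HE i; apply: big => //.
by apply: nBd => /=; apply: leq_trans ki; exact: leq_maxr.
Qed.

End oscillation.

(** * Oscillation of the Wiener integral over one interval *)

Section maximal.
Context {R : realType} {disp : measure_display} {T : measurableType disp}.
Variable P : probability T R.
Variables (F : R -> set (set T)) (hF : filtration F).
Variables (d r : nat) (B : R -> T -> 'cV[R]_r) (hB : brownian_motion P F B).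
Variables (sigma : R -> 'M[R]_(d, r)).
Hypothesis csigma : {within `[0, +oo[, continuous sigma}.
Variable M : R -> T -> 'cV[R]_d.
Hypothesis hM : forall t, 0 <= t -> is_wiener_integral P sigma B t (M t).
Variables (h : R) (h0 : 0 < h).

Let v i := quadvar sigma (i%:R * h) (i.+1%:R * h).

(** The signed coordinate vectors: 2 p and 2 p + 1 stand for plus and minus the vector
of index p. A bound on all these projections bounds the absolute values of the
coordinates. *)
Let dir l : 'cV[R]_d := (-1) ^+ l *: \col_i (i == l./2 :> nat)%:R.

Let dir_le1 l : enorm (dir l) <= 1.
Proof.
rewrite -(ler_pXn2r (n := 2))// ?nnegrE ?enorm_ge0// enorm_sqr expr1n /dot.
have [dl|ld] := leqP d l./2.
  by rewrite big1// => i _; rewrite !mxE ltn_eqF ?mulr0 ?mul0r// (leq_trans _ dl).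
rewrite (bigD1 (Ordinal ld))//= big1 ?addr0; last first.
  by move=> i; rewrite -val_eqE /= => /negPf il; rewrite !mxE il mulr0 mul0r.
by rewrite !mxE eqxx mulr1 -expr2 sqrr_sign.
Qed.

Let dir_dot l (x : 'cV[R]_d) (p : 'I_d) : l./2 = p -> dot (dir l) x = (-1) ^+ l * x p 0.
Proof.
move=> lp; rewrite /dot (bigD1 p)//= big1 ?addr0; last first.
  by move=> i; rewrite -val_eqE /= => /negPf il; rewrite !mxE lp il mulr0 mul0r.
by rewrite !mxE lp eqxx mulr1.
Qed.

Let dyadic_exceed (e : R) i l m := [set w | exists2 k, (k <= 2 ^ m)%N &
  2 * (e / 2) < dot (dir l) (M ((i * 2 ^ m + k)%:R * (h / 2 ^+ m)) w -
                        M ((i * 2 ^ m)%:R * (h / 2 ^+ m)) w)].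

Let dyadic_time N m : (N * 2 ^ m)%N%:R * (h / 2 ^+ m) = N%:R * h.
Proof. by rewrite natrM natrX; field; rewrite expf_neq0. Qed.

(** For each of the 2 d signed coordinates the events of exceeding e at a dyadic time
of level m increase with m, so their union has the same bound as each of them;
it contains every excess at an arbitrary time, because the excess of a
continuous path is strict and therefore persists at nearby dyadic times. The
event has to be the same for all V, since v i < V is known for large i only. The
index 2 d gives the zero vector; it accounts for the constant 2 d + 1. *)
Lemma maximal_event (e : R) i : 0 < e -> exists Bad : set T,
  [/\ measurable Bad,
      (forall V : R, 0 < V -> v i < V ->
        (P Bad <= ((d.*2.+1)%:R * expR (- (e ^+ 2 / (8 * V))))%:E)%E) &
      forall w, {within `[0, +oo[, continuous (fun t => M t w)} -> ~ Bad w ->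
        forall t p, i%:R * h <= t <= i.+1%:R * h ->
          `|M t w p 0 - M (i%:R * h) w p 0| <= e].
Proof.
move=> e0; have e20 : 0 < e / 2 by rewrite divr_gt0.
have hm0 m : 0 < h / 2 ^+ m by rewrite divr_gt0// exprn_gt0.
have key l m (V : R) : 0 < V -> v i < V -> measurable (dyadic_exceed e i l m) /\
    (P (dyadic_exceed e i l m) <= (expR (- (e ^+ 2 / (8 * V))))%:E)%E.
  move=> V0 vV; have th0 : 0 <= e / 2 / V by rewrite !divr_ge0// ltW.
  (* This th minimises the exponent th ^+ 2 * V / 2 - th * (e / 2). *)
  have := wiener_max hF hB csigma hM (V := V) (a := i * 2 ^ m) (K := 2 ^ m) (hm0 m) (dir_le1 l) _ e20 th0.
  rewrite -mulSnr !dyadic_time => /(_ vV)[mE PE]; split => //.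
    by rewrite /dyadic_exceed dyadic_time.
  rewrite /dyadic_exceed dyadic_time; apply: le_trans PE _; rewrite lee_fin ler_expR.
  by rewrite le_eqVlt; apply/orP; left; apply/eqP; field; rewrite gt_eqF.
have V00 : 0 < Num.max (v i) 0 + 1 by rewrite ltr_pwDr// le_max lexx orbT.
have vV0 : v i < Num.max (v i) 0 + 1.
  by apply: le_lt_trans (_ : Num.max (v i) 0 < _); rewrite ?le_max ?lexx// ltrDl.
have mex l m : measurable (dyadic_exceed e i l m) by have [] := key l m _ V00 vV0.
pose A l := \bigcup_m dyadic_exceed e i l m.
have mA l : measurable (A l) by apply: bigcup_measurable.
have nd l : nondecreasing_seq (dyadic_exceed e i l).
  apply/nondecreasing_seqP => m; apply/subsetPset => w [k km wk].
  exists (k * 2)%N; first by rewrite expnS mulnC leq_mul2l.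
  have E N : (N * 2)%N%:R * (h / 2 ^+ m.+1) = N%:R * (h / 2 ^+ m) :> R.
    by rewrite natrM exprS; field; rewrite expf_neq0.
  by rewrite expnS [(2 * _)%N]mulnC mulnA -mulnDl !E.
exists [set w | exists2 l, (l <= d.*2)%N & A l w]; split.
- exact: (bigcup_measurable (P := [set l | (l <= d.*2)%N])).
- move=> V V0 vV.
  have [] // := measure_exists_le (P := P) (K := d.*2) mA (e := expR (- (e ^+ 2 / (8 * V)))).
  move=> l _.
  have cv := nondecreasing_cvg_mu (mu := P) (fun m => mex l m) (mA l) (nd l).
  rewrite -(cvg_lim _ cv)//; apply: lime_le; first by apply/cvg_ex; eexists; exact: cv.
  by apply: nearW => m /=; have [] := key l m V V0 vV.
move=> w cM nBad t p /andP[it ti].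
have small l : (l <= d.*2)%N -> l./2 = p -> (-1) ^+ l * (M t w p 0 - M (i%:R * h) w p 0) <= e.
  move=> ld lp; rewrite leNgt; apply/negP => big.
  have t0 : 0 <= t by apply: le_trans it; rewrite mulr_ge0// ltW.
  pose g (s : R) := (-1) ^+ l * (M (Num.max 0 s) w p 0 - M (i%:R * h) w p 0).
  have cg : continuous g.
    move=> s; apply: cvgM; first exact: cvg_cst.
    apply: cvgB; last exact: cvg_cst.
    apply: (cvg_comp (fun s => M (Num.max 0 s) w) (fun x : 'cV[R]_d => x p 0)).
      exact: (continuous_extend cM).
    exact: coord_continuous.
  have gt : e < g t by rewrite /g max_r.
  have : \forall s \near t, e < g s.
    have /cvgrPdist_lt/(_ (g t - e)) := cg t; rewrite subr_gt0 => /(_ gt).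
    by apply: filterS => s; have := ler_norm (g t - g s); lra.
  move=> [eta /= eta0 near_t].
  have eta20 : 0 < eta / 2 by rewrite divr_gt0.
  have [m _ /(_ m (leqnn m)) meta] := mesh_small h0 eta20.
  have [k km kt] : exists2 k, (k <= 2 ^ m)%N & `|t - (i%:R * h + k%:R * (h / 2 ^+ m))| <= h / 2 ^+ m.
    move: it; rewrite le_eqVlt => /predU1P[<-|it].
      by exists 0%N => //; rewrite mul0r addr0 subrr normr0 ltW.
    have := @mesh_cell _ (h / 2 ^+ m) (t - i%:R * h) (2 ^ m) (hm0 m).
    have -> : (2 ^ m)%N%:R * (h / 2 ^+ m) = h.
      by rewrite -[(2 ^ m)%N]mul1n dyadic_time mul1r.
    rewrite subr_gt0 lerBlDl => /(_ it).
    have -> : i%:R * h + h = i.+1%:R * h by rewrite -[i.+1]addn1 natrD mulrDl mul1r.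
    move=> /(_ ti)[k km /andP[k1 k2]]; exists k; first exact: ltnW.
    rewrite opprD addrA ger0_norm; last by rewrite subr_ge0 ltW.
    by rewrite lerBlDl (le_trans k2)// -[k.+1]addn1 natrD mulrDl mul1r.
  have : e < g (i%:R * h + k%:R * (h / 2 ^+ m)).
    by apply: near_t; rewrite /ball_/=; apply: le_lt_trans kt _; apply: le_lt_trans meta _; lra.
  rewrite /g max_r; last by rewrite addr_ge0// mulr_ge0// ltW.
  rewrite -(dyadic_time i m) -mulrDl -natrD => eg.
  apply: nBad; exists l => //; exists m => //; exists k => //.
  rewrite dyadic_time mulrC divfK// (dir_dot _ lp) !mxE; move: eg.
  by rewrite dyadic_time.
have pd := ltn_ord p.
have := small p.*2 _ (doubleK p); rewrite leq_double => /(_ (ltnW pd)).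
have := small p.*2.+1 _ (uphalf_double p); rewrite ltn_double => /(_ pd).
rewrite exprS -[p.*2]muln2 exprM sqrr_sign mulr1 mul1r mulN1r => h1 h2.
by rewrite ler_norml h2 andbT lerNl.
Qed.

End maximal.

Section almost_sure_increments.
Context {R : realType} {disp : measure_display} {T : measurableType disp}.
Variable P : probability T R.
Variables (F : R -> set (set T)) (hF : filtration F).
Variables (d r : nat) (B : R -> T -> 'cV[R]_r) (hB : brownian_motion P F B).
Variables (sigma : R -> 'M[R]_(d, r)).
Hypothesis csigma : {within `[0, +oo[, continuous sigma}.
Variable M : R -> T -> 'cV[R]_d.
Hypothesis hM : forall t, 0 <= t -> is_wiener_integral P sigma B t (M t).
Variables (h : R) (h0 : 0 < h).

Let v i := quadvar sigma (i%:R * h) (i.+1%:R * h).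

(** The oscillation is measured from the left end of the interval and coordinate by
coordinate. *)
Definition increment_le (m : R -> 'cV[R]_d) (e : R) n : Prop :=
  forall t p, n%:R * h <= t <= n.+1%:R * h -> `|m t p 0 - m (n%:R * h) p 0| <= e.

(** With V = c / ln n the bound of maximal_event becomes a power of n. The index is
shifted by one to avoid the logarithm of 0 and to match pterm. *)
Let bad_events (e c : R) : 0 < e -> 0 < c ->
  (\forall n \near \oo, v n * ln n%:R < c) ->
  exists Bad : nat -> set T,
  [/\ forall n, measurable (Bad n),
      (\forall n \near \oo, (P (Bad n.+1) <=
         ((d.*2.+1)%:R * expR (- (e ^+ 2 / (8 * c)) * ln n.+1%:R))%:E)%E) &
      forall w n, {within `[0, +oo[, continuous (fun t => M t w)} -> ~ Bad n w ->
        increment_le (fun t => M t w) e n].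
Proof.
move=> e0 c0 [n0 _ vc].
have /boolp.choice[Bad HB] := fun i => maximal_event hF hB csigma hM h0 i e0.
exists Bad; split => [n||w n cw nB].
- by have [] := HB n.
- exists (maxn n0 1) => // n /=; rewrite geq_max => /andP[nn0 n1].
  have ln0 : 0 < ln n.+1%:R :> R by rewrite ln_gt0// ltr1n.
  have [_ PB _] := HB n.+1.
  have V0 : 0 < c / ln n.+1%:R by rewrite divr_gt0.
  have := PB _ V0; rewrite ltr_pdivlMr// => /(_ (vc _ (leqW nn0))).
  congr (_ <= (_ * expR _)%:E)%E.
  by field; rewrite !gt_eqF.
- by have [_ _ +] := HB n => /(_ w cw nB).
Qed.

(** The bad events have probability at most (2 d + 1) * n ^ (- e ^+ 2 / (8 * c)), and
16 * c <= e ^+ 2 makes the exponent at most - 2. *)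
Lemma small_increments (e c : R) : 0 < e -> 0 < c -> 16 * c <= e ^+ 2 ->
  (\forall n \near \oo, v n * ln n%:R < c) ->
  {ae P, forall w, {within `[0, +oo[, continuous (fun t => M t w)} ->
     \forall n \near \oo, increment_le (fun t => M t w) e n}.
Proof.
move=> e0 c0 ce vc; have [Bad [mB PB good]] := bad_events e0 c0 vc.
have : {ae P, forall w, \forall n \near \oo, ~ Bad n.+1 w}.
  apply: (borel_cantelli1 (A := fun n => Bad n.+1)
    (c := fun n => (d.*2.+1)%:R * pterm 1 n) (C := (d.*2.+1)%:R * (1 + 1^-1))).
  - by move=> n; exact: mB.
  - by move=> N; rewrite -mulr_sumr ler_pM2l ?ltr0n//; exact: pterm_sum_le.
  apply: filterS PB => n; move/le_trans; apply; rewrite lee_fin ler_pM2l ?ltr0n//.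
  have n0 : 0 < n.+1%:R :> R by rewrite ltr0n.
  rewrite /pterm -[X in _ <= _ / X]lnK ?posrE// -expRN -expRD ler_expR.
  have ln0 : 0 <= ln n.+1%:R :> R by rewrite ln_ge0// ler1n.
  have : 2 <= e ^+ 2 / (8 * c) by rewrite ler_pdivlMr ?mulr_gt0//; lra.
  by move=> /(ler_wpM2r ln0); lra.
apply: filterS => w [n0 _ nB] cw; exists n0.+1 => // -[//|n] /=.
rewrite ltnS => nn; apply: good => //; exact: nB.
Qed.

(** Without a condition on e, the exponent of n in the bound on the bad events is
merely negative; the additional factor 1 / n makes the series converge. *)
Lemma rare_increments (e c : R) : 0 < e -> 0 < c ->
  (\forall n \near \oo, v n * ln n%:R < c) ->
  {ae P, forall w, {within `[0, +oo[, continuous (fun t => M t w)} ->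
     exists K : R, forall N, \sum_(n < N)
       n.+1%:R^-1 * (~~ `[< increment_le (fun t => M t w) e n.+1 >])%:R <= K}.
Proof.
move=> e0 c0 vc; have [Bad [mB [n0 _ PB] good]] := bad_events e0 c0 vc.
pose a := e ^+ 2 / (8 * c); have a0 : 0 < a by rewrite divr_gt0 ?exprn_gt0 ?mulr_gt0.
pose D : R := (d.*2.+1)%:R; have D0 : 0 < D by rewrite ltr0n.
have term n : ((n.+1%:R^-1)%:E * P (Bad n.+1) <= ((n < n0)%:R + D * pterm a n)%:E)%E.
  have [nn|nn] := ltnP n n0.
    apply: (@le_trans _ _ 1%:E); last by rewrite lee_fin lerDl mulr_ge0 ?pterm_ge0// ltW.
    rewrite -[leRHS]mule1; apply: lee_pmul => //; last exact: probability_le1.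
    by rewrite lee_fin invf_le1// ler1n.
  apply: (@le_trans _ _ ((n.+1%:R^-1)%:E * (D * expR (- a * ln n.+1%:R))%:E)%E).
    by apply: lee_wpmul2l; [rewrite lee_fin invr_ge0|exact: PB].
  by rewrite -EFinM lee_fin add0r /pterm mulrCA [_^-1 * _]mulrC.
have : {ae P, forall w, exists K : R, forall N, \sum_(n < N) n.+1%:R^-1 * \1_(Bad n.+1) w <= K}.
  apply: (weighted_borel_cantelli (A := fun n => Bad n.+1) (c := fun n => n.+1%:R^-1) (C := n0%:R + D * (1 + a^-1))) => //.
  move=> N; apply: (@le_trans _ _ (\sum_(n < N) ((n < n0)%:R + D * pterm a n)%:E)%E).
    by apply: lee_sum => n _; exact: term.
  rewrite sumEFin lee_fin big_split/= lerD//; last first.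
    by rewrite -mulr_sumr ler_pM2l//; exact: pterm_sum_le.
  elim: N => [|N IH]; first by rewrite big_ord0.
  have [Nn|Nn] := leqP n0 N.
    by rewrite big_ord_recr/= ltnNge Nn addr0.
  apply: (@le_trans _ _ (\sum_(i < N.+1) 1)); first by apply: ler_sum => i _; case: (i < n0)%N.
  by rewrite sumr_const card_ord ler_nat.
apply: filterS => w [K HK] cw; exists K => N; apply: le_trans (HK N).
apply: ler_sum => n _; rewrite ler_wpM2l ?invr_ge0//.
case: asboolP => // ninc; rewrite indicE mem_set//.
by apply: contrapT => nB; apply: ninc; exact: good.
Qed.

End almost_sure_increments.

(** * Contraction along a path *)

Section differential_inequality.
Context {R : realType}.

(** The integral starts at - 1, so that 0 is an interior point and the derivative
there is two-sided. *)
Lemma primitive (f : R -> R) : continuous f -> exists F : R -> R,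
  (forall t : R, -1 < t -> is_derive t 1 F (f t)) /\
  forall s t : R, 0 <= s -> s <= t ->
    \int[lebesgue_measure]_(x in `[s, t]) f x = F t - F s.
Proof.
move=> cf; exists (fun t => \int[lebesgue_measure]_(x in `[-1, t]) f x); split.
  move=> t t1; have t2 : t < t + 1 by rewrite ltrDl.
  have [dF <-] := continuous_FTC1_closed t2 (continuous_itv_integrable (-1) (t + 1) cf) t1 (cf t).
  by rewrite derive1E; exact: derivableP.
move=> s t s0 st.
have s1 : -1 <= s by apply: le_trans s0; rewrite lerN10.
by rewrite (Rintegral_itv_split cf s1 st) addrAC subrr add0r.
Qed.

(** The function expR (al * s) * (G s - K / al) is nonincreasing. *)
Lemma gronwall (G G' : R -> R) (a b al K : R) : 0 < al ->
  (forall t : R, a <= t <= b -> is_derive t 1 G (G' t)) ->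
  (forall t : R, a <= t <= b -> G' t <= - al * G t + K) ->
  forall t : R, a <= t <= b -> G t <= expR (- al * (t - a)) * G a + K / al - expR (- al * (t - a)) * (K / al).
Proof.
move=> al0 dG lG t /andP[at_ tb].
pose Phi (s : R) := expR (al * s) * (G s - K / al).
have dPhi (s : R) : a <= s <= b -> is_derive s 1 Phi
    (expR (al * s) * (G' s) + (G s - K / al) * (al * expR (al * s))).
  move=> sab; have dGs := dG _ sab.
  have dE : is_derive s 1 (fun s : R => expR (al * s)) (al * expR (al * s)).
    rewrite mulrC; apply: (@is_derive1_comp _ expR ( *%R al)).
    by have := @is_deriveZ R R R id al s 1 1 _; rewrite /GRing.scale/= mulr1; exact.
  have dH : is_derive s 1 (fun s : R => G s - K / al) (G' s).
    by rewrite -[X in is_derive _ _ _ X]subr0; apply: is_deriveB.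
  by have := is_deriveM dE dH; rewrite /GRing.scale/= .
have Phi_le : Phi t <= Phi a.
  apply: (@ler0_derive1_nincr _ Phi a b) => //.
  - move=> s; rewrite in_itv/= => /andP[/ltW as_ /ltW sb].
    by have [] := dPhi s; rewrite ?as_ ?sb.
  - move=> s; rewrite in_itv/= => /andP[/ltW as_ /ltW sb].
    have sab : a <= s <= b by rewrite as_.
    rewrite derive1E; have [_ ->] := dPhi s sab.
    have -> : expR (al * s) * G' s + (G s - K / al) * (al * expR (al * s)) =
      expR (al * s) * (G' s - (- al * G s + K)) by field; rewrite gt_eqF.
    by rewrite mulr_ge0_le0 ?expR_ge0// subr_le0; exact: lG.
  - apply: derivable_within_continuous => s; rewrite in_itv/= => sab.
    by have [] := dPhi s sab.
have e0 : 0 < expR (al * t) by exact: expR_gt0.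
have E : expR (- al * (t - a)) = expR (al * a) / expR (al * t).
  by rewrite -expRN -expRD; congr expR; ring.
rewrite E -(ler_pM2l e0).
have -> : expR (al * t) * (expR (al * a) / expR (al * t) * G a + K / al -
   expR (al * a) / expR (al * t) * (K / al)) = Phi a + expR (al * t) * (K / al).
  by rewrite /Phi; field; rewrite !gt_eqF.
by move: Phi_le; rewrite {1}/Phi mulrBr lerBlDr.
Qed.

End differential_inequality.

Section path.
Context {R : realType}.
Variables (d : nat) (A : 'M[R]_d) (x m : R -> 'cV[R]_d) (xi : 'cV[R]_d).
Hypothesis cx : {within `[0, +oo[, continuous x}.
Hypothesis hx : forall t, 0 <= t -> x t = xi + vint (fun s => A *m x s) t + m t.

(** The Lebesgue integral of A *m x is the differentiable part of x; all the
roughness is in m. *)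
Lemma smooth_part : exists z : R -> 'cV[R]_d,
  (forall t, 0 <= t -> x t = z t + m t) /\
  (forall (t : R) k, 0 <= t -> is_derive t 1 (fun s : R => z s k 0) ((A *m x t) k 0)).
Proof.
pose f k (s : R) := (A *m x (Num.max 0 s)) k 0.
have cf k : continuous (f k).
  have -> : f k = (fun s => \sum_j A k j * x (Num.max 0 s) j 0).
    by apply/funext => s; rewrite /f mxE.
  apply: continuous_big; first exact: add_continuous.
  move=> j _ s; apply: cvgM; first exact: cvg_cst.
  apply: (cvg_comp (fun s => x (Num.max 0 s)) (fun M : 'cV[R]_d => M j 0)).
    exact: (continuous_extend cx).
  exact: coord_continuous.
have /boolp.choice[Fk HF] := fun k => primitive (cf k).
exists (fun t => \col_k (xi k 0 + (Fk k t - Fk k 0))); split.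
  move=> t t0; rewrite hx//; congr (_ + _); apply/matrixP => k j; rewrite !mxE ord1.
  congr (_ + _); have [_ <-//] := HF k; apply: eq_Rintegral => s.
  by rewrite inE/= in_itv/= => /andP[s0 _]; rewrite /f max_r.
move=> t k t0; have [dF _] := HF k.
have -> : (fun s : R => (\col_k0 (xi k0 0 + (Fk k0 s - Fk k0 0))) k 0) =
    (fun s : R => Fk k s + (xi k 0 - Fk k 0)).
  by apply/funext => s; rewrite mxE; ring.
have -> : (A *m x t) k 0 = f k t + 0 by rewrite /f max_r// addr0.
have dFt : is_derive t 1 (Fk k) (f k t) by apply: dF; apply: lt_le_trans t0; rewrite ltrN10.
by apply: is_deriveD.
Qed.

(** The process y = x - (m - m a) is differentiable with derivative A (y + (m - m a)),
so the squared Lyapunov norm of y decreases at rate 2 al, up to a forcing term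
which is linear in m - m a. Half of that decrease absorbs the forcing by Young's
inequality, and the other half remains for gronwall. *)
Lemma energy_bound n (N : 'M[R]_(n, d)) (al : R) : 0 < al ->
  (forall y, dot (N *m y) (N *m (A *m y)) <= - al * dot (N *m y) (N *m y)) ->
  forall a b e : R, 0 <= a -> 0 <= e ->
  (forall t p, a <= t <= b -> `|m t p 0 - m a p 0| <= e) ->
  forall t, a <= t <= b ->
  dot (N *m (x t - (m t - m a))) (N *m (x t - (m t - m a))) <=
  expR (- al * (t - a)) * dot (N *m x a) (N *m x a) +
    fnorm (N *m A) ^+ 2 * d%:R / al ^+ 2 * e ^+ 2.
Proof.
move=> al0 lyap a b e a0 e0 me t /andP[at_ tb].
have [z [xz dz]] := smooth_part.
pose y s := z s + m a.
have yE s : 0 <= s -> y s = x s - (m s - m a).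
  by move=> s0; rewrite /y xz//; apply/matrixP => i j; rewrite !mxE; ring.
pose G s := dot (N *m y s) (N *m y s).
pose G' s := 2 * dot (N *m y s) (N *m (A *m x s)).
have dG (s : R) : a <= s <= b -> is_derive s 1 G (G' s).
  move=> /andP[as_ _]; have s0 := le_trans a0 as_.
  have dNy i : is_derive s 1 (fun s : R => (N *m y s) i 0) ((N *m (A *m x s)) i 0).
    have -> : (fun s : R => (N *m y s) i 0) =
        \sum_(j < d) (fun s : R => N i j *: (z s j 0 + m a j 0)).
      by apply/funext => s'; rewrite mxE fct_sumE; apply: eq_bigr => j _; rewrite mxE.
    rewrite mxE; apply: is_derive_sum => j; apply: is_deriveZ.
    by rewrite -[X in is_derive _ _ _ X]addr0; have := dz s j s0 => dzj; apply: is_deriveD.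
  have -> : G = \sum_(i < n) (fun s : R => (N *m y s) i 0 * (N *m y s) i 0).
    by apply/funext => s'; rewrite fct_sumE.
  rewrite /G' /dot mulr_sumr; apply: is_derive_sum => i.
  have := is_deriveM (dNy i) (dNy i); rewrite /GRing.scale/=.
  by congr is_derive; ring.
pose K := fnorm (N *m A) ^+ 2 * d%:R * e ^+ 2 / al.
have K0 : 0 <= K by rewrite divr_ge0 ?(ltW al0)// mulr_ge0 ?sqr_ge0// mulr_ge0 ?sqr_ge0.
have lG (s : R) : a <= s <= b -> G' s <= - al * G s + K.
  move=> sab; have s0 : 0 <= s by case/andP: sab => /(le_trans a0).
  pose eta := m s - m a.
  have xsE : x s = y s + eta by rewrite yE// subrK.
  have E : N *m (A *m (y s + eta)) = N *m (A *m y s) + N *m (A *m eta).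
    by rewrite -!mulmxDr.
  rewrite /G' xsE E dotDr.
  have := lyap (y s); rewrite -/(G s) => h1.
  have h2 := dot_le (N *m y s) (N *m (A *m eta)).
  have h3 : enorm (N *m (A *m eta)) ^+ 2 <= fnorm (N *m A) ^+ 2 * (d%:R * e ^+ 2).
    rewrite mulmxA; apply: le_trans (_ : (fnorm (N *m A) * enorm eta) ^+ 2 <= _).
      by rewrite ler_pXn2r ?nnegrE ?mulr_ge0 ?enorm_ge0 ?sqrtr_ge0// enorm_mulmx.
    rewrite exprMn ler_wpM2l ?sqr_ge0//; apply: enorm_le_coord => p.
    by rewrite !mxE; exact: me.
  have h4 : enorm (N *m y s) ^+ 2 = G s by rewrite enorm_sqr.
  set u := enorm _ in h2 h4; set w := enorm _ in h2 h3.
  have h5 : 2 * (u * w) <= al * u ^+ 2 + w ^+ 2 / al.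
    have := mulr_ge0 (ltW al0) (sqr_ge0 (u - w / al)).
    have -> : al * (u - w / al) ^+ 2 = al * u ^+ 2 - 2 * (u * w) + w ^+ 2 / al by field; rewrite gt_eqF.
    lra.
  have h6 : w ^+ 2 / al <= K.
    by rewrite ler_pM2r ?invr_gt0//; apply: le_trans h3 _; rewrite mulrA.
  rewrite h4 in h5; lra.
have tab : a <= t <= b by rewrite at_.
have := gronwall al0 dG lG tab.
have ya : y a = x a by rewrite yE// subrr subr0.
rewrite /G (yE t (le_trans a0 at_)) ya => /le_trans; apply.
have -> : fnorm (N *m A) ^+ 2 * d%:R / al ^+ 2 * e ^+ 2 = K / al by rewrite /K; field; rewrite gt_eqF.
by rewrite lerBlDr lerDl mulr_ge0 ?expR_ge0// divr_ge0// ltW.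
Qed.

End path.

Section stability.
Context {R : realType}.

Definition solution_path d (A : 'M[R]_d) (xi : 'cV[R]_d) (m x : R -> 'cV[R]_d) : Prop :=
  [/\ {within `[0, +oo[, continuous x}, {within `[0, +oo[, continuous m} &
      forall t, 0 <= t -> x t = xi + vint (fun s => A *m x s) t + m t].

(** Young's inequality for the cross term; c weighs the two summands. *)
Lemma dotDD_le n (x y : 'cV[R]_n) (c : R) : 0 < c ->
  dot (x + y) (x + y) <= (1 + c) * dot x x + (1 + c^-1) * dot y y.
Proof.
move=> c0; rewrite /dot !mulr_sumr -big_split; apply: ler_sum => i _ /=; rewrite mxE.
have := mulr_ge0 (ltW c0) (sqr_ge0 (x i 0 - y i 0 / c)).
have -> : c * (x i 0 - y i 0 / c) ^+ 2 =
    c * (x i 0 * x i 0) - 2 * (x i 0 * y i 0) + c^-1 * (y i 0 * y i 0).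
  by field; rewrite gt_eqF.
lra.
Qed.

(** Over one interval energy_bound contracts the squared Lyapunov norm of x - (m - m a)
by the factor r0 < 1; adding back m - m a costs the factor 1 + c. With c = 1 - r0
the product is (1 - c) * (1 + c) = 1 - c ^+ 2 < 1. *)
Lemma recursion d (A : 'M[R]_d) (h : R) : (0 < d)%N -> stable_mx A -> 0 < h ->
  exists (q : 'cV[R]_d -> R) (rho C : R),
    [/\ 0 <= rho < 1, 0 < C, (forall y, 0 <= q y), (forall y, enorm y ^+ 2 <= C * q y) &
    forall xi m x n e, solution_path A xi m x -> 0 <= e -> increment_le h m e n ->
      q (x (n.+1%:R * h)) <= rho * q (x (n%:R * h)) + C * e ^+ 2 /\
      forall t, n%:R * h <= t <= n.+1%:R * h ->
        enorm (x t) ^+ 2 <= C * (q (x (n%:R * h)) + e ^+ 2)].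
Proof.
move=> d0 stA h0; have [k [N [N' [al [al0 N'N lyap]]]]] := lyapunov d0 stA.
pose r0 := expR (- al * h); pose c := 1 - r0.
have r00 : 0 < r0 by exact: expR_gt0.
have c0 : 0 < c by rewrite subr_gt0 expR_lt1 mulNr oppr_lt0 mulr_gt0.
pose kap := fnorm (N *m A) ^+ 2 * d%:R / al ^+ 2.
pose fN := fnorm N ^+ 2 * d%:R; pose fN' := fnorm N' ^+ 2.
have kap0 : 0 <= kap by rewrite divr_ge0 ?sqr_ge0// mulr_ge0 ?sqr_ge0.
have fN0 : 0 <= fN by rewrite mulr_ge0 ?sqr_ge0.
have fN'0 : 0 <= fN' by rewrite sqr_ge0.
have ci0 : 0 <= 1 + c^-1 by rewrite addr_ge0// invr_ge0 ltW.
pose C1 := (1 + c) * kap + (1 + c^-1) * fN.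
have C10 : 0 <= C1 by rewrite addr_ge0// mulr_ge0// addr_ge0// ltW.
pose C2 := 2 * fN' * (1 + kap) + 2 * d%:R.
have C20 : 0 <= C2.
  by apply: addr_ge0; [apply: mulr_ge0; [exact: mulr_ge0|exact: addr_ge0]|exact: mulr_ge0].
have dot0 n (y : 'cV[R]_n) : 0 <= dot y y by rewrite -enorm_sqr sqr_ge0.
have enN y : enorm y ^+ 2 <= fN' * dot (N *m y) (N *m y).
  rewrite -enorm_sqr -exprMn ler_pXn2r ?nnegrE ?mulr_ge0 ?enorm_ge0 ?sqrtr_ge0//.
  by rewrite -{1}[y]mul1mx -N'N -mulmxA enorm_mulmx.
exists (fun y => dot (N *m y) (N *m y)), (1 - c ^+ 2), (1 + C1 + C2 + fN'); split => //.
- have c1 : c <= 1 by rewrite lerBlDr lerDl ltW.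
  by rewrite subr_ge0 exprn_ile1 ?(ltW c0)//= gtrBl exprn_gt0.
- by rewrite ltr_wpDr// ltr_wpDr// ltr_pwDl.
- by move=> y; apply: le_trans (enN y) _; apply: ler_wpM2r => //; lra.
move=> xi m x n e [cx cm hx] e0 inc.
set a := n%:R * h; set b := n.+1%:R * h.
have a0 : 0 <= a by rewrite mulr_ge0// ltW.
have baE : b - a = h by rewrite /a /b -[n.+1]addn1 natrD; ring.
have ab : a <= b by rewrite -subr_ge0 baE ltW.
have me t p : a <= t <= b -> `|m t p 0 - m a p 0| <= e by exact: inc.
have en := energy_bound cx hx al0 lyap a0 e0 me.
have etaN t : a <= t <= b ->
    dot (N *m (m t - m a)) (N *m (m t - m a)) <= fN * e ^+ 2 /\
    enorm (m t - m a) ^+ 2 <= d%:R * e ^+ 2.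
  move=> tab; have e2 : enorm (m t - m a) ^+ 2 <= d%:R * e ^+ 2.
    by apply: enorm_le_coord => p; rewrite !mxE; exact: me.
  split=> //; rewrite -enorm_sqr.
  apply: le_trans (_ : (fnorm N * enorm (m t - m a)) ^+ 2 <= _).
    by rewrite ler_pXn2r ?nnegrE ?mulr_ge0 ?enorm_ge0 ?sqrtr_ge0// enorm_mulmx.
  by rewrite exprMn /fN -mulrA ler_wpM2l ?sqr_ge0.
set Q := dot (N *m x a) (N *m x a) in en *.
have Q0 : 0 <= Q by exact: dot0.
have e20 : 0 <= e ^+ 2 by exact: sqr_ge0.
split.
  have bab : a <= b <= b by rewrite ab lexx.
  have := en _ bab; rewrite baE -/kap -/r0 => Gb.
  have [Nb _] := etaN _ bab.
  have -> : N *m x b = N *m (x b - (m b - m a)) + N *m (m b - m a).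
    by rewrite -mulmxDr subrK.
  apply: le_trans (dotDD_le _ _ c0) _.
  have h1 := ler_wpM2l (addr_ge0 ler01 (ltW c0)) Gb.
  have h2 := ler_wpM2l ci0 Nb.
  have -> : (1 - c ^+ 2) * Q = (1 + c) * (r0 * Q) by rewrite /c; ring.
  have : (1 + c) * (kap * e ^+ 2) + (1 + c^-1) * (fN * e ^+ 2) <= (1 + C1 + C2 + fN') * e ^+ 2.
    have -> : (1 + c) * (kap * e ^+ 2) + (1 + c^-1) * (fN * e ^+ 2) = C1 * e ^+ 2.
      by rewrite /C1; ring.
    by apply: ler_wpM2r => //; lra.
  lra.
move=> t tab; have := en _ tab; rewrite -/kap => Gt.
have [_ et] := etaN _ tab.
have Gt' : dot (N *m (x t - (m t - m a))) (N *m (x t - (m t - m a))) <= Q + kap * e ^+ 2.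
  apply: le_trans Gt _; rewrite lerD2r ler_piMl// expR_le1.
  by rewrite mulNr oppr_le0 mulr_ge0 ?(ltW al0)// subr_ge0; case/andP: tab.
have -> : x t = (x t - (m t - m a)) + (m t - m a) by rewrite subrK.
rewrite enorm_sqr; apply: le_trans (dotDD_le _ _ ltr01) _; rewrite -!enorm_sqr invr1.
have h1 := enN (x t - (m t - m a)).
have h2 := ler_wpM2l fN'0 Gt'.
have h3 : 0 <= fN' * kap * Q by apply: mulr_ge0 => //; exact: mulr_ge0.
have h4 : 0 <= d%:R * Q by exact: mulr_ge0.
have h5 : 0 <= (1 + C1 + fN') * (Q + e ^+ 2).
  by apply: mulr_ge0; [apply: addr_ge0 => //; exact: addr_ge0|exact: addr_ge0].
have h6 : 0 <= fN' * e ^+ 2 by exact: mulr_ge0.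
rewrite /C2; lra.
Qed.

End stability.

(** * From increments to the path *)

Section sequences.
Context {R : realType}.
Implicit Types (a b c : nat -> R) (rho : R).

(** The fixed point of the recursion is beta / (1 - rho); the contribution of the
initial term decays, and is eventually at most as large. *)
Lemma contraction_eventually a rho (beta : R) : 0 <= rho < 1 -> 0 < beta ->
  (\forall n \near \oo, a n.+1 <= rho * a n + beta) ->
  \forall n \near \oo, a n <= 2 * beta / (1 - rho).
Proof.
move=> /andP[r0 r1] b0 [n0 _ rec].
have s0 : 0 < 1 - rho by rewrite subr_gt0.
have bnd k : a (n0 + k)%N <= rho ^+ k * `|a n0| + beta / (1 - rho).
  elim: k => [|k IH].
    rewrite addn0 mul1r; apply: le_trans (ler_norm _) _.
    by rewrite lerDl divr_ge0// ltW.
  rewrite addnS; apply: le_trans (rec _ (leq_addr _ _)) _.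
  apply: le_trans (_ : rho * (rho ^+ k * `|a n0| + beta / (1 - rho)) + beta <= _).
    by rewrite lerD2r ler_wpM2l.
  rewrite exprS le_eqVlt; apply/orP; left; apply/eqP; field.
  by rewrite gt_eqF.
have e0 : 0 < beta / (1 - rho) / (1 + `|a n0|) by rewrite !divr_gt0// ltr_pwDl.
have r1' : `|rho| < 1 by rewrite ger0_norm.
have /cvgrPdist_le/(_ _ e0)[k0 _ Hk] := cvg_expr r1'.
exists (n0 + k0)%N => // n /= nn.
rewrite -(subnKC (leq_trans (leq_addr _ _) nn)).
apply: le_trans (bnd _) _.
have kk : (k0 <= n - n0)%N by rewrite leq_subRL// (leq_trans (leq_addr _ _) nn).
have := Hk _ kk; rewrite sub0r normrN ger0_norm ?exprn_ge0// ler_pdivlMr ?ltr_pwDl// => H.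
have : rho ^+ (n - n0) * `|a n0| <= beta / (1 - rho).
  by apply: le_trans H; rewrite ler_wpM2l ?exprn_ge0// lerDr.
rewrite -[2 * beta / _]mulrA; lra.
Qed.

(** Telescoping, as (1 - rho) * a n <= a n - a n.+1 + b n. *)
Lemma contraction_sum a b rho : (forall n, 0 <= a n) ->
  (forall n, a n.+1 <= rho * a n + b n) ->
  forall N, (1 - rho) * (\sum_(n < N) a n) <= a 0%N + \sum_(n < N) b n.
Proof.
move=> a0 rec N.
suff : (1 - rho) * (\sum_(n < N) a n) + a N <= a 0%N + \sum_(n < N) b n.
  by apply: le_trans; rewrite lerDl.
elim: N => [|N IH]; first by rewrite !big_ord0 mulr0 add0r addr0.
by rewrite !big_ord_recr/=; have := rec N; lra.
Qed.

(** Once the remaining tail of the series of c n / (n + 1) is below dl / 2, the part of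
the sum of c beyond that index is at most N * (dl / 2), as n + 1 <= N there; the
other part is fixed. *)
Lemma kronecker c (K : R) : (forall n, 0 <= c n) ->
  (forall N, \sum_(n < N) n.+1%:R^-1 * c n <= K) ->
  forall dl : R, 0 < dl -> \forall N \near \oo, \sum_(n < N) c n <= dl * N%:R.
Proof.
move=> c0 cK dl dl0; pose s N := \sum_(n < N) n.+1%:R^-1 * c n.
have dl20 : 0 < dl / 2 by rewrite divr_gt0.
have hs : has_sup (range s).
  split; first by exists (s 0%N); exists 0%N.
  by exists K => _ [N _ <-]; exact: cK.
have [_ [m _ <-] sm] := sup_adherent dl20 hs.
have sN N : s N <= sup (range s) by apply: sup_upper_bound => //; exists N.
exists (maxn m (Num.truncn ((\sum_(n < m) c n) / (dl / 2))).+1) => // N /=.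
rewrite geq_max => /andP[mN Nbig].
have head : \sum_(n < m) c n <= dl / 2 * N%:R.
  rewrite mulrC -ler_pdivrMr//; apply: le_trans (ltW (truncnS_gt _)) _.
  by rewrite ler_nat.
have split_sum (f : nat -> R) :
    \sum_(n < N) f n = \sum_(n < m) f n + \sum_(m <= n < N) f n.
  by rewrite -!(big_mkord xpredT) (big_cat_nat _ mN).
have tail : \sum_(m <= n < N) c n <= N%:R * (s N - s m).
  rewrite /s (split_sum (fun n => n.+1%:R^-1 * c n)) addrAC subrr add0r mulr_sumr.
  rewrite big_nat_cond [leRHS]big_nat_cond; apply: ler_sum => n /andP[/andP[_ nN] _].
  by rewrite mulrA ler_peMl// ler_pdivlMr ?ltr0n// mul1r ler_nat.
rewrite split_sum; have := sN N => sN'.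
have : N%:R * (s N - s m) <= N%:R * (dl / 2) by rewrite ler_wpM2l//; lra.
lra.
Qed.

End sequences.

Section path_conclusions.
Context {R : realType}.

(** The infimum of the bounds on the oscillation is attained, since the bounds are
non-strict. Working with this number turns the statements about all e into
statements about one sequence. *)
Lemma best_increment d (h : R) (m : R -> 'cV[R]_d) n : (0 < d)%N -> 0 <= h ->
  {within `[0, +oo[, continuous m} ->
  exists z, [/\ 0 <= z, increment_le h m z n &
    forall e, increment_le h m e n -> z <= e].
Proof.
move=> d0 h0 cm; pose S := [set e | increment_le h m e n].
set a := n%:R * h; set b := n.+1%:R * h.
have a0 : 0 <= a by rewrite mulr_ge0.
have ab : a <= b by rewrite ler_wpM2r// ler_nat.
have S0 : lbound S 0.
  move=> e /(_ a (Ordinal d0)); rewrite lexx ab => /(_ isT).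
  by apply: le_trans.
have Sne : S !=set0.
  pose g p (t : R) := `|m (Num.max 0 t) p 0 - m a p 0|.
  have cg p : continuous (g p).
    move=> t; apply: cvg_norm; apply: cvgB; last exact: cvg_cst.
    apply: (cvg_comp (fun s => m (Num.max 0 s)) (fun M : 'cV[R]_d => M p 0)).
      exact: (continuous_extend cm).
    exact: coord_continuous.
  have /boolp.choice[c Hc] : forall p, exists c, forall t, a <= t <= b -> g p t <= g p c.
    move=> p; have [|c _ Hc] := @EVT_max _ (g p) a b ab.
      exact: continuous_subspaceT.
    by exists c => t tab; apply: Hc; rewrite in_itv.
  exists (\sum_p g p (c p)) => t p tab.
  have t0 : 0 <= t by case/andP: tab => /(le_trans a0).
  have := Hc p t tab; rewrite {1}/g max_r// => /le_trans; apply.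
  by rewrite (bigD1 p)//= lerDl sumr_ge0// => i _; rewrite /g.
have hinf : has_inf S by split => //; exists 0.
exists (inf S); split.
- exact: lb_le_inf.
- by move=> t p tab; apply: lb_le_inf => // e /(_ t p tab).
- by move=> e Se; apply: ge_inf => //; case: hinf.
Qed.

Lemma enorm_sqr_continuous d (x : R -> 'cV[R]_d) : {within `[0, +oo[, continuous x} ->
  continuous (fun s : R => enorm (x (Num.max 0 s)) ^+ 2).
Proof.
move=> cx.
have -> : (fun s => enorm (x (Num.max 0 s)) ^+ 2) =
    (fun s => \sum_(i < d) x (Num.max 0 s) i 0 * x (Num.max 0 s) i 0).
  by apply/funext => s; rewrite enorm_sqr.
apply: continuous_big; first exact: add_continuous.
move=> i _ s.
have ci : {for s, continuous (fun s : R => x (Num.max 0 s) i 0)}.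
  apply: (cvg_comp (fun s => x (Num.max 0 s)) (fun M : 'cV[R]_d => M i 0)).
    exact: (continuous_extend cx).
  exact: coord_continuous.
exact: (cvgM ci ci).
Qed.

Lemma Rintegral_itv_le (f : R -> R) a b c : continuous f -> a <= b ->
  (forall x, a <= x <= b -> f x <= c) ->
  \int[lebesgue_measure]_(x in `[a, b]) f x <= (b - a) * c.
Proof.
move=> cf ab fc.
have -> : (b - a) * c = \int[lebesgue_measure]_(x in `[a, b]) c.
  rewrite Rintegral_cst//= lebesgue_measure_itv/= lte_fin.
  move: ab; rewrite le_eqVlt => /predU1P[->|->]; first by rewrite ltxx subrr mulr0 mul0r.
  by rewrite -EFinB/= mulrC.
apply: le_Rintegral => //; first exact: continuous_itv_integrable.
  by apply: continuous_itv_integrable => x; exact: cvg_cst.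
Qed.

Lemma grid_index (h t : R) k : 0 < h -> k%:R * h <= t ->
  exists2 n, (k <= n)%N & n%:R * h <= t <= n.+1%:R * h.
Proof.
move=> h0 kt; have th0 : 0 <= t / h by rewrite divr_ge0 ?(ltW h0)// (le_trans _ kt)// mulr_ge0// ltW.
have /andP[lo up] := truncn_itv th0.
exists (Num.truncn (t / h)).
  by rewrite truncn_ge_nat// ler_pdivlMr.
by rewrite -ler_pdivlMr// lo -ler_pdivrMr//= ltW.
Qed.

(** The recursion makes q at the grid points eventually at most a multiple of
e ^+ 2, and its second part carries this to the times in between. *)
Lemma path_bound d (A : 'M[R]_d) (h : R) : (0 < d)%N -> stable_mx A -> 0 < h ->
  exists2 D : R, 0 < D & forall xi m x e, solution_path A xi m x -> 0 < e ->
    (\forall n \near \oo, increment_le h m e n) ->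
    exists t0, forall t, t0 <= t -> enorm (x t) <= D * e.
Proof.
move=> d0 stA h0; have [q [rho [C [rho01 C0 q0 xq rec]]]] := recursion d0 stA h0.
have s0 : 0 < 1 - rho by case/andP: rho01 => _; rewrite subr_gt0.
have D20 : 0 < C * (2 * C / (1 - rho) + 1) by rewrite mulr_gt0// addr_gt0// divr_gt0// mulr_gt0.
exists (Num.sqrt (C * (2 * C / (1 - rho) + 1))); first by rewrite sqrtr_gt0.
move=> xi m x e sol e0 inc.
have e20 : 0 < e ^+ 2 by rewrite exprn_gt0.
have := @contraction_eventually R (fun n => q (x (n%:R * h))) rho (C * e ^+ 2) rho01 (mulr_gt0 C0 e20).
have [n0 _ Hinc] := inc.
case; first by exists n0 => // n nn; have [] := rec _ _ _ n e sol (ltW e0) (Hinc n nn).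
move=> n1 _ Hq; exists ((maxn n0 n1)%:R * h) => t kt.
have [n kn tn] := grid_index h0 kt.
have nn0 : (n0 <= n)%N := leq_trans (leq_maxl _ _) kn.
have nn1 : (n1 <= n)%N := leq_trans (leq_maxr _ _) kn.
have [_ /(_ t tn) xt] := rec _ _ _ n e sol (ltW e0) (Hinc n nn0).
rewrite -(ler_pXn2r (n := 2))// ?nnegrE ?enorm_ge0 ?mulr_ge0 ?sqrtr_ge0 ?(ltW e0)//.
rewrite exprMn [X in _ <= X * _]sqr_sqrtr ?(ltW D20)//; apply: le_trans xt _.
rewrite -[leRHS]mulrA ler_pM2l// mulrDl mul1r lerD2r.
by apply: le_trans (Hq n nn1) _; rewrite le_eqVlt; apply/orP; left; apply/eqP; field; rewrite gt_eqF.
Qed.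

End path_conclusions.

Section path_averages.
Context {R : realType}.

(** Up to finitely many n, z n ^+ 2 is at most dl / 3 if the oscillation is small, and
at most e0 ^+ 2 otherwise; the second case has density zero by kronecker. *)
Lemma increments_average d (h : R) (m : R -> 'cV[R]_d) (z : nat -> R) (e0 : R) :
  (forall n, 0 <= z n) -> (forall n, increment_le h m (z n) n) ->
  (forall n e, increment_le h m e n -> z n <= e) -> 0 < e0 ->
  (\forall n \near \oo, increment_le h m e0 n) ->
  (forall e : R, 0 < e -> exists K : R, forall N, \sum_(n < N)
       n.+1%:R^-1 * (~~ `[< increment_le h m e n.+1 >])%:R <= K) ->
  forall dl : R, 0 < dl -> \forall N \near \oo, \sum_(n < N) z n ^+ 2 <= dl * N%:R.
Proof.
move=> z0 incz leastz e00 [n0 _ inc0] rare dl dl0.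
pose e := Num.sqrt (dl / 3).
have dl30 : 0 < dl / 3 by rewrite divr_gt0.
have e_gt0 : 0 < e by rewrite sqrtr_gt0.
have eE : e ^+ 2 = dl / 3 by rewrite sqr_sqrtr// ltW.
pose bad n : R := (~~ `[< increment_le h m e n >])%:R.
have [K HK] := rare e e_gt0.
have e020 : 0 < e0 ^+ 2 by rewrite exprn_gt0.
have dl'0 : 0 < dl / 3 / e0 ^+ 2 by rewrite divr_gt0.
have bad0 n : 0 <= bad n by [].
have [N1 _ Hbad] := @kronecker R (fun n => bad n.+1) K (fun n => bad0 n.+1) HK _ dl'0.
pose H := e0 ^+ 2 + \sum_(n < n0) z n ^+ 2.
have zle n : z n ^+ 2 <= dl / 3 + e0 ^+ 2 * bad n + (if (n < n0)%N then z n ^+ 2 else 0).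
  have [nn|nn] := ltnP n n0.
    by rewrite lerDr addr_ge0 ?(ltW dl30)// mulr_ge0// ltW.
  rewrite addr0 /bad; case: asboolP => [ince|_] /=.
    by rewrite mulr0 addr0 -eE ler_pXn2r ?nnegrE ?(ltW e_gt0)//; exact: leastz.
  rewrite mulr1; apply: (@le_trans _ _ (e0 ^+ 2)); last by rewrite lerDr ltW.
  by rewrite ler_pXn2r ?nnegrE ?(ltW e00)//; apply: leastz; exact: inc0.
exists (maxn N1 (Num.truncn (H / (dl / 3))).+1) => // N /=.
rewrite geq_max => /andP[NN1 NH].
have HN : H <= dl / 3 * N%:R.
  by rewrite mulrC -ler_pdivrMr//; apply: le_trans (ltW (truncnS_gt _)) _; rewrite ler_nat.
apply: le_trans (ler_sum _ (fun (n : 'I_N) _ => zle n)) _.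
rewrite !big_split/= sumr_const card_ord -mulr_sumr.
have s1 : \sum_(n < N) bad n <= 1 + \sum_(n < N) bad n.+1.
  case: N {NN1 NH HN} => [|N]; first by rewrite !big_ord0 addr0.
  rewrite big_ord_recl [in leRHS]big_ord_recr/=.
  have : bad 0%N <= 1 by rewrite /bad; case: (~~ _).
  have := bad0 N.+1; lra.
have s2 : \sum_(n < N) (if (n < n0)%N then z n ^+ 2 else 0) <= \sum_(n < n0) z n ^+ 2.
  rewrite -(big_mkord xpredT (fun n => if (n < n0)%N then z n ^+ 2 else 0)) -big_mkcond/=.
  rewrite -(big_mkord xpredT (fun n => z n ^+ 2)).
  have [Nn|Nn] := leqP N n0.
    rewrite (big_cat_nat _ Nn)//= [leLHS]big_nat_cond [X in _ <= X + _]big_nat_cond.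
    have E : forall i, (0 <= i < N)%N && (i < n0)%N = (0 <= i < N)%N && true.
      by move=> i; rewrite andbT; case: (ltnP i N) => //= iN; rewrite (leq_trans iN Nn).
    by rewrite (eq_bigl _ _ E) lerDl sumr_ge0// => i _; rewrite sqr_ge0.
  rewrite (big_cat_nat _ (ltnW Nn))//= [X in _ + X <= _]big_nat_cond [X in _ + X <= _]big_pred0 ?addr0.
    by rewrite [leLHS]big_nat_cond [leRHS]big_nat_cond; rewrite le_eqVlt; apply/orP; left; apply/eqP; apply: eq_bigl => i; rewrite andbT; case: (i < n0)%N; rewrite ?andbT ?andbF.
  by move=> i; case: (ltnP i n0); rewrite ?andbF// => iN; rewrite leqNgt iN.
have := ler_wpM2l (ltW e020) s1; rewrite mulrDr mulr1.
have := ler_wpM2l (ltW e020) (Hbad N NN1).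
have -> : e0 ^+ 2 * (dl / 3 / e0 ^+ 2 * N%:R) = dl / 3 * N%:R by field; rewrite gt_eqF.
rewrite -[dl / 3 *+ N]mulr_natr; move: HN; rewrite /H; lra.
Qed.

(** The recursion is linear, so the averages of q at the grid points inherit the
convergence to 0 from the averages of z ^+ 2, and the integral of
enorm (x s) ^+ 2 over each interval is at most C * h * (a n + z n ^+ 2). If x stayed
above e from some time on, the averages of q could not tend to 0. *)
Lemma path_average d (A : 'M[R]_d) (h : R) xi m x e0 : (0 < d)%N -> stable_mx A -> 0 < h ->
  solution_path A xi m x -> 0 < e0 ->
  (\forall n \near \oo, increment_le h m e0 n) ->
  (forall e : R, 0 < e -> exists K : R, forall N, \sum_(n < N)
       n.+1%:R^-1 * (~~ `[< increment_le h m e n.+1 >])%:R <= K) ->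
  (t^-1 * (\int[lebesgue_measure]_(s in `[0, t]) enorm (x s) ^+ 2) @[t --> +oo] --> (0 : R)) /\
  (forall e t0 : R, 0 < e -> exists2 t, t0 <= t & enorm (x t) <= e).
Proof.
move=> d0 stA h0 sol e00 inc0 rare.
have [q [rho [C [rho01 C0 q0 xq rec]]]] := recursion d0 stA h0.
have s0 : 0 < 1 - rho by case/andP: rho01 => _; rewrite subr_gt0.
have [cx cm _] := sol.
have /boolp.choice[z Hz] := fun n => best_increment n d0 (ltW h0) cm.
have z0 n : 0 <= z n by have [] := Hz n.
have incz n : increment_le h m (z n) n by have [] := Hz n.
have zavg := increments_average z0 incz (fun n => let: And3 _ _ H := Hz n in H) e00 inc0 rare.
pose a n := q (x (n%:R * h)).
have a0 n : 0 <= a n by exact: q0.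
have stepa n : a n.+1 <= rho * a n + C * z n ^+ 2.
  by have [] := rec _ _ _ n (z n) sol (z0 n) (incz n).
have Wavg dl : 0 < dl -> \forall N \near \oo, \sum_(n < N) (a n + z n ^+ 2) <= dl * N%:R.
  move=> dl0; pose K1 := C / (1 - rho) + 1.
  have K10 : 0 < K1 by rewrite addr_gt0// divr_gt0.
  have dl'0 : 0 < dl / 2 / K1 by rewrite !divr_gt0.
  have [N1 _ HN1] := zavg _ dl'0.
  exists (maxn N1 (Num.truncn (a 0%N / (1 - rho) / (dl / 2))).+1) => // N /=.
  rewrite geq_max => /andP[NN1 Na].
  have dl20 : 0 < dl / 2 by rewrite divr_gt0.
  have HN : a 0%N / (1 - rho) <= dl / 2 * N%:R.
    by rewrite [leRHS]mulrC -ler_pdivrMr//; apply: le_trans (ltW (truncnS_gt _)) _; rewrite ler_nat.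
  rewrite big_split/=; have := contraction_sum a0 stepa N.
  rewrite -mulr_sumr mulrC -ler_pdivlMr// => sa.
  have := ler_wpM2l (ltW K10) (HN1 N NN1).
  have -> : K1 * (dl / 2 / K1 * N%:R) = dl / 2 * N%:R by field; rewrite gt_eqF.
  move: sa; rewrite mulrDl /K1; lra.
pose f s := enorm (x (Num.max 0 s)) ^+ 2.
have cf : continuous f by exact: enorm_sqr_continuous.
have f0 s : 0 <= f s by exact: sqr_ge0.
have JN N : \int[lebesgue_measure]_(s in `[0, N%:R * h]) f s <= h * C * \sum_(n < N) (a n + z n ^+ 2).
  elim: N => [|N IH]; first by rewrite big_ord0 mulr0 mul0r set_itv1 Rintegral_set1.
  have N0 : 0 <= N%:R * h by rewrite mulr_ge0// ltW.
  have NN : N%:R * h <= N.+1%:R * h by rewrite ler_pM2r// ler_nat.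
  rewrite (Rintegral_itv_split cf N0 NN) big_ord_recr/= mulrDr lerD//.
  have E : N.+1%:R * h - N%:R * h = h by rewrite -[N.+1]addn1 natrD; ring.
  apply: (@le_trans _ _ ((N.+1%:R * h - N%:R * h) * (C * (a N + z N ^+ 2)))); last by rewrite E mulrA.
  apply: Rintegral_itv_le => // s sN.
  have [_ /(_ s sN)] := rec _ _ _ N (z N) sol (z0 N) (incz N).
  by rewrite /f max_r//; case/andP: sN => /(le_trans N0).
split.
  apply/cvgrPdist_le => e e_gt0.
  have dl0 : 0 < e / (2 * C) by rewrite divr_gt0// mulr_gt0.
  have [N0 _ HN0] := Wavg _ dl0.
  exists (N0.+1%:R * h); split; first exact: num_real.
  move=> t /ltW tN /=; have [n nn /andP[nt tn]] := grid_index h0 tN.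
  have n0 : 0 < n%:R * h by rewrite mulr_gt0// ltr0n (leq_trans _ nn).
  have t0 : 0 < t := lt_le_trans n0 nt.
  have -> : \int[lebesgue_measure]_(s in `[0, t]) enorm (x s) ^+ 2 =
      \int[lebesgue_measure]_(s in `[0, t]) f s.
    by apply: eq_Rintegral => s; rewrite inE/= in_itv/= => /andP[s_ge0 _]; rewrite /f max_r.
  rewrite sub0r normrN ger0_norm; last first.
    by rewrite mulr_ge0 ?invr_ge0 ?(ltW t0)// Rintegral_ge0.
  rewrite mulrC ler_pdivrMr//.
  apply: (@le_trans _ _ (\int[lebesgue_measure]_(s in `[0, n.+1%:R * h]) f s)).
    by rewrite (Rintegral_itv_split cf (ltW t0) tn) lerDl Rintegral_ge0.
  apply: le_trans (JN _) _.
  have := ler_wpM2l (ltW (mulr_gt0 h0 C0)) (HN0 n.+1 (leq_trans (leqnSn _) (leqW nn))).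
  move/le_trans; apply.
  have -> : h * C * (e / (2 * C) * n.+1%:R) = e * (n.+1%:R * h / 2) by field; rewrite gt_eqF.
  rewrite ler_pM2l//; apply: le_trans nt; rewrite ler_pdivrMr// mulrAC ler_pM2r//.
  by rewrite -natrM ler_nat muln2 -addnn -addn1 leq_add2l (leq_trans _ nn).
move=> e t0 e_gt0; apply: contrapT => /forall2NP nt.
have big t : t0 <= t -> e < enorm (x t).
  by move=> tt; have [//|/negP] := nt t; rewrite -ltNge.
have eta0 : 0 < e ^+ 2 / C by rewrite divr_gt0// exprn_gt0.
have [N1 _ HN1] := Wavg _ (divr_gt0 eta0 (ltr0n _ 2)).
pose n1 := (Num.truncn (t0 / h)).+1.
have abig n : (n1 <= n)%N -> e ^+ 2 / C <= a n.
  move=> nn; rewrite ler_pdivrMr// mulrC; apply: le_trans (xq _).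
  rewrite ler_pXn2r ?nnegrE ?enorm_ge0 ?(ltW e_gt0)//; apply/ltW/big.
  rewrite -ler_pdivrMr//; apply: le_trans (ltW (truncnS_gt _)) _; by rewrite ler_nat.
pose N := (N1 + n1 + n1).+1.
have := HN1 N; rewrite /= /N ltnW ?ltnS -?addnA ?leq_addr// => /(_ isT).
apply/negP; rewrite -ltNge addnA -/N.
have NE : N = (n1 + (N1 + n1).+1)%N by rewrite /N addnS; congr _.+1; rewrite addnC.
rewrite NE big_split_ord/=.
apply: (@lt_le_trans _ _ (\sum_(i < (N1 + n1).+1) (e ^+ 2 / C))).
  rewrite sumr_const card_ord -[ltRHS]mulr_natr -NE.
  have -> : e ^+ 2 / C / 2 * N%:R = e ^+ 2 / C * (N%:R / 2).
    by move: (e ^+ 2 / C) => eta; field.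
  rewrite ltr_pM2l// ltr_pdivrMr//.
  by rewrite -natrM ltr_nat; lia.
rewrite -[leLHS]add0r lerD//.
  by apply: sumr_ge0 => i _; rewrite addr_ge0// sqr_ge0.
apply: ler_sum => i _; have := abig (n1 + i)%N (leq_addr _ _).
by move=> /le_trans; apply; rewrite lerDl sqr_ge0.
Qed.

(** The increment of m is the increment of x minus the integral of A *m x, and both
are bounded in terms of K. *)
Lemma path_lower d (A : 'M[R]_d) (h : R) : 0 < h ->
  exists2 D : R, 0 < D & forall xi m x K n, solution_path A xi m x -> 0 <= K ->
    (forall t, n%:R * h <= t <= n.+1%:R * h -> enorm (x t) <= K) ->
    enorm (m (n.+1%:R * h) - m (n%:R * h)) <= D * K.
Proof.
move=> h0; pose D := 2 + Num.sqrt d%:R * (h * fnorm A).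
have D0 : 0 < D by rewrite ltr_pwDl// mulr_ge0 ?sqrtr_ge0// mulr_ge0 ?sqrtr_ge0// ltW.
exists D => // xi m x K n [cx cm hx] K0 xK.
set a := n%:R * h in xK *; set b := n.+1%:R * h in xK *.
have a0 : 0 <= a by rewrite mulr_ge0// ltW.
have baE : b - a = h by rewrite /a /b -[n.+1]addn1 natrD; ring.
have ab : a <= b by rewrite -subr_ge0 baE ltW.
have b0 := le_trans a0 ab.
pose V := vint (fun s => A *m x s) b - vint (fun s => A *m x s) a.
have -> : m b - m a = x b - x a - V.
  by rewrite /V !hx//; apply/matrixP => i j; rewrite !mxE; ring.
have VK : enorm V <= Num.sqrt d%:R * (h * fnorm A) * K.
  have hAK : 0 <= h * fnorm A * K by rewrite !mulr_ge0 ?sqrtr_ge0// ltW.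
  rewrite -mulrA -(ler_pXn2r (n := 2))// ?nnegrE ?enorm_ge0 ?mulr_ge0 ?sqrtr_ge0 ?(ltW h0)//.
  rewrite exprMn [X in _ <= X * _]sqr_sqrtr//; apply: enorm_le_coord => p.
  pose g s := (A *m x (Num.max 0 s)) p 0.
  have cg : continuous g.
    have -> : g = (fun s => \sum_j A p j * x (Num.max 0 s) j 0).
      by apply/funext => s; rewrite /g mxE.
    apply: continuous_big; first exact: add_continuous.
    move=> j _ s; apply: cvgM; first exact: cvg_cst.
    apply: (cvg_comp (fun s => x (Num.max 0 s)) (fun M : 'cV[R]_d => M j 0)).
      exact: (continuous_extend cx).
    exact: coord_continuous.
  have E t : 0 <= t -> \int[lebesgue_measure]_(s in `[0, t]) (A *m x s) p 0 =
      \int[lebesgue_measure]_(s in `[0, t]) g s.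
    by move=> t0; apply: eq_Rintegral => s; rewrite inE/= in_itv/= => /andP[s0 _]; rewrite /g max_r.
  rewrite !mxE E// E// (Rintegral_itv_split cg a0 ab) addrAC subrr add0r.
  have := @Rintegral_itv_dist _ g a b 0 (fnorm A * K) cg ab.
  rewrite mulr0 sub0r normrN baE mulrA; apply=> s sab.
  have s0 : 0 <= s by case/andP: sab => /(le_trans a0).
  rewrite sub0r normrN /g max_r//; apply: le_trans (coord_le_enorm _ _) _.
  apply: le_trans (enorm_mulmx _ _) _; apply: ler_wpM2l; first exact: sqrtr_ge0.
  exact: xK.
have xa : enorm (x a) <= K by apply: xK; rewrite lexx ab.
have xb : enorm (x b) <= K by apply: xK; rewrite lexx ab.
have := enormB (x b - x a) V; have := enormB (x b) (x a).
rewrite /D mulrDl; lra.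
Qed.

End path_averages.

(** * Limits superior and inferior, and the solution *)

Section limit_points.
Context {R : realType}.

Lemma limf_esup_le (f : R -> \bar R) t0 (c : \bar R) : (forall t, t0 <= t -> (f t <= c)%E) ->
  (limf_esup f +oo%R <= c)%E.
Proof.
move=> fc; apply: (@le_trans _ _ (ereal_sup (f @` [set t | t0 < t]))).
  apply: ereal_inf_lbound; exists [set t | t0 < t] => //.
  by exists t0; split => //; exact: num_real.
by apply: ge_ereal_sup => _ [t /= /ltW t0t <-]; exact: fc.
Qed.

Lemma le_limf_esup (f : R -> \bar R) (c : \bar R) :
  (forall t0, exists2 t, t0 <= t & (c <= f t)%E) -> (c <= limf_esup f +oo%R)%E.
Proof.
move=> fc; apply: le_ereal_inf_tmp => _ [V [t0 [_ Vt0]] <-].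
have [t t0t cft] := fc (t0 + 1); apply: le_trans cft _.
apply: ereal_sup_ubound; exists t => //; apply: Vt0.
by apply: lt_le_trans t0t; rewrite ltrDl.
Qed.

Lemma limf_einf_eq0 (f : R -> \bar R) : (forall t, (0 <= f t)%E) ->
  (forall e t0 : R, 0 < e -> exists2 t, t0 <= t & (f t <= e%:E)%E) ->
  limf_einf f +oo%R = 0%E.
Proof.
move=> f0 fe; apply/eqP; rewrite eq_le; apply/andP; split; rewrite limf_einfE.
  apply: ge_ereal_sup => _ [V [t0 [_ Vt0]] <-].
  apply/lee_addgt0Pr => e e0; rewrite add0e.
  have [t t0t fte] := fe e (t0 + 1) e0; apply: le_trans fte.
  apply: ereal_inf_lbound; exists t => //; apply: Vt0.
  by apply: lt_le_trans t0t; rewrite ltrDl.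
apply: (@le_trans _ _ (ereal_inf (f @` setT))).
  by apply: le_ereal_inf_tmp => _ [t _ <-].
by apply: ereal_sup_ubound; exists setT => //; exact: filterT.
Qed.

(** Convergence of column vectors refers to the maximum norm, which the Euclidean norm
dominates. *)
Lemma enorm_cvg0 d (x : R -> 'cV[R]_d) :
  (forall e, 0 < e -> exists t0, forall t, t0 <= t -> enorm (x t) <= e) ->
  x t @[t --> +oo] --> (0 : 'cV[R]_d).
Proof.
move=> xe; apply/cvgrPdist_le => e e0; have [t0 Ht] := xe e e0.
exists t0; split; first exact: num_real.
move=> t /ltW t0t; rewrite /= sub0r normrN [leLHS]/Num.norm/= mx_normrE.
apply: bigmax_le; first exact: ltW.
move=> [i j] _ /=; rewrite ord1; apply: le_trans (coord_le_enorm _ _) _.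
exact: Ht.
Qed.

End limit_points.

Section conclusion.
Context {R : realType} {disp : measure_display} {T : measurableType disp}.
Variable P : probability T R.
Variables (F : R -> set (set T)) (hF : filtration F).
Variables (d r : nat) (d_gt0 : (0 < d)%N).
Variables (B : R -> T -> 'cV[R]_r) (hB : brownian_motion P F B).
Variables (sigma : R -> 'M[R]_(d, r)).
Hypothesis csigma : {within `[0, +oo[, continuous sigma}.
Variables (h : R) (h0 : 0 < h) (A : 'M[R]_d).
Variables (xi : 'cV[R]_d) (X : R -> T -> 'cV[R]_d).
Hypothesis hX : sde_solution P F A sigma B xi X.

Let v i := quadvar sigma (i%:R * h) (i.+1%:R * h).

Lemma quadvarE (a b : R) : 0 <= a ->
  (\int[lebesgue_measure]_(s in `[a, b]) (fnorm (sigma s) ^+ 2)%:E = (quadvar sigma a b)%:E)%E.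
Proof.
move=> a0; rewrite /quadvar /Rintegral fineK.
  apply: eq_integral => s; rewrite inE/= in_itv/= => /andP[/(le_trans a0) s0 _].
  by rewrite max_r.
apply: integrable_fin_num => //; apply: continuous_itv_integrable.
exact: fnorm_sqr_continuous.
Qed.

Lemma sde_path : exists2 M : R -> T -> 'cV[R]_d,
  (forall t, 0 <= t -> is_wiener_integral P sigma B t (M t)) &
  {ae P, forall w, solution_path A xi (fun t => M t w) (fun t => X t w)}.
Proof.
have [cX _ [M [cM hM eqX]]] := hX; exists M => //.
by move: cX cM eqX; apply: filterS3 => w cx cm hx; split.
Qed.

Lemma sde_small_increments (e c : R) : 0 < e -> 0 < c -> 16 * c <= e ^+ 2 ->
  (\forall n \near \oo, v n * ln n%:R < c) ->
  {ae P, forall w, exists2 m, solution_path A xi m (fun t => X t w) &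
     \forall n \near \oo, increment_le h m e n}.
Proof.
move=> e0 c0 ce vc; have [M hM sol] := sde_path.
have := small_increments hF hB csigma hM h0 e0 c0 ce vc.
move: sol; apply: filterS2 => w sol inc; exists (fun t => M t w) => //.
by apply: inc; case: sol.
Qed.

(** The exceptional null sets of rare_increments depend on e, so e runs through the
inverses of the positive integers. *)
Lemma sde_averages (c : R) : stable_mx A -> 0 < c ->
  (\forall n \near \oo, v n * ln n%:R < c) ->
  {ae P, forall w,
    (t^-1 * (\int[lebesgue_measure]_(s in `[0, t]) enorm (X s w) ^+ 2)
      @[t --> +oo] --> (0 : R)) /\
    (forall e t0 : R, 0 < e -> exists2 t, t0 <= t & enorm (X t w) <= e)}.
Proof.
move=> stA c0 vc; have [M hM sol] := sde_path.
pose e0 := Num.sqrt (16 * c).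
have c16 : 0 < 16 * c by rewrite mulr_gt0.
have e00 : 0 < e0 by rewrite sqrtr_gt0.
have ce : 16 * c <= e0 ^+ 2 by rewrite sqr_sqrtr// ltW.
have inc := small_increments hF hB csigma hM h0 e00 c0 ce vc.
have rare : {ae P, forall w, forall k, {within `[0, +oo[, continuous (fun t => M t w)} ->
     exists K : R, forall N, \sum_(n < N)
       n.+1%:R^-1 * (~~ `[< increment_le h (fun t => M t w) k.+1%:R^-1 n.+1 >])%:R <= K}.
  apply: ae_foralln => k; apply: (rare_increments hF hB csigma hM h0 _ c0 vc).
  by rewrite invr_gt0.
move: sol inc rare; apply: filterS3 => w sol inc rare.
have cM : {within `[0, +oo[, continuous (fun t => M t w)} by case: sol.
apply: (path_average d_gt0 stA h0 sol e00 (inc cM)) => e1 e10.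
have [k _ ke] : exists2 k, True & k.+1%:R^-1 <= e1.
  exists (Num.truncn e1^-1) => //; rewrite -[leRHS]invrK lef_pV2 ?posrE ?invr_gt0//.
  exact/ltW/truncnS_gt.
have [K HK] := rare k cM; exists K => N; apply: le_trans (HK N).
apply: ler_sum => n _; rewrite ler_wpM2l ?invr_ge0//.
case: (asboolP (increment_le h _ e1 _)) => [//|ninc] /=.
by rewrite asboolF//= => inck; apply: ninc => t p tp; exact: le_trans (inck t p tp) ke.
Qed.

(** A path which stays below K from some time on has increments at most D * K over all
later intervals, while increments larger than D * K occur infinitely often for
y = 2 * D * K. The hypothesis on v also yields v n > 0. *)
Lemma sde_excursions (D : R) :
  (forall xi m x K n, solution_path A xi m x -> 0 <= K ->
    (forall t, n%:R * h <= t <= n.+1%:R * h -> enorm (x t) <= K) ->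
    enorm (m (n.+1%:R * h) - m (n%:R * h)) <= D * K) -> 0 < D ->
  forall c K : R, 0 < c -> 0 < K -> 16 * d%:R * (2 * D * K) ^+ 2 <= c ->
  (\forall n \near \oo, c < v n * ln n%:R) ->
  {ae P, forall w, forall t0, exists2 t, t0 <= t & K <= enorm (X t w)}.
Proof.
move=> lower D0 c K c0 K0 dc [n0 _ vc]; have [M hM sol] := sde_path.
have y0 : 0 < 2 * D * K by rewrite !mulr_gt0.
have vn0 i : (n0 <= i)%N -> 0 < v i /\ 16 * d%:R * (2 * D * K) ^+ 2 <= v i * ln i%:R.
  move=> /vc /= ci; split; last exact: le_trans dc (ltW ci).
  have ln_nat_ge0 : 0 <= ln (i%:R : R).
    by case: (i) => [|j]; [rewrite ln0|rewrite ln_ge0// ler1n].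
  rewrite ltNge; apply: contraL (lt_trans c0 ci) => vi0.
  by rewrite -leNgt mulr_le0_ge0.
have := wiener_io hF d_gt0 hB csigma hM h0 y0 vn0.
move: sol; apply: filterS2 => w sol large t0.
pose k := (Num.truncn (t0 / h)).+1.
have t0k : t0 <= k%:R * h by rewrite -ler_pdivrMr//; exact/ltW/truncnS_gt.
have [i ki] := large k; apply: contraPP => /forall2NP small; apply/negP; rewrite -leNgt.
have -> : 2 * D * K / 2 = D * K by field.
apply: (lower _ _ _ _ _ sol (ltW K0)) => t /andP[it _].
have [nt|/negP] := small t; last by rewrite -ltNge => /ltW.
case: nt; apply: le_trans t0k (le_trans _ it).
by rewrite ler_pM2r// ler_nat.
Qed.

End conclusion.

Theorem theorem10 (R : realType) (disp : measure_display)
    (T : measurableType disp) (P : probability T R)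
    (F : R -> set (set T)) (hF : filtration F)
    (d r : nat) (hd : (0 < d)%N) (hr : (0 < r)%N)
    (B : R -> T -> 'cV[R]_r) (hB : brownian_motion P F B)
    (sigma : R -> 'M[R]_(d, r))
    (hsigma : {within `[0, +oo[, continuous sigma})
    (h : R) (hh : 0 < h) (L : \bar R) (hL0 : (0 <= L)%E)
    (hL : ((\int[lebesgue_measure]_(s in `[(n%:R * h)%R, (n.+1%:R * h)%R])
               (fnorm (sigma s) ^+ 2)%:E) * (ln n%:R)%:E)%E
            @[n --> \oo] --> L)
    (A : 'M[R]_d) (hA : stable_mx A)
    (X : 'cV[R]_d -> R -> T -> 'cV[R]_d)
    (hX : forall xi : 'cV[R]_d, sde_solution P F A sigma B xi (X xi)) :
  (L = 0%E ->
     forall xi : 'cV[R]_d,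
       {ae P, forall w, X xi t w @[t --> +oo] --> (0 : 'cV[R]_d)}) /\
  ((0 < L < +oo)%E ->
     exists c1 c2 : R, (0 < c1 /\ c1 <= c2) /\
       forall xi : 'cV[R]_d,
         [/\ {ae P, forall w,
                (c1%:E <= limf_esup (fun t : R => (enorm (X xi t w))%:E) +oo%R
                  /\ limf_esup (fun t : R => (enorm (X xi t w))%:E) +oo%R
                       <= c2%:E)%E},
             {ae P, forall w,
                limf_einf (fun t : R => (enorm (X xi t w))%:E) +oo%R = 0%E} &
             {ae P, forall w,
                t^-1 * (\int[lebesgue_measure]_(s in `[0, t])
                          enorm (X xi s w) ^+ 2)
                  @[t --> +oo] --> (0 : R)}]) /\
  (L = +oo%E ->
     forall xi : 'cV[R]_d,
       {ae P, forall w,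
          limf_esup (fun t : R => (enorm (X xi t w))%:E) +oo%R = +oo%E}).
Proof.
pose v (n : nat) := quadvar sigma (n%:R * h) (n.+1%:R * h).
have vL : (v n * ln n%:R)%:E @[n --> \oo] --> L.
  move: hL; under eq_fun do rewrite quadvarE ?mulr_ge0 ?(ltW hh)//.
  by [].
have v_lt c : (L < c%:E)%E -> \forall n \near \oo, v n * ln n%:R < c.
  move=> Lc; have : \forall n \near \oo, ((v n * ln n%:R)%:E < c%:E)%E by exact: vL (open_ereal_lt' Lc).
  by apply: filterS => n; rewrite lte_fin.
have v_gt c : (c%:E < L)%E -> \forall n \near \oo, c < v n * ln n%:R.
  move=> Lc; have : \forall n \near \oo, (c%:E < (v n * ln n%:R)%:E)%E by exact: vL (open_ereal_gt' Lc).
  by apply: filterS => n; rewrite lte_fin.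
have [D D0 upper] := path_bound hd hA hh.
have [D' D'0 lower] := path_lower A hh.
have d0 : 0 < d%:R :> R by rewrite ltr0n.
split; [move=> L0 xi|split; [move=> /andP[L0 Loo]|move=> Loo xi]].
- have small : {ae P, forall w, forall k, exists2 m,
      solution_path A xi m (fun t => X xi t w) &
      \forall n \near \oo, increment_le h m k.+1%:R^-1 n}.
    apply: ae_foralln => k; have k0 : 0 < k.+1%:R^-1 :> R by rewrite invr_gt0.
    have c0 : 0 < k.+1%:R^-1 ^+ 2 / 16 :> R by rewrite divr_gt0// exprn_gt0.
    apply: (sde_small_increments hF hB hsigma hh (hX xi) k0 c0).
      by rewrite mulrC divfK.
    by apply: v_lt; rewrite L0 lte_fin.
  move: small; apply: filterS => w small; apply: enorm_cvg0 => e e0.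
  have eD0 : 0 < e / D by rewrite divr_gt0.
  pose k := Num.truncn (e / D)^-1.
  have [m sol inc] := small k.
  have k0 : 0 < k.+1%:R^-1 :> R by rewrite invr_gt0.
  have [t0 Ht] := upper _ _ _ _ sol k0 inc.
  exists t0 => t /Ht /le_trans; apply; rewrite mulrC -ler_pdivlMr//.
  rewrite -[leRHS]invrK lef_pV2 ?posrE ?invr_gt0//.
  exact/ltW/truncnS_gt.
- case: L {hL hL0} vL v_lt v_gt L0 Loo => // l _ v_lt v_gt; rewrite lte_fin => l0 _.
  have l10 : 0 < l + 1 by rewrite addr_gt0.
  have vl1 := v_lt (l + 1) (ltac:(by rewrite lte_fin ltrDl)).
  have vl2 := v_gt (l / 2) (ltac:(by rewrite lte_fin ltr_pdivrMr// ltr_pMr// ltr1n)).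
  have c160 : 0 < 16 * (l + 1) by rewrite mulr_gt0.
  (* The smallest e allowed by the threshold l + 1. *)
  pose e := Num.sqrt (16 * (l + 1)).
  have e0 : 0 < e by rewrite sqrtr_gt0.
  have ce : 16 * (l + 1) <= e ^+ 2 by rewrite sqr_sqrtr// ltW.
  (* This K solves 16 * d%:R * (2 * D' * K) ^+ 2 = l / 2, the condition for
     excursions above K when v n * ln n%:R > l / 2. *)
  pose K := Num.sqrt (l / (128 * d%:R)) / D'.
  have K0 : 0 < K by rewrite divr_gt0// sqrtr_gt0 divr_gt0// mulr_gt0.
  have Kl : 16 * d%:R * (2 * D' * K) ^+ 2 <= l / 2.
    have -> : 2 * D' * K = 2 * Num.sqrt (l / (128 * d%:R)).
      by rewrite /K; field; rewrite gt_eqF.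
    rewrite exprMn sqr_sqrtr ?divr_ge0 ?mulr_ge0// ?(ltW l0)//.
    by rewrite le_eqVlt; apply/orP; left; apply/eqP; field; rewrite gt_eqF.
  exists K, (Num.max (D * e) K); split; first by split; rewrite // le_max lexx orbT.
  move=> xi; have avg := sde_averages hF hd hB hsigma hh (hX xi) hA l10 vl1.
  split.
  + have inc := sde_small_increments hF hB hsigma hh (hX xi) e0 l10 ce vl1.
    have exc := sde_excursions hF hd hB hsigma hh (hX xi) lower D'0 (divr_gt0 l0 (ltr0Sn _ 1)) K0 Kl vl2.
    move: inc exc; apply: filterS2 => w [m sol inc] exc; split.
      apply: le_limf_esup => t0; have [t t0t Kt] := exc t0.
      by exists t; rewrite // lee_fin.
    have [t0 Ht] := upper _ _ _ _ sol e0 inc.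
    apply: (@limf_esup_le _ _ t0) => t /Ht Dt.
    by rewrite lee_fin le_max Dt.
  + move: avg; apply: filterS => w [_ low]; apply: limf_einf_eq0 => [t|e1 t0 e10].
      by rewrite lee_fin enorm_ge0.
    by have [t t0t te] := low e1 t0 e10; exists t; rewrite // lee_fin.
  + by move: avg; apply: filterS => w [].
- have exc : {ae P, forall w, forall k t0, exists2 t, t0 <= t & k.+1%:R <= enorm (X xi t w)}.
    apply: ae_foralln => k; pose c := 16 * d%:R * (2 * D' * k.+1%:R) ^+ 2.
    have c0 : 0 < c by rewrite !mulr_gt0// exprn_gt0// !mulr_gt0.
    apply: (sde_excursions hF hd hB hsigma hh (hX xi) lower D'0 c0) => //.
    by apply: v_gt; rewrite Loo ltry.
  move: exc; apply: filterS => w exc; apply/eqyP => y y0.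
  pose k := Num.truncn y.
  apply: (@le_trans _ _ k.+1%:R%:E); first by rewrite lee_fin; exact/ltW/truncnS_gt.
  apply: le_limf_esup => t0; have [t t0t Kt] := exc k t0.
  by exists t; rewrite // lee_fin.
Qed.
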